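(* Let $\epsilon\in(0,1)$ and assume $p_{\max}=\max_jp_j$ is given as part of the input. There is a two-pass $(1+\epsilon)$-approximation streaming algorithm for $P_m\mid \text{stream, share},\ e_{i,k}\ge e_0 \text{ for } i\le m_1\mid C_{\max}$ which takes $O(1)$ time to process each job in both the first and the second pass, uses $O\big(\tilde n+\frac{m^2}{\epsilon e_0 m_1}\log\frac{m}{\epsilon e_0}\big)$ space, and $O\big(\tilde n+t_1(m,m_1,\tilde n,\epsilon,e_0)\big)$ time, and returns a schedule of all jobs with makespan at most $(1+\epsilon)C^*_{\max}$, where $$t_1(m,m_1,\tilde n,\epsilon,e_0)= m^{O\left(\frac{m^2}{\epsilon e_0 m_1}\log\frac{m}{\epsilon e_0 m_1}\right)}\cdot\log\!\Big(\tfrac1\epsilon\log\tfrac{m}{e_0}\Big)\cdot\sum_{i=1}^m\log k_i .$$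
   Context: Problem: $m$ identical parallel machines $M_1,\dots,M_m$ ($m$ a constant) and $n$ primary jobs with processing times $p_1,\dots,p_n>0$, all available at time $0$. The time axis of each machine $M_i$ is partitioned into consecutive intervals $(0,t_{i,1}],(t_{i,1},t_{i,2}],\dots$ (sorted) with sharing ratios $e_{i,1},e_{i,2},\dots\in(0,1]$; in an interval with ratio $e$ the machine processes primary jobs at rate $e$. Machine $M_i$ has $k_i$ shared intervals ($O(k_i)$ intervals in total), $\tilde n=\sum_i k_i$. Integers $1\le m_1\le m-1$ and a constant $e_0\in(0,1]$ are given with $e_{i,k}\ge e_0$ for all intervals of $M_1,\dots,M_{m_1}$; other ratios arbitrary in $(0,1]$. Each job is processed on one machine without interruption, one job at a time per machine; a job completes when its received processing equals $p_j$. Objective: minimize the makespan $C_{\max}=\max_jC_j$; $C^*_{\max}$ is the optimum. Streaming model (''stream''): the machine data and parameters are known in advance; the processing times arrive one by one as a stream whose length $n$ is not known in advance; each pass reads the stream once in order, with limited memory. *)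

(* Defs.v *)
From Stdlib Require Import Reals List Arith ZArith Sorted.
Import ListNotations.
Open Scope R_scope.

(** * The scheduling problem *)

Definition sum_list (l : list R) : R := fold_right Rplus 0 l.

(* Maximum of a list of nonnegative reals; 0 on the empty list. *)
Definition max_list (l : list R) : R := fold_right Rmax 0 l.

(* [intervals] lists (t_1, e_1), ..., (t_r, e_r): ratio e_k on (t_{k-1}, t_k],
   with t_0 = 0.  The last interval (t_r, +oo) has ratio [last_ratio]. *)
Record machine := Machine {
  intervals : list (R * R);
  last_ratio : R }.

Definition ratios (M : machine) : list R :=
  map snd (intervals M) ++ [last_ratio M].

Definition num_intervals (M : machine) : nat := length (ratios M).

(* k_i: an interval is shared when primary jobs do not get the full rate. *)
Definition num_shared (M : machine) : nat :=
  length (filter (fun e => if Rlt_dec e 1 then true else false) (ratios M)).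

Definition valid_machine (M : machine) : Prop :=
  StronglySorted Rlt (0 :: map fst (intervals M)) /\
  Forall (fun e => 0 < e <= 1) (ratios M).

Fixpoint work_from (s : R) (l : list (R * R)) (e_last t : R) : R :=
  match l with
  | [] => e_last * Rmax 0 (t - s)
  | (u, e) :: l' => e * Rmax 0 (Rmin t u - s) + work_from u l' e_last t
  end.

(* Amount of primary work that M can process during (0, t]. *)
Definition work (M : machine) (t : R) : R :=
  work_from 0 (intervals M) (last_ratio M) t.

Definition nth_machine (Ms : list machine) (i : nat) : machine :=
  nth i Ms (Machine [] 1).

(* Jobs and machines are numbered from 0; only the values at j < n matter.
   Job j occupies machine [machine_of j] during (start j, completion j]. *)
Record schedule := Schedule {
  machine_of : nat -> nat;
  start : nat -> R;
  completion : nat -> R }.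

Definition feasible (Ms : list machine) (p : list R) (s : schedule) : Prop :=
  (forall j, (j < length p)%nat ->
     (machine_of s j < length Ms)%nat /\
     0 <= start s j <= completion s j /\
     work (nth_machine Ms (machine_of s j)) (completion s j)
       - work (nth_machine Ms (machine_of s j)) (start s j) = nth j p 0) /\
  (forall j j', (j < length p)%nat -> (j' < length p)%nat -> j <> j' ->
     machine_of s j = machine_of s j' ->
     completion s j <= start s j' \/ completion s j' <= start s j).

Definition makespan (p : list R) (s : schedule) : R :=
  max_list (map (completion s) (seq 0 (length p))).

Definition optimal_makespan (Ms : list machine) (p : list R) (C : R) : Prop :=
  (exists s, feasible Ms p s /\ makespan p s = C) /\
  (forall s, feasible Ms p s -> C <= makespan p s).

(* The schedule given by a stream of machine numbers: every machine runs its
   jobs in stream order and without idle time. *)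
Definition realizes (sigma : list nat) (s : schedule) : Prop :=
  forall j, (j < length sigma)%nat ->
    machine_of s j = nth j sigma 0%nat /\
    start s j =
      max_list (map (completion s)
        (filter (fun j' => (machine_of s j' =? machine_of s j)%nat) (seq 0 j))).

(** * Real RAM

    A unit-cost random access machine whose memory cells hold real numbers,
    programmed with structured commands.  A program contains only integer
    constants, so it cannot carry problem-dependent advice. *)

Definition memory := nat -> R.

Inductive arith := Add | Sub | Mul | Div.

Inductive expr :=
| Cst (z : Z)
| Fetch (a : expr)
| Op (o : arith) (a b : expr).

Inductive cmd :=
| Skip
| Store (a e : expr)
| Seq (c1 c2 : cmd)
| IfLt (a b : expr) (c1 c2 : cmd)
| WhileLt (a b : expr) (c : cmd).

(* Addresses are integer parts of nonnegative reals and must lie below the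
   space bound [sp].  There is no other rounding operation, so integer parts
   are available only for numbers below [sp]. *)
Definition address (sp : nat) (x : R) : option nat :=
  if Rle_dec 0 x then
    let a := Z.to_nat (Int_part x) in
    if (a <? sp)%nat then Some a else None
  else None.

Definition eval_arith (o : arith) (x y : R) : option R :=
  match o with
  | Add => Some (x + y)
  | Sub => Some (x - y)
  | Mul => Some (x * y)
  | Div => if Req_EM_T y 0 then None else Some (x / y)
  end.

(* [None] is a crash: a division by zero or an access outside the space. *)
Fixpoint eval (sp : nat) (mem : memory) (e : expr) : option R :=
  match e with
  | Cst z => Some (IZR z)
  | Fetch a =>
      match eval sp mem a with
      | Some x => option_map mem (address sp x)
      | None => None
      end
  | Op o a b =>
      match eval sp mem a, eval sp mem b with
      | Some x, Some y => eval_arith o x y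
      | _, _ => None
      end
  end.

Fixpoint cost (e : expr) : nat :=
  match e with
  | Cst _ => 1
  | Fetch a => S (cost a)
  | Op _ a b => S (cost a + cost b)
  end.

Definition update (mem : memory) (a : nat) (v : R) : memory :=
  fun b => if (b =? a)%nat then v else mem b.

(* [exec sp c mem t mem']: started on [mem], the command [c] halts after t
   elementary steps with memory [mem'], using only the cells 0, ..., sp - 1. *)
Inductive exec (sp : nat) : cmd -> memory -> nat -> memory -> Prop :=
| exec_Skip mem : exec sp Skip mem 0 mem
| exec_Store a e mem x l v :
    eval sp mem a = Some x -> address sp x = Some l ->
    eval sp mem e = Some v ->
    exec sp (Store a e) mem (1 + cost a + cost e) (update mem l v)
| exec_Seq c1 c2 mem t1 mem1 t2 mem2 :
    exec sp c1 mem t1 mem1 -> exec sp c2 mem1 t2 mem2 ->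
    exec sp (Seq c1 c2) mem (t1 + t2) mem2
| exec_IfLt_true a b c1 c2 mem x y t mem' :
    eval sp mem a = Some x -> eval sp mem b = Some y -> x < y ->
    exec sp c1 mem t mem' ->
    exec sp (IfLt a b c1 c2) mem (1 + cost a + cost b + t) mem'
| exec_IfLt_false a b c1 c2 mem x y t mem' :
    eval sp mem a = Some x -> eval sp mem b = Some y -> y <= x ->
    exec sp c2 mem t mem' ->
    exec sp (IfLt a b c1 c2) mem (1 + cost a + cost b + t) mem'
| exec_WhileLt_true a b c mem x y t1 mem1 t2 mem2 :
    eval sp mem a = Some x -> eval sp mem b = Some y -> x < y ->
    exec sp c mem t1 mem1 -> exec sp (WhileLt a b c) mem1 t2 mem2 ->
    exec sp (WhileLt a b c) mem (1 + cost a + cost b + t1 + t2) mem2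
| exec_WhileLt_false a b c mem x y :
    eval sp mem a = Some x -> eval sp mem b = Some y -> y <= x ->
    exec sp (WhileLt a b c) mem (1 + cost a + cost b) mem.

(** * Two-pass streaming algorithms *)

Record two_pass_algorithm := TwoPass {
  before : cmd;       (* before the stream is read *)
  on_job1 : cmd;      (* on each job of the first pass *)
  between : cmd;      (* between the two passes *)
  on_job2 : cmd }.    (* on each job of the second pass *)

(* One pass over the stream, at most [d] steps per job.  Each processing time
   is delivered in cell 0, and the content of cell 0 once the job has been
   handled is emitted. *)
Inductive pass (sp d : nat) (c : cmd) :
  memory -> list R -> list R -> memory -> Prop :=
| pass_nil mem : pass sp d c mem [] [] mem
| pass_cons mem pj p t mem1 out mem2 :
    exec sp c (update mem 0 pj) t mem1 -> (t <= d)%nat ->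
    pass sp d c mem1 p out mem2 ->
    pass sp d c mem (pj :: p) (mem1 0%nat :: out) mem2.

Definition encode_machine (M : machine) : list R :=
  INR (length (intervals M)) :: last_ratio M ::
  flat_map (fun te => [fst te; snd te]) (intervals M).

Definition encode_input
  (m1 : nat) (e0 eps pmax : R) (Ms : list machine) : list R :=
  [0; eps; e0; INR (length Ms); INR m1; pmax] ++ flat_map encode_machine Ms.

(* On the data [input] known in advance and the stream [p], the algorithm
   uses [sp] cells (input included), at most [d] steps per job in either pass
   and [t] steps outside the passes, and assigns the jobs to the machines
   [sigma].  The emissions of the first pass are ignored. *)
Inductive run (A : two_pass_algorithm) (input p : list R)
  (sp d t : nat) (sigma : list nat) : Prop :=
| run_intro ta tb mem1 mem2 mem3 mem4 out :
    (length input <= sp)%nat ->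
    exec sp (before A) (fun a => nth a input 0) ta mem1 ->
    pass sp d (on_job1 A) mem1 p out mem2 ->
    exec sp (between A) mem2 tb mem3 ->
    pass sp d (on_job2 A) mem3 p (map INR sigma) mem4 ->
    t = (ta + tb)%nat ->
    run A input p sp d t sigma.

(** * Resource bounds *)

(* Logarithm in asymptotic bounds: base 2, and at least 1, since a bound such
   as O(log k) is not meant to vanish at k = 1. *)
Definition lg (x : R) : R := Rmax 1 (ln x / ln 2).

Definition total_shared (Ms : list machine) : R :=
  sum_list (map (fun M => INR (num_shared M)) Ms).

Definition space_bound (m m1 : nat) (n_shared eps e0 : R) : R :=
  n_shared + INR m ^ 2 / (eps * e0 * INR m1) * lg (INR m / (eps * e0)).

(* t_1, with [K] the constant hidden by the O in the exponent. *)
Definition t1_bound (K : R) (m m1 : nat) (Ms : list machine) (eps e0 : R) : R :=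
  Rpower (INR m)
    (K * (INR m ^ 2 / (eps * e0 * INR m1) * lg (INR m / (eps * e0 * INR m1))))
  * lg (1 / eps * lg (INR m / e0))
  * sum_list (map (fun M => lg (INR (num_shared M))) Ms).

(* Main.v *)
(** Let [P] be the total processing time, [delta = eps P / (2 m)] and
    [s = eps e0 m1 P / (2 m^2)].  Jobs longer than [s] are big; there are at most
    [1 / q = 2 m^2 / (eps e0 m1)] of them.  The first pass keeps a job [p] if it is longer
    than [q] times the work seen so far and than [q pmax]: every kept job multiplies the
    work by at least [1 + q] and the work never exceeds [pmax / q] when a job is kept, so
    only [O((1 / q) log (1 / q))] jobs are kept, and all big jobs are among them.

    Between the passes the makespans [T = delta, 2 delta, ...] are tried.  One pointer per
    machine moves monotonically through its intervals and yields the work [W_i(T)].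
    Machine [i] gets the capacity [W_i(T) + X] with [X = e0 delta] if [i < m1], and
    [W_i(T)] otherwise.  A guess is accepted if [P <= sum_i W_i(T)] and some assignment of
    the big jobs, found by counting in base [m], respects the capacities.  This holds for
    every [T] that is at least the optimum, and for every [T >= P / e0] because the first
    machine alone can then do all the work; hence [O(m / (eps e0))] guesses suffice.

    In the second pass the small jobs fill the machines by next fit.  Each machine that is
    left wastes less than [s] of its capacity, which costs at most [m s = m1 X] in total,
    exactly the capacity added to the fast machines.  The schedule ends by [T + delta]
    since [X] takes time at most [delta] on a fast machine, and [delta <= (eps / 2) C*]
    because [P <= m C*]. *)

Require Import Defs.
From Stdlib Require Import Reals List Arith ZArith Sorted Lia Lra.
(* [Defs] again, since [List.Add] shadows the instruction [Add]. *)
Import ListNotations Defs.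
Open Scope R_scope.

(** * Work and schedules *)

(** The constants are fixed backwards. The result may exceed the optimum by two steps of the grid,
    one from the optimum to the accepted guess and one for the time that the extra capacity takes;
    with [P <= m C*] this leads to [delta = eps P / (2 m)]. A fast machine does at least [e0 delta]
    work in time [delta], which is [X], and solving [m s = m1 X] gives [s].

    The obstacle of the first pass is that [s = q P] is unknown before its end. The work seen so far
    underestimates [P], so testing against it never loses a big job, but early in the stream it is a
    poor estimate and arbitrarily many jobs of growing size could pass. As [pmax <= P] is known,
    [q pmax] is a second safe threshold, and it confines the growth of the work to the range from
    [q pmax] to [pmax / q].

    Time is counted with credits: a single guess may move a pointer through many intervals, and only
    the sum over all guesses is bounded by the input. Programs are verified on an abstract state of
    registers and tables, so that addresses appear only in the basic rules. *)

Fixpoint rising (s : R) (l : list (R * R)) : Prop :=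
  match l with
  | [] => True
  | (u, _) :: l' => s < u /\ rising u l'
  end.

Lemma rising_sorted s l : StronglySorted Rlt (s :: map fst l) -> rising s l.
Proof.
  revert s; induction l as [|[u e] l IH]; simpl; intros s H; [trivial|].
  apply StronglySorted_inv in H as [H1 H2].
  inversion H2; subst; split; auto.
Qed.

Lemma work_from_zero s l el t : rising s l -> t <= s -> work_from s l el t = 0.
Proof.
  revert s; induction l as [|[u e] l IH]; simpl; intros s H Ht.
  - rewrite Rmax_left by lra; ring.
  - destruct H as [H1 H2]. rewrite IH by (auto; lra).
    pose proof (Rmin_l t u). rewrite Rmax_left by lra. ring.
Qed.

Lemma work_from_past s u e l el t : s <= u <= t ->
  work_from s ((u, e) :: l) el t = e * (u - s) + work_from u l el t.
Proof.
  intros H; simpl. rewrite Rmin_right by lra. rewrite Rmax_right by lra. ring.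
Qed.

Lemma work_from_within s u e l el t : rising s ((u, e) :: l) -> s <= t <= u ->
  work_from s ((u, e) :: l) el t = e * (t - s).
Proof.
  intros [H1 H2] H; simpl. rewrite (work_from_zero u) by (auto; lra).
  rewrite Rmin_left by lra. rewrite Rmax_right by lra. ring.
Qed.

(** All facts about speed come from this one slope bound: with [b = 1] and [a] the least ratio it
    gives strict monotonicity and [work M t <= t], with [a = e0] the guaranteed speed of a fast
    machine. *)
Lemma work_from_growth a b s l el t1 t2 : rising s l ->
  Forall (fun e => a <= e <= b) (map snd l ++ [el]) -> s <= t1 <= t2 ->
  a * (t2 - t1) <= work_from s l el t2 - work_from s l el t1 <= b * (t2 - t1).
Proof.
  revert s t1; induction l as [|[u e] l IH]; intros s t1 H HF Ht.
  - simpl in *. inversion HF; subst.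
    rewrite !Rmax_right by lra. nra.
  - inversion HF as [|? ? He HF']; subst. simpl fst in *; simpl snd in *.
    destruct (Rle_dec t2 u) as [h|h].
    + rewrite !work_from_within by (auto; lra). nra.
    + destruct (Rle_dec t1 u) as [h'|h'].
      * rewrite (work_from_within _ _ _ _ _ t1) by (auto; lra).
        destruct H as [H1 H2].
        rewrite work_from_past by lra.
        destruct (IH u u H2 HF') as [I1 I2]; [lra|].
        rewrite (work_from_zero u l el u) in I1, I2 by (auto; lra). nra.
      * destruct H as [H1 H2]. rewrite !work_from_past by lra.
        destruct (IH u t1 H2 HF') as [I1 I2]; [lra|]. lra.
Qed.

Lemma work_growth a b M t1 t2 : valid_machine M ->
  Forall (fun e => a <= e <= b) (ratios M) -> 0 <= t1 <= t2 ->
  a * (t2 - t1) <= work M t2 - work M t1 <= b * (t2 - t1).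
Proof.
  intros [H _] HF Ht. apply work_from_growth; auto using rising_sorted.
Qed.

Lemma work_0 M : valid_machine M -> work M 0 = 0.
Proof. intros [H _]. apply work_from_zero; [auto using rising_sorted | lra]. Qed.

(** The machines beyond the first [m1] have no common lower bound on their speed, but each has
    finitely many ratios, whose minimum is positive. This makes every work function strictly
    increasing. *)
Lemma ratios_bounded_below M : valid_machine M ->
  exists a, 0 < a /\ Forall (fun e => a <= e <= 1) (ratios M).
Proof.
  intros [_ H]. induction H as [|x l Hx H [a [Ha IH]]].
  - exists 1; split; [lra | constructor].
  - exists (Rmin a x). split; [apply Rmin_glb_lt; lra|]. constructor.
    + split; [apply Rmin_r | lra].
    + eapply Forall_impl; [|apply IH]. intros y Hy; simpl in Hy.
      pose proof (Rmin_l a x); lra.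
Qed.

Lemma work_le M t : valid_machine M -> 0 <= t -> work M t <= t.
Proof.
  intros H Ht. destruct (ratios_bounded_below M H) as [a [Ha HF]].
  pose proof (work_growth a 1 M 0 t H HF). rewrite (work_0 M) in H0 by auto. lra.
Qed.

Lemma work_lower a M t : valid_machine M -> Forall (fun e => a <= e) (ratios M) ->
  0 <= t -> forall d, 0 <= d -> work M t + a * d <= work M (t + d).
Proof.
  intros H HF Ht d Hd.
  assert (HF' : Forall (fun e => a <= e <= 1) (ratios M)).
  { rewrite Forall_forall in *. destruct H as [_ H]. rewrite Forall_forall in H.
    intros x Hx; split; [auto | apply H; auto]. }
  pose proof (work_growth a 1 M t (t + d) H HF'). lra.
Qed.

Lemma work_strict M t1 t2 : valid_machine M -> 0 <= t1 < t2 -> work M t1 < work M t2.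
Proof.
  intros H Ht. destruct (ratios_bounded_below M H) as [a [Ha HF]].
  pose proof (work_growth a 1 M t1 t2 H HF). nra.
Qed.

Lemma work_mono M t1 t2 : valid_machine M -> 0 <= t1 <= t2 -> work M t1 <= work M t2.
Proof.
  intros H Ht. destruct (Req_dec t1 t2); [subst; lra|].
  left; apply work_strict; auto; lra.
Qed.

Lemma work_nonneg M t : valid_machine M -> 0 <= t -> 0 <= work M t.
Proof. intros H Ht. rewrite <- (work_0 M) by auto. apply work_mono; auto; lra. Qed.

(** Inverse of [work_from], followed segment by segment: the time at which the work reaches [w]. It
    exists for every [w] because the last interval is unbounded and has a positive ratio. *)
Fixpoint finish_from (s : R) (l : list (R * R)) (el w : R) : R :=
  match l with
  | [] => s + w / el
  | (u, e) :: l' =>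
      if Rle_dec w (e * (u - s)) then s + w / e
      else finish_from u l' el (w - e * (u - s))
  end.

Definition finish (M : machine) (w : R) : R :=
  finish_from 0 (intervals M) (last_ratio M) w.

Lemma finish_from_spec s l el w : rising s l ->
  Forall (fun e => 0 < e <= 1) (map snd l ++ [el]) -> 0 <= w ->
  s <= finish_from s l el w /\ work_from s l el (finish_from s l el w) = w.
Proof.
  revert s w; induction l as [|[u e] l IH]; intros s w H HF Hw.
  - simpl in *. inversion HF; subst.
    assert (0 <= w / el) by (apply Rle_mult_inv_pos; lra).
    split; [lra|]. rewrite Rmax_right by lra. field; lra.
  - inversion HF as [|? ? He HF']; subst. simpl snd in *.
    simpl finish_from. destruct (Rle_dec w (e * (u - s))) as [h|h].
    + assert (0 <= w / e) by (apply Rle_mult_inv_pos; lra).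
      assert (w / e <= u - s).
      { apply Rmult_le_reg_l with e; [lra|]. replace (e * (w / e)) with w by (field; lra). lra. }
      split; [lra|]. rewrite work_from_within by (auto; lra). field; lra.
    + destruct H as [H1 H2]. destruct (IH u (w - e * (u - s)) H2 HF') as [I1 I2]; [lra|].
      split; [lra|]. rewrite work_from_past by lra. lra.
Qed.

Lemma finish_spec M w : valid_machine M -> 0 <= w ->
  0 <= finish M w /\ work M (finish M w) = w.
Proof. intros [H1 H2] Hw. apply finish_from_spec; auto using rising_sorted. Qed.

Lemma finish_le M w t : valid_machine M -> 0 <= w -> 0 <= t -> w <= work M t ->
  finish M w <= t.
Proof.
  intros H Hw Ht Hwt. destruct (finish_spec M w H Hw) as [H1 H2].
  destruct (Rle_dec (finish M w) t); [auto|].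
  pose proof (work_strict M t (finish M w) H). lra.
Qed.

Lemma finish_mono M w1 w2 : valid_machine M -> 0 <= w1 <= w2 ->
  finish M w1 <= finish M w2.
Proof.
  intros H Hw. destruct (finish_spec M w2 H) as [H1 H2]; [lra|].
  apply finish_le; auto; lra.
Qed.

Lemma finish_0 M : valid_machine M -> finish M 0 = 0.
Proof.
  intros H. apply Rle_antisym.
  - apply finish_le; auto; try lra. rewrite work_0 by auto; lra.
  - apply finish_spec; auto; lra.
Qed.

Lemma max_list_nonneg l : 0 <= max_list l.
Proof. induction l; simpl; [lra|]. eapply Rle_trans; [exact IHl | apply Rmax_r]. Qed.

Lemma max_list_snoc l x : 0 <= x -> max_list (l ++ [x]) = Rmax (max_list l) x.
Proof.
  intros Hx; induction l as [|y l IH]; simpl.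
  - rewrite Rmax_left, Rmax_right by lra; auto.
  - change (fold_right Rmax 0 (l ++ [x])) with (max_list (l ++ [x])).
    rewrite IH, Rmax_assoc. reflexivity.
Qed.

Lemma max_list_le l b : 0 <= b -> (forall x, In x l -> x <= b) -> max_list l <= b.
Proof.
  intros Hb; induction l as [|y l IH]; simpl; intros H; [auto|].
  apply Rmax_lub; [apply H; auto | apply IH; auto].
Qed.

Lemma max_list_ge l x : In x l -> x <= max_list l.
Proof.
  induction l as [|y l IH]; simpl; intros H; [tauto|].
  destruct H as [->|H]; [apply Rmax_l|].
  eapply Rle_trans; [apply IH; auto | apply Rmax_r].
Qed.

(** * Loads and the schedule of an assignment *)

Fixpoint load (i : nat) (p : list R) (sigma : list nat) : R :=
  match p, sigma with
  | x :: p', k :: sigma' => (if (k =? i)%nat then x else 0) + load i p' sigma'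
  | _, _ => 0
  end.

Lemma load_nonneg i p sigma : Forall (fun x => 0 < x) p -> 0 <= load i p sigma.
Proof.
  intros H; revert sigma; induction H as [|x p Hx H IH]; intros [|k sigma]; simpl; try lra.
  specialize (IH sigma). destruct (k =? i)%nat; lra.
Qed.

Lemma load_snoc i p sigma x k : length p = length sigma ->
  load i (p ++ [x]) (sigma ++ [k]) = load i p sigma + (if (k =? i)%nat then x else 0).
Proof.
  revert sigma; induction p as [|y p IH]; intros [|h sigma] E; simpl in *; try lia.
  - lra.
  - rewrite IH by lia. lra.
Qed.

Lemma load_firstn_S i p sigma j : length p = length sigma -> (j < length p)%nat ->
  load i (firstn (S j) p) (firstn (S j) sigma) =
  load i (firstn j p) (firstn j sigma) + (if (nth j sigma 0%nat =? i)%nat then nth j p 0 else 0).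
Proof.
  revert sigma j; induction p as [|y p IH]; intros [|h sigma] [|j] E Hj; simpl in *; try lia.
  - lra.
  - specialize (IH sigma j). simpl in IH. rewrite IH by lia. lra.
Qed.

Fixpoint sum_below (f : nat -> R) (n : nat) : R :=
  match n with O => 0 | S n' => sum_below f n' + f n' end.

Lemma sum_below_le f g n : (forall i, (i < n)%nat -> f i <= g i) ->
  sum_below f n <= sum_below g n.
Proof.
  induction n as [|n IH]; simpl; intros H; [lra|].
  apply Rplus_le_compat; [apply IH; intros; apply H; lia | apply H; lia].
Qed.

Lemma sum_below_plus f g n :
  sum_below (fun i => f i + g i) n = sum_below f n + sum_below g n.
Proof. induction n as [|n IH]; simpl; lra. Qed.

Lemma sum_below_ext f g n : (forall i, (i < n)%nat -> f i = g i) ->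
  sum_below f n = sum_below g n.
Proof.
  intros H; apply Rle_antisym; apply sum_below_le; intros; rewrite H; auto; lra.
Qed.

Lemma sum_below_const c n : sum_below (fun _ => c) n = INR n * c.
Proof. induction n as [|n IH]; [simpl; lra|]. rewrite S_INR. simpl. lra. Qed.

Lemma sum_below_single k x n : (k < n)%nat ->
  sum_below (fun i => if (k =? i)%nat then x else 0) n = x.
Proof.
  induction n as [|n IH]; intros H; [lia|]. simpl.
  destruct (Nat.eqb_spec k n) as [->|h].
  - rewrite (sum_below_ext _ (fun _ => 0)).
    + rewrite sum_below_const. lra.
    + intros i Hi. destruct (Nat.eqb_spec n i); [lia | auto].
  - rewrite IH by lia. lra.
Qed.

Lemma sum_load m p sigma : length p = length sigma ->
  Forall (fun k => (k < m)%nat) sigma ->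
  sum_below (fun i => load i p sigma) m = sum_list p.
Proof.
  intros E H; revert p E; induction H as [|k sigma Hk H IH]; intros [|x p] E; simpl in *; try lia.
  - rewrite sum_below_const; lra.
  - rewrite sum_below_plus, sum_below_single, IH by (auto; lia). reflexivity.
Qed.

Section FromAssignment.

Variables (Ms : list machine) (p : list R) (sigma : list nat).
Hypothesis valid : Forall valid_machine Ms.
Hypothesis len : length p = length sigma.
Hypothesis pos : Forall (fun x => 0 < x) p.
Hypothesis range : Forall (fun k => (k < length Ms)%nat) sigma.

Let mach j := nth j sigma 0%nat.
Let used i j := load i (firstn j p) (firstn j sigma).

(** A machine without idle time has done exactly the load of its earlier jobs when the next one
    starts, so start and completion are the inverse images of two consecutive prefix loads. *)
Definition list_schedule : schedule :=
  Schedule mach (fun j => finish (nth_machine Ms (mach j)) (used (mach j) j))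
                (fun j => finish (nth_machine Ms (mach j)) (used (mach j) (S j))).

Lemma valid_nth i : (i < length Ms)%nat -> valid_machine (nth_machine Ms i).
Proof. intros H. eapply Forall_nth in valid; eauto. Qed.

Lemma mach_range j : (j < length p)%nat -> (mach j < length Ms)%nat.
Proof. intros H. unfold mach. eapply Forall_nth in range; eauto. lia. Qed.

Lemma used_nonneg i j : 0 <= used i j.
Proof. apply load_nonneg. rewrite <- (firstn_skipn j p) in pos. apply Forall_app in pos. tauto. Qed.

Lemma used_S i j : (j < length p)%nat ->
  used i (S j) = used i j + (if (mach j =? i)%nat then nth j p 0 else 0).
Proof. intros H. unfold used. apply load_firstn_S; auto. Qed.

Lemma used_mono i j j' : (j <= j' <= length p)%nat -> used i j <= used i j'.
Proof.
  intros [H H']. induction H as [|j' H IH]; [lra|].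
  rewrite used_S by lia. specialize (IH ltac:(lia)).
  assert (0 < nth j' p 0) by (eapply Forall_nth in pos; eauto; lia).
  destruct (mach j' =? i)%nat; lra.
Qed.

Lemma list_schedule_realizes : realizes sigma list_schedule.
Proof.
  intros j Hj. split; [reflexivity|]. cbn [start machine_of completion list_schedule].
  assert (Hm : (mach j < length Ms)%nat) by (apply mach_range; lia).
  (* The machine is decoupled from [j], since the induction runs over prefixes of the stream, whose
     last job may belong to another machine. *)
  set (i := mach j) in *. clearbody i.
  pose proof (valid_nth i Hm) as Hv. rewrite <- len in Hj.
  assert (Hj' : (j <= length p)%nat) by lia. clear Hj.
  induction j as [|j IH].
  - simpl. unfold used. simpl. apply finish_0; auto.
  - rewrite seq_S, filter_app, map_app. simpl.
    pose proof (used_nonneg i j). pose proof (used_nonneg i (S j)).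
    pose proof (used_mono i j (S j) ltac:(lia)).
    destruct (Nat.eqb_spec (mach j) i) as [E|E].
    + simpl. rewrite max_list_snoc.
      * rewrite <- IH by lia. rewrite E. rewrite Rmax_right; [reflexivity|].
        apply finish_mono; auto.
      * rewrite E. apply finish_spec; auto.
    + simpl. rewrite app_nil_r, <- IH by lia. f_equal. rewrite used_S by lia.
      destruct (Nat.eqb_spec (mach j) i); [tauto | lra].
Qed.

Lemma list_schedule_feasible : feasible Ms p list_schedule.
Proof.
  split.
  - intros j Hj. cbn [machine_of start completion list_schedule]. pose proof (mach_range j Hj) as Hm.
    pose proof (valid_nth _ Hm) as Hv.
    pose proof (used_nonneg (mach j) j). pose proof (used_nonneg (mach j) (S j)).
    pose proof (used_mono (mach j) j (S j) ltac:(lia)).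
    split; [auto|]. split; [split|].
    + apply finish_spec; auto.
    + apply finish_mono; auto.
    + destruct (finish_spec _ _ Hv H) as [_ ->]. destruct (finish_spec _ _ Hv H0) as [_ ->].
      rewrite used_S, Nat.eqb_refl by auto. lra.
  - assert (W : forall j j', (j < j')%nat -> (j' < length p)%nat -> mach j = mach j' ->
                completion list_schedule j <= start list_schedule j').
    { intros j j' H Hj' E. cbn [machine_of start completion list_schedule]. rewrite E.
      apply finish_mono; [apply valid_nth, mach_range; auto|].
      split; [apply used_nonneg | apply used_mono; lia]. }
    intros j j' Hj Hj' Hne E. cbn [machine_of list_schedule] in E.
    destruct (Nat.lt_ge_cases j j'); [left | right]; apply W; auto; lia.
Qed.

Lemma list_schedule_makespan t : 0 <= t ->
  (forall i, (i < length Ms)%nat -> load i p sigma <= work (nth_machine Ms i) t) ->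
  makespan p list_schedule <= t.
Proof.
  intros Ht H. apply max_list_le; auto. intros x Hx.
  apply in_map_iff in Hx as [j [<- Hj]]. apply in_seq in Hj.
  pose proof (mach_range j ltac:(lia)) as Hm.
  cbn [machine_of start completion list_schedule].
  apply finish_le; auto using valid_nth, used_nonneg.
  eapply Rle_trans; [|apply H; auto].
  replace (load (mach j) p sigma) with (used (mach j) (length p)).
  - apply used_mono; lia.
  - unfold used. rewrite firstn_all. rewrite len, firstn_all. reflexivity.
Qed.

End FromAssignment.

(** * Loads in an arbitrary feasible schedule *)

Lemma sum_list_app l l' : sum_list (l ++ l') = sum_list l + sum_list l'.
Proof.
  induction l as [|x l IH]; simpl; [lra|].
  change (fold_right Rplus 0 (l ++ l')) with (sum_list (l ++ l')). rewrite IH.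
  unfold sum_list; lra.
Qed.

Lemma exists_last_completion (c : nat -> R) j js :
  exists k, In k (j :: js) /\ forall k', In k' (j :: js) -> c k' <= c k.
Proof.
  revert j; induction js as [|j' js IH]; intros j.
  - exists j; simpl; split; [auto|]. intros k' [->|[]]; lra.
  - destruct (IH j') as [k [H1 H2]]. destruct (Rle_dec (c j) (c k)).
    + exists k; split; [right; auto|]. intros k' [->|H]; auto.
    + exists j; split; [left; auto|]. intros k' [->|H]; [lra|].
      specialize (H2 k' H); lra.
Qed.

(* Remove the job that completes last: all the others complete before it starts. *)
Lemma disjoint_work (f a c w : nat -> R) (g : R -> R) js t :
  (forall x y, 0 <= x <= y -> g x <= g y) -> g 0 = 0 -> 0 <= t -> NoDup js ->
  (forall j, In j js -> 0 <= a j < c j /\ c j <= t /\ w j = g (c j) - g (a j)) ->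
  (forall j j', In j js -> In j' js -> j <> j' -> c j <= a j' \/ c j' <= a j) ->
  sum_list (map w js) <= g t.
Proof.
  intros Hg Hg0. remember (length js) as n eqn:En. revert js t En.
  induction n as [|n IH]; intros js t En Ht Hnd Hj Hd.
  - destruct js; [|discriminate]. simpl. rewrite <- Hg0. apply Hg; lra.
  - destruct js as [|j0 js0]; [discriminate|].
    destruct (exists_last_completion c j0 js0) as [k [Hk Hmax]].
    set (js := j0 :: js0) in *. clearbody js. clear j0 js0.
    destruct (in_split _ _ Hk) as [l1 [l2 ->]].
    destruct (Hj k Hk) as [K1 [K2 K3]].
    assert (I : sum_list (map w (l1 ++ l2)) <= g (a k)).
    { assert (Sub : forall j, In j (l1 ++ l2) -> In j (l1 ++ k :: l2) /\ j <> k).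
      { intros j Hin. split.
        - rewrite in_app_iff in *; simpl; tauto.
        - intros ->. apply NoDup_remove_2 in Hnd. auto. }
      apply IH.
      - rewrite length_app in *; simpl in *; lia.
      - lra.
      - eapply NoDup_remove_1; eauto.
      - intros j Hin. destruct (Sub j Hin) as [S1 S2].
        destruct (Hj j S1) as [J1 [J2 J3]]. repeat split; try tauto; try lra.
        destruct (Hd j k S1 Hk S2) as [h|h]; [auto|].
        specialize (Hmax j S1). lra.
      - intros j j' Hin Hin'. apply Hd; apply Sub; auto. }
    rewrite map_app, sum_list_app in *. simpl.
    change (fold_right Rplus 0 (map w l2)) with (sum_list (map w l2)).
    assert (g (c k) <= g t) by (apply Hg; lra). lra.
Qed.

Lemma load_filter i p f : load i p (map f (seq 0 (length p))) =
  sum_list (map (fun j => nth j p 0) (filter (fun j => (f j =? i)%nat) (seq 0 (length p)))).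
Proof.
  induction p as [|x p IH] using rev_ind; [reflexivity|].
  rewrite length_app, Nat.add_1_r, seq_S, map_app, filter_app, map_app, sum_list_app.
  simpl. rewrite load_snoc by (rewrite length_map, length_seq; auto).
  rewrite IH. f_equal.
  - f_equal. apply map_ext_in. intros j Hj. apply filter_In in Hj as [Hj _].
    apply in_seq in Hj. rewrite app_nth1 by lia. auto.
  - destruct (f (length p) =? i)%nat; simpl; [|lra].
    rewrite nth_middle. lra.
Qed.

(** Idle time and the order of the jobs are arbitrary here: the occupation intervals on machine [i]
    are disjoint and lie in [(0, t]], so the work done in them is at most that of the machine. It is
    applied to an optimal schedule. *)
Lemma feasible_load Ms p s t i : Forall valid_machine Ms ->
  Forall (fun x => 0 < x) p -> feasible Ms p s -> makespan p s <= t ->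
  (i < length Ms)%nat ->
  load i p (map (machine_of s) (seq 0 (length p))) <= work (nth_machine Ms i) t.
Proof.
  intros Hv Hp [Hf Hd] Ht Hi.
  assert (V : valid_machine (nth_machine Ms i)) by (eapply Forall_nth in Hv; eauto).
  pose proof (max_list_nonneg (map (completion s) (seq 0 (length p)))) as M0.
  unfold makespan in Ht.
  rewrite load_filter. apply disjoint_work with (a := start s) (c := completion s).
  - exact (start s).
  - intros; apply work_mono; auto.
  - apply work_0; auto.
  - lra.
  - apply NoDup_filter, seq_NoDup.
  - intros j Hj. apply filter_In in Hj as [Hj E]. apply in_seq in Hj.
    apply Nat.eqb_eq in E. destruct (Hf j ltac:(lia)) as [F1 [F2 F3]]. rewrite E in F3.
    assert (0 < nth j p 0) by (eapply Forall_nth in Hp; eauto; lia).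
    repeat split; try lra.
    (* [disjoint_work] asks for nonempty intervals; an empty one would contain no work, whereas
       every processing time is positive. *)
    + destruct (Req_dec (start s j) (completion s j)) as [e|e]; [rewrite e in F3; lra | lra].
    + eapply Rle_trans; [|exact Ht]. apply max_list_ge. apply in_map, in_seq; lia.
  - intros j j' Hj Hj' Hne. apply filter_In in Hj as [Hj E]. apply filter_In in Hj' as [Hj' E'].
    apply in_seq in Hj, Hj'. apply Nat.eqb_eq in E, E'. apply Hd; auto; try lia; congruence.
Qed.

(** * Big jobs and kept jobs *)

Definition above (s : R) (p : list R) : list R :=
  filter (fun x => if Rlt_dec s x then true else false) p.

Lemma above_cons s x p :
  above s (x :: p) = (if Rlt_dec s x then [x] else []) ++ above s p.
Proof. unfold above; simpl. destruct (Rlt_dec s x); reflexivity. Qed.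

(** Forgetting the small jobs only lowers the loads; this turns an optimal schedule into an
    assignment of the big jobs that the search can find. *)
Lemma restrict_assignment m s p sigma : length p = length sigma ->
  Forall (fun x => 0 < x) p -> Forall (fun k => (k < m)%nat) sigma ->
  exists a, length a = length (above s p) /\ Forall (fun k => (k < m)%nat) a /\
    forall i, load i (above s p) a <= load i p sigma.
Proof.
  intros E Hp; revert sigma E; induction Hp as [|x p Hx Hp IH]; intros [|k sigma] E Hs;
    simpl in E; try lia.
  - exists []; simpl; repeat split; auto. intros; lra.
  - inversion Hs; subst. destruct (IH sigma ltac:(lia)) as [a [A1 [A2 A3]]]; [auto|].
    rewrite above_cons. destruct (Rlt_dec s x).
    + exists (k :: a). simpl. repeat split; auto.
      intros i. specialize (A3 i). destruct (k =? i)%nat; lra.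
    + exists a. simpl. repeat split; auto.
      intros i. specialize (A3 i). destruct (k =? i)%nat; lra.
Qed.

Lemma sum_list_nonneg p : Forall (fun x => 0 < x) p -> 0 <= sum_list p.
Proof. induction 1; simpl in *; unfold sum_list in *; lra. Qed.

Lemma sum_above_le s p : Forall (fun x => 0 < x) p -> sum_list (above s p) <= sum_list p.
Proof.
  induction 1 as [|x p Hx Hp IH]; [simpl; lra|].
  rewrite above_cons, sum_list_app. simpl.
  destruct (Rlt_dec s x); unfold sum_list in *; simpl; lra.
Qed.

(** Markov's inequality; with [s = q P] it bounds the number of big jobs by [1 / q]. *)
Lemma above_count s p : Forall (fun x => 0 < x) p ->
  INR (length (above s p)) * s <= sum_list p.
Proof.
  intros Hp. eapply Rle_trans; [|apply sum_above_le with (s := s); auto].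
  unfold above. induction Hp as [|x p Hx Hp IH]; [simpl; lra|]. simpl.
  destruct (Rlt_dec s x); auto. simpl length. rewrite S_INR.
  unfold sum_list in *; simpl; lra.
Qed.

Lemma load_sum_le i p a : Forall (fun x => 0 < x) p -> load i p a <= sum_list p.
Proof.
  intros H; revert a; induction H as [|x p Hx H IH]; intros [|k a]; simpl; try lra.
  - specialize (sum_list_nonneg p H). unfold sum_list; simpl; lra.
  - specialize (IH a). unfold sum_list in *. destruct (k =? i)%nat; lra.
Qed.

Lemma load_repeat i k p n : i <> k -> load i p (repeat k n) = 0.
Proof.
  intros H; revert n; induction p as [|x p IH]; intros [|n]; simpl; auto.
  rewrite IH. destruct (Nat.eqb_spec k i); [congruence | lra].
Qed.

(* Jobs that look big when they arrive; [acc] is the work that arrived before. *)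
Fixpoint kept (q pmax acc : R) (p : list R) : list R :=
  match p with
  | [] => []
  | x :: p' =>
      (if Rlt_dec (q * (acc + x)) x then if Rlt_dec (q * pmax) x then [x] else [] else [])
        ++ kept q pmax (acc + x) p'
  end.

(** The work that has arrived never exceeds the final total, so both thresholds of the first pass
    stay at or below [s]. The equality also preserves the order of the stream, on which the second
    pass relies when it reads the machines of the big jobs one after another. *)
Lemma above_kept q pmax s acc p : 0 < q -> Forall (fun x => 0 < x) p ->
  q * pmax <= s -> q * (acc + sum_list p) <= s ->
  above s (kept q pmax acc p) = above s p.
Proof.
  intros Hq Hp Hs. revert acc; induction Hp as [|x p Hx Hp IH]; intros acc H; [reflexivity|].
  simpl in H. fold (sum_list p) in H. pose proof (sum_list_nonneg p Hp).
  cbn [kept]. unfold above at 1. rewrite filter_app. fold (above s (kept q pmax (acc + x) p)).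
  rewrite IH by lra. rewrite above_cons. f_equal.
  assert (q * (acc + x) <= s) by nra.
  destruct (Rlt_dec (q * (acc + x)) x); [destruct (Rlt_dec (q * pmax) x)|]; simpl;
    destruct (Rlt_dec s x); auto; lra.
Qed.

Section KeptLength.

Variables (q pmax : R).
Hypothesis Hq : 0 < q < 1.

(* Every kept job multiplies the arrived work by at least 1 / (1 - q) >= 1 + q. *)
Lemma kept_growth acc p : 0 <= acc -> Forall (fun x => 0 < x <= pmax) p ->
  kept q pmax acc p <> [] ->
  (1 + q) ^ length (kept q pmax acc p) * acc <= pmax / q.
Proof.
  intros Ha Hp; revert acc Ha; induction Hp as [|x p Hx Hp IH]; intros acc Ha Hne;
    [simpl in Hne; tauto|].
  cbn [kept] in *. set (r := kept q pmax (acc + x) p) in *.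
  assert (Hpow : forall n, 0 < (1 + q) ^ n) by (intros; apply pow_lt; lra).
  assert (IH' : r <> [] -> (1 + q) ^ length r * (acc + x) <= pmax / q).
  { intros h; apply IH; [lra | auto]. }
  destruct (Rlt_dec (q * (acc + x)) x) as [h1|h1];
    [destruct (Rlt_dec (q * pmax) x) as [h2|h2]|].
  - simpl. assert (G : (1 + q) * acc <= acc + x) by nra.
    destruct r as [|y r'].
    + simpl. assert (acc + x <= pmax / q).
      { apply Rmult_le_reg_l with q; [lra|].
        replace (q * (pmax / q)) with pmax by (field; lra). lra. }
      lra.
    + specialize (IH' ltac:(discriminate)). pose proof (Hpow (length (y :: r'))). nra.
  - simpl in *. specialize (IH' Hne). pose proof (Hpow (length r)). nra.
  - simpl in *. specialize (IH' Hne). pose proof (Hpow (length r)). nra.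
Qed.

(** The first kept job is longer than [q pmax], so from then on the arrived work exceeds [q pmax],
    however little there was before; [kept_growth] counts the remaining kept jobs from that point.
    Hence the exponent is one less than the length. *)
Lemma kept_growth' acc p : 0 <= acc -> Forall (fun x => 0 < x <= pmax) p ->
  0 < pmax -> (1 + q) ^ (length (kept q pmax acc p) - 1) * (q * pmax) <= pmax / q.
Proof.
  intros Ha Hp Hpm.
  assert (B : 1 * (q * pmax) <= pmax / q).
  { apply Rmult_le_reg_l with q; [lra|].
    replace (q * (pmax / q)) with pmax by (field; lra).
    assert (q * q < 1) by nra. nra. }
  revert acc Ha; induction Hp as [|x p Hx Hp IH]; intros acc Ha; [simpl; lra|].
  cbn [kept]. specialize (IH (acc + x) ltac:(lra)).
  pose proof (kept_growth (acc + x) p ltac:(lra) Hp) as G.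
  set (r := kept q pmax (acc + x) p) in *.
  destruct (Rlt_dec (q * (acc + x)) x); [destruct (Rlt_dec (q * pmax) x)|]; simpl in *; auto.
  rewrite Nat.sub_0_r. destruct r as [|y r']; [simpl; lra|].
  specialize (G ltac:(discriminate)).
  assert (0 < (1 + q) ^ length (y :: r')) by (apply pow_lt; lra). nra.
Qed.

(** The kept jobs after the first can raise the work by a factor of at most [1 / q ^ 2], from
    [q pmax] to [pmax / q]. Its logarithm is [2 * ln (1 / q)], and each of these jobs accounts for
    [ln (1 + q) >= q / 2] of it. *)
Lemma kept_length acc p : 0 <= acc -> Forall (fun x => 0 < x <= pmax) p -> 0 < pmax ->
  INR (length (kept q pmax acc p)) <= 1 + 4 / q * ln (1 / q).
Proof.
  intros Ha Hp Hpm. pose proof (kept_growth' acc p Ha Hp Hpm) as G.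
  set (n := (length (kept q pmax acc p) - 1)%nat) in *.
  assert (Hn : INR (length (kept q pmax acc p)) <= 1 + INR n).
  { replace 1 with (INR 1) by reflexivity. rewrite <- plus_INR. apply le_INR. lia. }
  assert (Hiq : 0 < / q) by (apply Rinv_0_lt_compat; lra).
  assert (P : (1 + q) ^ n <= / q * / q).
  { apply Rmult_le_reg_r with (q * pmax); [nra|].
    replace (/ q * / q * (q * pmax)) with (pmax / q) by (field; lra). auto. }
  assert (L : INR n * ln (1 + q) <= 2 * ln (1 / q)).
  { rewrite <- ln_pow by lra. replace (1 / q) with (/ q) by (field; lra).
    replace (2 * ln (/ q)) with (ln (/ q * / q)) by (rewrite ln_mult by auto; ring).
    destruct P as [P|P]; [left; apply ln_increasing; auto; apply pow_lt; lra | rewrite P; lra]. }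
  (* [exp (- y) >= 1 - y] at [y = ln (1 + q)] gives [y >= q / (1 + q)], which is at least [q / 2]
     since [q < 1]. *)
  assert (L2 : q / 2 <= ln (1 + q)).
  { pose proof (exp_ineq1_le (- ln (1 + q))) as E. rewrite exp_Ropp, exp_ln in E by lra.
    assert (/ (1 + q) <= 1 - q / 2).
    { apply Rmult_le_reg_l with (1 + q); [lra|]. rewrite Rinv_r by lra. nra. }
    lra. }
  pose proof (pos_INR n).
  assert (INR n * (q / 2) <= 2 * ln (1 / q)) by nra.
  assert (INR n <= 4 / q * ln (1 / q)).
  { apply Rmult_le_reg_r with (q / 2); [lra|].
    replace (4 / q * ln (1 / q) * (q / 2)) with (2 * ln (1 / q)) by (field; lra). auto. }
  lra.
Qed.

End KeptLength.

(** * Assignments as numbers in base [m] *)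

Fixpoint code (m : nat) (a : list nat) : nat :=
  match a with [] => 0 | d :: a' => d + m * code m a' end.

Lemma code_lt m a : Forall (fun d => (d < m)%nat) a -> (code m a < m ^ length a)%nat.
Proof. induction 1; simpl; [lia | nia]. Qed.

Lemma code_inj m a a' : length a = length a' ->
  Forall (fun d => (d < m)%nat) a -> Forall (fun d => (d < m)%nat) a' ->
  code m a = code m a' -> a = a'.
Proof.
  intros E H; revert a' E; induction H as [|d a Hd H IH]; intros [|d' a'] E H' C;
    simpl in *; try lia; auto.
  inversion H'; subst.
  assert (code m a = code m a') by nia. assert (d = d') by nia.
  subst; f_equal; apply IH; auto; lia.
Qed.

(** With [code_max] this is the odometer: either [b] maximal digits turn into zeros and the next one
    goes up, or all digits are maximal and the count is complete. *)
Lemma code_carry m b d a : (0 < m)%nat ->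
  code m (repeat 0%nat b ++ S d :: a) = S (code m (repeat (m - 1)%nat b ++ d :: a)).
Proof. intros Hm; induction b as [|b IH]; simpl; [lia|]. rewrite IH. nia. Qed.

Lemma code_max m b : (0 < m)%nat -> S (code m (repeat (m - 1)%nat b)) = (m ^ b)%nat.
Proof. intros Hm; induction b as [|b IH]; simpl; [lia|]. nia. Qed.

(** * Programs with time credits *)

(* Total correctness with [r] time credits to spend; [Q] sees the remaining balance,
   which allows for amortized bounds. *)
Definition runs sp c mem (r : nat) (Q : nat -> memory -> Prop) : Prop :=
  exists t mem' r', exec sp c mem t mem' /\ (t + r' <= r)%nat /\ Q r' mem'.

Lemma runs_conseq sp c mem r r1 (Q1 Q : nat -> memory -> Prop) :
  runs sp c mem r1 Q1 -> (r1 <= r)%nat ->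
  (forall r' mem', Q1 r' mem' -> Q r' mem') -> runs sp c mem r Q.
Proof. intros (t & mem' & r' & H1 & H2 & H3) Hr HQ. exists t, mem', r'. repeat split; auto; lia. Qed.

Lemma runs_skip sp mem r (Q : nat -> memory -> Prop) : Q r mem -> runs sp Skip mem r Q.
Proof. intros H. exists 0%nat, mem, r. repeat split; auto. constructor. Qed.

Lemma runs_seq sp c1 c2 mem r Q :
  runs sp c1 mem r (fun r1 mem1 => runs sp c2 mem1 r1 Q) -> runs sp (Seq c1 c2) mem r Q.
Proof.
  intros (t1 & mem1 & r1 & H1 & H2 & t2 & mem2 & r2 & H3 & H4 & H5).
  exists (t1 + t2)%nat, mem2, r2. repeat split; auto; [econstructor; eauto | lia].
Qed.

(* No test or assignment of the algorithm costs more than 100 steps. *)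
Lemma runs_if sp a b c1 c2 mem x y r (Q : nat -> memory -> Prop) :
  eval sp mem a = Some x -> eval sp mem b = Some y ->
  (1 + cost a + cost b <= 100)%nat -> (100 <= r)%nat ->
  (x < y -> runs sp c1 mem (r - 100) Q) -> (y <= x -> runs sp c2 mem (r - 100) Q) ->
  runs sp (IfLt a b c1 c2) mem r Q.
Proof.
  intros Ha Hb Hc Hr H1 H2. destruct (Rlt_le_dec x y) as [h|h].
  - destruct (H1 h) as (t & mem' & r' & E & L & HQ).
    exists (1 + cost a + cost b + t)%nat, mem', r'.
    repeat split; auto; [eapply exec_IfLt_true; eauto | lia].
  - destruct (H2 h) as (t & mem' & r' & E & L & HQ).
    exists (1 + cost a + cost b + t)%nat, mem', r'.
    repeat split; auto; [eapply exec_IfLt_false; eauto | lia].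
Qed.

Lemma runs_store sp a e mem x l v r (Q : nat -> memory -> Prop) :
  eval sp mem a = Some x -> address sp x = Some l -> eval sp mem e = Some v ->
  (1 + cost a + cost e <= 100)%nat -> (100 <= r)%nat ->
  Q (r - 100)%nat (update mem l v) -> runs sp (Store a e) mem r Q.
Proof.
  intros Ha Hl He Hc Hr H.
  exists (1 + cost a + cost e)%nat, (update mem l v), (r - 100)%nat.
  repeat split; auto; [econstructor; eauto | lia].
Qed.

(* Every iteration consumes credits, so the loop terminates. *)
Lemma runs_while sp a b c (I : nat -> memory -> Prop) (Q : nat -> memory -> Prop) :
  (1 + cost a + cost b <= 100)%nat ->
  (forall r mem, I r mem -> exists x y,
     eval sp mem a = Some x /\ eval sp mem b = Some y /\ (100 <= r)%nat /\
     (x < y -> runs sp c mem (r - 100) I) /\ (y <= x -> Q (r - 100)%nat mem)) ->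
  forall r mem, I r mem -> runs sp (WhileLt a b c) mem r Q.
Proof.
  intros Hc H r. induction r as [r IH] using lt_wf_ind. intros mem HI.
  destruct (H r mem HI) as (x & y & Ha & Hb & Hr & H1 & H2).
  destruct (Rlt_le_dec x y) as [h|h].
  - destruct (H1 h) as (t1 & mem1 & r1 & E1 & L1 & HI1).
    destruct (IH r1 ltac:(lia) mem1 HI1) as (t2 & mem2 & r2 & E2 & L2 & HQ).
    exists (1 + cost a + cost b + t1 + t2)%nat, mem2, r2.
    repeat split; auto; [eapply exec_WhileLt_true; eauto | lia].
  - exists (1 + cost a + cost b)%nat, mem, (r - 100)%nat.
    repeat split; auto; [eapply exec_WhileLt_false; eauto | lia].
Qed.

(** * Evaluation of expressions and memory layout *)

Lemma address_INR sp n : (n < sp)%nat -> address sp (INR n) = Some n.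
Proof.
  intros H. unfold address. destruct (Rle_dec 0 (INR n)) as [_|h].
  - rewrite Int_part_INR, Nat2Z.id. apply Nat.ltb_lt in H. rewrite H. reflexivity.
  - pose proof (pos_INR n); lra.
Qed.

Lemma eval_cst sp mem z : eval sp mem (Cst z) = Some (IZR z).
Proof. reflexivity. Qed.

Lemma eval_nat sp mem n : eval sp mem (Cst (Z.of_nat n)) = Some (INR n).
Proof. simpl. rewrite <- INR_IZR_INZ. reflexivity. Qed.

Lemma eval_add sp mem a b x y : eval sp mem a = Some x -> eval sp mem b = Some y ->
  eval sp mem (Op Add a b) = Some (x + y).
Proof. simpl; intros -> ->; reflexivity. Qed.

Lemma eval_sub sp mem a b x y : eval sp mem a = Some x -> eval sp mem b = Some y ->
  eval sp mem (Op Sub a b) = Some (x - y).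
Proof. simpl; intros -> ->; reflexivity. Qed.

Lemma eval_mul sp mem a b x y : eval sp mem a = Some x -> eval sp mem b = Some y ->
  eval sp mem (Op Mul a b) = Some (x * y).
Proof. simpl; intros -> ->; reflexivity. Qed.

Lemma eval_div sp mem a b x y : eval sp mem a = Some x -> eval sp mem b = Some y ->
  y <> 0 -> eval sp mem (Op Div a b) = Some (x / y).
Proof. simpl; intros -> -> H. destruct (Req_EM_T y 0); tauto. Qed.

Lemma eval_fetch sp mem a x n : eval sp mem a = Some x -> x = INR n -> (n < sp)%nat ->
  eval sp mem (Fetch a) = Some (mem n).
Proof. simpl; intros -> -> H. rewrite address_INR by auto. reflexivity. Qed.

(* Layout: cells 0, ..., L - 1 hold the input, except that cell 0 holds the job
   and cells 1 and 2 the addresses of the registers and of the job table.  They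
   are followed by 20 registers, then 9 fields per machine, then 3 per kept job. *)
Definition job_cell := Fetch (Cst 0).
Definition reg_at (k : nat) := Op Add (Fetch (Cst 1)) (Cst (Z.of_nat k)).
Definition fld_at (e : expr) (f : nat) :=
  Op Add (Op Add (Fetch (Cst 1)) (Op Mul (Cst 9) e)) (Cst (Z.of_nat (20 + f))).
Definition buf_at (e : expr) (f : nat) :=
  Op Add (Op Add (Fetch (Cst 2)) (Op Mul (Cst 3) e)) (Cst (Z.of_nat f)).
Definition Reg k := Fetch (reg_at k).
Definition Fld e f := Fetch (fld_at e f).
Definition Buf e f := Fetch (buf_at e f).

(** The fields are total functions; [holds] ties only the cells inside the layout to them. Lemmas on
    commands then speak of a state and of what the command leaves unchanged, not of addresses. *)
Record state := State {
  job : R; reg : nat -> R; fld : nat -> nat -> R; buf : nat -> nat -> R }.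

Definition set_job S v := State v (reg S) (fld S) (buf S).
Definition set_reg S k v :=
  State (job S) (fun k' => if (k' =? k)%nat then v else reg S k') (fld S) (buf S).
(** The field is compared first: field numbers are literals, so that test computes, and the indices
    are compared only when the fields agree. *)
Definition set2 (g : nat -> nat -> R) i f v i' f' :=
  if (f' =? f)%nat then if (i' =? i)%nat then v else g i' f' else g i' f'.
Definition set_fld S i f v := State (job S) (reg S) (set2 (fld S) i f v) (buf S).
Definition set_buf S i f v := State (job S) (reg S) (fld S) (set2 (buf S) i f v).

Section Layout.

Variables (inp : nat -> R) (L m nb : nat).
Hypothesis HL : (6 <= L)%nat.

Definition space := (L + 20 + 9 * m + 3 * nb)%nat.

(** The scalar parameters survive in registers, [eps] inside [r_q] and [r_delta]; of the input
    itself only the machine descriptions, which start at cell 6, are read again. *)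
Definition holds (mem : memory) (S : state) : Prop :=
  mem 0%nat = job S /\ mem 1%nat = INR L /\ mem 2%nat = INR (L + 20 + 9 * m) /\
  (forall a, (6 <= a < L)%nat -> mem a = inp a) /\
  (forall k, (k < 20)%nat -> mem (L + k)%nat = reg S k) /\
  (forall i f, (i < m)%nat -> (f < 9)%nat -> mem (L + 20 + 9 * i + f)%nat = fld S i f) /\
  (forall j f, (j < nb)%nat -> (f < 3)%nat ->
     mem (L + 20 + 9 * m + 3 * j + f)%nat = buf S j f).

Lemma eval_job mem S : holds mem S -> eval space mem job_cell = Some (job S).
Proof.
  intros H. unfold job_cell. erewrite eval_fetch with (n := 0%nat); [|reflexivity|reflexivity|].
  - f_equal; apply H.
  - unfold space; lia.
Qed.

Lemma eval_base mem S : holds mem S -> eval space mem (Fetch (Cst 1)) = Some (INR L).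
Proof.
  intros H. erewrite eval_fetch with (n := 1%nat); [|reflexivity|reflexivity|].
  - f_equal; apply H.
  - unfold space; lia.
Qed.

Lemma eval_base2 mem S : holds mem S ->
  eval space mem (Fetch (Cst 2)) = Some (INR (L + 20 + 9 * m)).
Proof.
  intros H. erewrite eval_fetch with (n := 2%nat); [|reflexivity|reflexivity|].
  - f_equal; apply H.
  - unfold space; lia.
Qed.

Lemma eval_reg_at mem S k : holds mem S -> eval space mem (reg_at k) = Some (INR (L + k)).
Proof.
  intros H. unfold reg_at. erewrite eval_add; [|eapply eval_base; eauto|apply eval_nat].
  rewrite plus_INR. reflexivity.
Qed.

Lemma eval_fld_at mem S e x i f : holds mem S -> eval space mem e = Some x -> x = INR i ->
  eval space mem (fld_at e f) = Some (INR (L + 20 + 9 * i + f)).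
Proof.
  intros H He ->. unfold fld_at.
  erewrite eval_add;
    [|eapply eval_add; [eapply eval_base; eauto|eapply eval_mul; [apply eval_cst|eauto]]
     |apply eval_nat].
  f_equal. rewrite !plus_INR, mult_INR. simpl; ring.
Qed.

Lemma eval_buf_at mem S e x i f : holds mem S -> eval space mem e = Some x -> x = INR i ->
  eval space mem (buf_at e f) = Some (INR (L + 20 + 9 * m + 3 * i + f)).
Proof.
  intros H He ->. unfold buf_at.
  erewrite eval_add;
    [|eapply eval_add; [eapply eval_base2; eauto|eapply eval_mul; [apply eval_cst|eauto]]
     |apply eval_nat].
  f_equal. rewrite (plus_INR _ f), (plus_INR _ (3 * i)), (mult_INR 3). simpl; ring.
Qed.

Lemma eval_reg mem S k : holds mem S -> (k < 20)%nat ->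
  eval space mem (Reg k) = Some (reg S k).
Proof.
  intros H Hk. unfold Reg. erewrite eval_fetch; [|eapply eval_reg_at; eauto|reflexivity|].
  - f_equal; apply H; auto.
  - unfold space; lia.
Qed.

Lemma eval_fld mem S e x i f : holds mem S -> eval space mem e = Some x -> x = INR i ->
  (i < m)%nat -> (f < 9)%nat -> eval space mem (Fld e f) = Some (fld S i f).
Proof.
  intros H He Hx Hi Hf. unfold Fld. erewrite eval_fetch; [|eapply eval_fld_at; eauto|reflexivity|].
  - f_equal; apply H; auto.
  - unfold space; nia.
Qed.

Lemma eval_buf mem S e x i f : holds mem S -> eval space mem e = Some x -> x = INR i ->
  (i < nb)%nat -> (f < 3)%nat -> eval space mem (Buf e f) = Some (buf S i f).
Proof.
  intros H He Hx Hi Hf. unfold Buf. erewrite eval_fetch; [|eapply eval_buf_at; eauto|reflexivity|].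
  - f_equal; apply H; auto.
  - unfold space; nia.
Qed.

Lemma eval_inp mem S e x a : holds mem S -> eval space mem e = Some x -> x = INR a ->
  (6 <= a < L)%nat -> eval space mem (Fetch e) = Some (inp a).
Proof.
  intros H He Hx Ha. erewrite eval_fetch; [|eauto|eauto|].
  - f_equal; apply H; auto.
  - unfold space; lia.
Qed.

Ltac solve_update :=
  unfold update; repeat split; intros;
  repeat match goal with
  | |- context [(?a =? ?b)%nat] => destruct (Nat.eqb_spec a b); try lia
  end; auto.

Lemma holds_job mem S v : holds mem S -> holds (update mem 0 v) (set_job S v).
Proof. intros (H0 & H1 & H2 & H3 & H4 & H5 & H6). unfold holds; cbn [job reg fld buf set_job].
  solve_update. Qed.

Lemma holds_reg mem S k v : holds mem S -> (k < 20)%nat ->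
  holds (update mem (L + k) v) (set_reg S k v).
Proof.
  intros (H0 & H1 & H2 & H3 & H4 & H5 & H6) Hk. unfold holds; cbn [job reg fld buf set_reg].
  solve_update.
Qed.

Lemma holds_fld mem S i f v : holds mem S -> (i < m)%nat -> (f < 9)%nat ->
  holds (update mem (L + 20 + 9 * i + f) v) (set_fld S i f v).
Proof.
  intros (H0 & H1 & H2 & H3 & H4 & H5 & H6) Hi Hf.
  unfold holds; cbn [job reg fld buf set_fld]. unfold set2. solve_update.
Qed.

Lemma holds_buf mem S j f v : holds mem S -> (j < nb)%nat -> (f < 3)%nat ->
  holds (update mem (L + 20 + 9 * m + 3 * j + f) v) (set_buf S j f v).
Proof.
  intros (H0 & H1 & H2 & H3 & H4 & H5 & H6) Hi Hf.
  unfold holds; cbn [job reg fld buf set_buf]. unfold set2. solve_update.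
Qed.

Lemma runs_set_job mem S e v r (Q : nat -> memory -> Prop) :
  holds mem S -> eval space mem e = Some v ->
  (1 + cost (Cst 0) + cost e <= 100)%nat -> (100 <= r)%nat ->
  (forall mem', holds mem' (set_job S v) -> Q (r - 100)%nat mem') ->
  runs space (Store (Cst 0) e) mem r Q.
Proof.
  intros H He Hc Hr HQ. eapply runs_store; eauto.
  - apply (eval_nat _ _ 0).
  - apply address_INR; unfold space; lia.
  - apply HQ, holds_job; auto.
Qed.

Lemma runs_set_reg mem S k e v r (Q : nat -> memory -> Prop) :
  holds mem S -> (k < 20)%nat -> eval space mem e = Some v ->
  (1 + cost (reg_at k) + cost e <= 100)%nat -> (100 <= r)%nat ->
  (forall mem', holds mem' (set_reg S k v) -> Q (r - 100)%nat mem') ->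
  runs space (Store (reg_at k) e) mem r Q.
Proof.
  intros H Hk He Hc Hr HQ. eapply runs_store; eauto.
  - eapply eval_reg_at; eauto.
  - apply address_INR; unfold space; lia.
  - apply HQ, holds_reg; auto.
Qed.

Lemma runs_set_fld mem S ei x i f e v r (Q : nat -> memory -> Prop) :
  holds mem S -> eval space mem ei = Some x -> x = INR i -> (i < m)%nat -> (f < 9)%nat ->
  eval space mem e = Some v ->
  (1 + cost (fld_at ei f) + cost e <= 100)%nat -> (100 <= r)%nat ->
  (forall mem', holds mem' (set_fld S i f v) -> Q (r - 100)%nat mem') ->
  runs space (Store (fld_at ei f) e) mem r Q.
Proof.
  intros H Hei Hx Hi Hf He Hc Hr HQ. eapply runs_store; eauto.
  - eapply eval_fld_at; eauto.
  - apply address_INR; unfold space; nia.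
  - apply HQ, holds_fld; auto.
Qed.

Lemma runs_set_buf mem S ei x j f e v r (Q : nat -> memory -> Prop) :
  holds mem S -> eval space mem ei = Some x -> x = INR j -> (j < nb)%nat -> (f < 3)%nat ->
  eval space mem e = Some v ->
  (1 + cost (buf_at ei f) + cost e <= 100)%nat -> (100 <= r)%nat ->
  (forall mem', holds mem' (set_buf S j f v) -> Q (r - 100)%nat mem') ->
  runs space (Store (buf_at ei f) e) mem r Q.
Proof.
  intros H Hei Hx Hi Hf He Hc Hr HQ. eapply runs_store; eauto.
  - eapply eval_buf_at; eauto.
  - apply address_INR; unfold space; nia.
  - apply HQ, holds_buf; auto.
Qed.

End Layout.

(** * The algorithm *)

Notation r_m := 0%nat (only parsing).
Notation r_m1 := 1%nat (only parsing).
Notation r_pmax := 2%nat (only parsing).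
Notation r_q := 3%nat (only parsing).
Notation r_P := 4%nat (only parsing).
Notation r_kept := 5%nat (only parsing).
Notation r_delta := 6%nat (only parsing).
Notation r_e0 := 7%nat (only parsing).
Notation r_s := 8%nat (only parsing).
Notation r_X := 9%nat (only parsing).
Notation r_B := 10%nat (only parsing).
Notation r_T := 11%nat (only parsing).
Notation r_found := 12%nat (only parsing).
Notation r_W := 13%nat (only parsing).
Notation r_i := 14%nat (only parsing).
Notation r_done := 15%nat (only parsing).
Notation r_ok := 16%nat (only parsing).
Notation r_b := 17%nat (only parsing).
Notation r_cur := 18%nat (only parsing).
Notation r_go := 19%nat (only parsing).

Notation f_pos := 0%nat (only parsing).
Notation f_rest := 1%nat (only parsing).
Notation f_last := 2%nat (only parsing).
Notation f_time := 3%nat (only parsing).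
Notation f_done := 4%nat (only parsing).
Notation f_cap := 5%nat (only parsing).
Notation f_room := 6%nat (only parsing).
Notation f_open := 7%nat (only parsing).
Notation f_space := 8%nat (only parsing).

Notation j_kept := 0%nat (only parsing).
Notation j_big := 1%nat (only parsing).
Notation j_digit := 2%nat (only parsing).

Declare Scope prog_scope.
Delimit Scope prog_scope with prog.
Notation "a + b" := (Op Add a b) : prog_scope.
Notation "a - b" := (Op Sub a b) : prog_scope.
Notation "a * b" := (Op Mul a b) : prog_scope.
Notation "a / b" := (Op Div a b) : prog_scope.
Notation "c ;; d" := (Seq c d) (at level 90, right associativity) : prog_scope.
Notation "a <- e" := (Store a e) (at level 80) : prog_scope.
Arguments Store (a e)%_prog.
Arguments Seq (c1 c2)%_prog.
Arguments IfLt (a b c1 c2)%_prog.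
Arguments WhileLt (a b c)%_prog.
Arguments Fetch a%_prog.
Arguments Fld e%_prog f.
Arguments Buf e%_prog f.
Arguments fld_at e%_prog f.
Arguments buf_at e%_prog f.
Local Open Scope prog_scope.

Definition For (k : nat) (n : expr) (c : cmd) : cmd :=
  reg_at k <- Cst 0 ;;
  WhileLt (Reg k) n (c ;; reg_at k <- Reg k + Cst 1).

Definition cell (k : Z) := Fetch (Cst k).

(* Cell 1 holds eps and counts the machines: eps + k < m iff k < m. *)
Definition find_end : cmd :=
  Cst 0 <- Cst 6 ;;
  WhileLt (cell 1) (cell 3)
    (Cst 0 <- cell 0 + (Cst 2 + Cst 2 * Fetch (cell 0)) ;;
     Cst 1 <- cell 1 + Cst 1).

(** [find_end] has left the address [L] in cell 0 and [m + eps] in cell 1, so [cell 1 - cell 3] is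
    [eps]. Cells 1 and 2 get their final contents last, after their old ones have been used. *)
Definition set_up : cmd :=
  cell 0 <- cell 3 ;;
  cell 0 + Cst 1 <- cell 4 ;;
  cell 0 + Cst 2 <- cell 5 ;;
  cell 0 + Cst 3 <- (cell 1 - cell 3) * cell 2 * cell 4 / (Cst 2 * cell 3 * cell 3) ;;
  cell 0 + Cst 6 <- (cell 1 - cell 3) / (Cst 2 * cell 3) ;;
  cell 0 + Cst 7 <- cell 2 ;;
  Cst 1 <- cell 0 ;;
  Cst 2 <- cell 0 + Cst 20 + Cst 9 * cell 3.

Definition locate_machines : cmd :=
  reg_at r_b <- Cst 6 ;;
  For r_i (Reg r_m)
    (fld_at (Reg r_i) f_pos <- Reg r_b + Cst 2 ;;
     fld_at (Reg r_i) f_rest <- Fetch (Reg r_b) ;;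
     fld_at (Reg r_i) f_last <- Fetch (Reg r_b + Cst 1) ;;
     reg_at r_b <- Reg r_b + (Cst 2 + Cst 2 * Fetch (Reg r_b))).

Definition first_pass : cmd :=
  reg_at r_P <- Reg r_P + job_cell ;;
  IfLt (Reg r_q * Reg r_P) job_cell
    (IfLt (Reg r_q * Reg r_pmax) job_cell
       (buf_at (Reg r_kept) j_kept <- job_cell ;;
        reg_at r_kept <- Reg r_kept + Cst 1)
       Skip)
    Skip.

(** Until here [r_delta] holds [eps / (2 m)] and the threshold exists only as the ratio [r_q]; the
    total work that scales them is known once the first pass is over. *)
Definition select_big : cmd :=
  reg_at r_delta <- Reg r_delta * Reg r_P ;;
  reg_at r_s <- Reg r_q * Reg r_P ;;
  reg_at r_X <- Reg r_e0 * Reg r_delta ;;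
  For r_i (Reg r_kept)
    (IfLt (Reg r_s) (Buf (Reg r_i) j_kept)
       (buf_at (Reg r_B) j_big <- Buf (Reg r_i) j_kept ;;
        reg_at r_B <- Reg r_B + Cst 1)
       Skip).

Definition advance : cmd :=
  reg_at r_go <- Cst 1 ;;
  WhileLt (Cst 0) (Reg r_go)
    (IfLt (Cst 0) (Fld (Reg r_i) f_rest)
       (IfLt (Reg r_T) (Fetch (Fld (Reg r_i) f_pos))
          (reg_at r_go <- Cst 0)
          (fld_at (Reg r_i) f_done <- Fld (Reg r_i) f_done
             + Fetch (Fld (Reg r_i) f_pos + Cst 1)
               * (Fetch (Fld (Reg r_i) f_pos) - Fld (Reg r_i) f_time) ;;
           fld_at (Reg r_i) f_time <- Fetch (Fld (Reg r_i) f_pos) ;;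
           fld_at (Reg r_i) f_pos <- Fld (Reg r_i) f_pos + Cst 2 ;;
           fld_at (Reg r_i) f_rest <- Fld (Reg r_i) f_rest - Cst 1))
       (reg_at r_go <- Cst 0)).

Definition capacity : cmd :=
  advance ;;
  IfLt (Cst 0) (Fld (Reg r_i) f_rest)
    (fld_at (Reg r_i) f_cap <- Fld (Reg r_i) f_done
       + Fetch (Fld (Reg r_i) f_pos + Cst 1) * (Reg r_T - Fld (Reg r_i) f_time))
    (fld_at (Reg r_i) f_cap <- Fld (Reg r_i) f_done
       + Fld (Reg r_i) f_last * (Reg r_T - Fld (Reg r_i) f_time)) ;;
  reg_at r_W <- Reg r_W + Fld (Reg r_i) f_cap ;;
  IfLt (Reg r_i) (Reg r_m1)
    (fld_at (Reg r_i) f_cap <- Fld (Reg r_i) f_cap + Reg r_X)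
    Skip.

Definition capacities : cmd :=
  reg_at r_W <- Cst 0 ;;
  For r_i (Reg r_m) capacity.

(** The rooms are recomputed for each assignment. Those of the accepted one remain in [f_room],
    where [list_open] reads them. *)
Definition check : cmd :=
  IfLt (Reg r_W) (Reg r_P) (reg_at r_ok <- Cst 0) (reg_at r_ok <- Cst 1) ;;
  For r_i (Reg r_m) (fld_at (Reg r_i) f_room <- Fld (Reg r_i) f_cap) ;;
  For r_b (Reg r_B)
    (fld_at (Buf (Reg r_b) j_digit) f_room <-
       Fld (Buf (Reg r_b) j_digit) f_room - Buf (Reg r_b) j_big) ;;
  For r_i (Reg r_m)
    (IfLt (Fld (Reg r_i) f_room) (Cst 0) (reg_at r_ok <- Cst 0) Skip).

(* Adds 1 to the number whose base m digits are the machines of the big jobs. *)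
Definition next_assignment : cmd :=
  reg_at r_done <- Cst 1 ;;
  reg_at r_b <- Cst 0 ;;
  WhileLt (Reg r_b) (Reg r_B)
    (IfLt (Buf (Reg r_b) j_digit + Cst 1) (Reg r_m)
       (buf_at (Reg r_b) j_digit <- Buf (Reg r_b) j_digit + Cst 1 ;;
        reg_at r_done <- Cst 0 ;;
        reg_at r_b <- Reg r_B)
       (buf_at (Reg r_b) j_digit <- Cst 0 ;;
        reg_at r_b <- Reg r_b + Cst 1)).

Definition search : cmd :=
  reg_at r_done <- Cst 0 ;;
  WhileLt (Reg r_done) (Cst 1)
    (check ;;
     IfLt (Cst 0) (Reg r_ok)
       (reg_at r_found <- Cst 1 ;; reg_at r_done <- Cst 1)
       next_assignment).

Definition guess : cmd :=
  WhileLt (Reg r_found) (Cst 1)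
    (reg_at r_T <- Reg r_T + Reg r_delta ;;
     capacities ;;
     search).

Definition list_open : cmd :=
  reg_at r_cur <- Cst 0 ;;
  For r_i (Reg r_m)
    (IfLt (Fld (Reg r_i) f_room) (Reg r_s)
       Skip
       (fld_at (Reg r_cur) f_open <- Reg r_i ;;
        fld_at (Reg r_cur) f_space <- Fld (Reg r_i) f_room ;;
        reg_at r_cur <- Reg r_cur + Cst 1)) ;;
  reg_at r_cur <- Cst 0 ;;
  reg_at r_b <- Cst 0.

(** A job is recognized as big by the same comparison as in [select_big], so each big job of the
    stream meets its own digit at [r_b]. The machine number has to end up in cell 0, whose content
    the pass emits. *)
Definition second_pass : cmd :=
  IfLt (Reg r_s) job_cell
    (Cst 0 <- Buf (Reg r_b) j_digit ;;
     reg_at r_b <- Reg r_b + Cst 1)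
    (IfLt (Fld (Reg r_cur) f_space) job_cell
       (reg_at r_cur <- Reg r_cur + Cst 1)
       Skip ;;
     fld_at (Reg r_cur) f_space <- Fld (Reg r_cur) f_space - job_cell ;;
     Cst 0 <- Fld (Reg r_cur) f_open).

Definition algorithm : two_pass_algorithm :=
  TwoPass (find_end ;; set_up ;; locate_machines)
          first_pass
          (select_big ;; guess ;; list_open)
          second_pass.
Close Scope prog_scope.

(** * Execution of the algorithm *)

Ltac cheap := apply Nat.leb_le; reflexivity.

Ltac side := first [eassumption | lia | cbn; first [eassumption | lia] | idtac].

Ltac ev :=
  lazymatch goal with
  | |- eval _ _ (Cst _) = Some _ => apply eval_cst
  | |- eval _ _ job_cell = Some _ => eapply eval_job; [eassumption | eassumption]
  | |- eval _ _ (Reg _) = Some _ => eapply eval_reg; [eassumption | eassumption | lia]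
  | |- eval _ _ (Fld _ _) = Some _ => eapply eval_fld; [eassumption | eassumption | ev | side | side | lia]
  | |- eval _ _ (Buf _ _) = Some _ => eapply eval_buf; [eassumption | eassumption | ev | side | side | lia]
  | |- eval _ _ (Fetch _) = Some _ => eapply eval_inp; [eassumption | eassumption | ev | side | side]
  | |- eval _ _ (Op Add _ _) = Some _ => eapply eval_add; ev
  | |- eval _ _ (Op Sub _ _) = Some _ => eapply eval_sub; ev
  | |- eval _ _ (Op Mul _ _) = Some _ => eapply eval_mul; ev
  end.

Ltac step :=
  lazymatch goal with
  | |- runs _ (Seq _ _) _ _ _ => apply runs_seq; step
  | |- runs _ Skip _ _ _ => apply runs_skip
  | |- runs _ (Store (reg_at _) _) _ _ _ =>
      eapply runs_set_reg; [eassumption | eassumption | lia | ev | cheap | try lia | ]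
  | |- runs _ (Store (fld_at _ _) _) _ _ _ =>
      eapply runs_set_fld; [eassumption | eassumption | ev | side | side | lia | ev | cheap | try lia | ]
  | |- runs _ (Store (buf_at _ _) _) _ _ _ =>
      eapply runs_set_buf; [eassumption | eassumption | ev | side | side | lia | ev | cheap | try lia | ]
  | |- runs _ (Store (Cst 0) _) _ _ _ =>
      eapply runs_set_job; [eassumption | eassumption | ev | cheap | try lia | ]
  | |- runs _ (IfLt _ _ _ _) _ _ _ => eapply runs_if; [ev | ev | cheap | try lia | | ]
  end.

Definition keeps (rs : list nat) (S S' : state) : Prop :=
  forall k, ~ In k rs -> reg S' k = reg S k.

Lemma keeps_set rs S S' k v : keeps rs S S' -> In k rs -> keeps rs S (set_reg S' k v).
Proof.
  intros H Hk k' Hk'. cbn. destruct (Nat.eqb_spec k' k); [subst; tauto | auto].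
Qed.

Lemma keeps_trans rs rs' S S' S'' : keeps rs S S' -> keeps rs' S' S'' -> incl rs' rs ->
  keeps rs S S''.
Proof. intros H H' Hi k Hk. rewrite H', H; auto. Qed.

Section Rules.

Variables (inp : nat -> R) (L m nb : nat).
Hypothesis HL : (6 <= L)%nat.

(* [J k r S]: invariant after k iterations, with [r] credits left. *)
Lemma runs_for (J : nat -> nat -> state -> Prop) k ne n c (Q : nat -> memory -> Prop) :
  (k < 20)%nat -> (1 + cost (Reg k) + cost ne <= 100)%nat ->
  (forall i r S mem, J i r S -> holds inp L m nb mem S ->
     eval (space L m nb) mem ne = Some (INR n) /\ (200 <= r)%nat) ->
  (forall i r S mem, (i < n)%nat -> J i r S -> reg S k = INR i -> holds inp L m nb mem S ->
     runs (space L m nb) c mem (r - 100)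
       (fun r' mem' => exists S', holds inp L m nb mem' S' /\ reg S' k = INR i /\
          (100 <= r')%nat /\ J (Datatypes.S i) (r' - 100)%nat (set_reg S' k (INR (Datatypes.S i))))) ->
  (forall r S mem, J n r S -> reg S k = INR n -> holds inp L m nb mem S -> Q (r - 100)%nat mem) ->
  forall r S mem, holds inp L m nb mem S -> (100 <= r)%nat ->
    J 0%nat (r - 100)%nat (set_reg S k 0) ->
    runs (space L m nb) (For k ne c) mem r Q.
Proof.
  intros Hk Hc Hn Hb HQ r S mem HS Hr HJ. unfold For. step. intros mem1 H1.
  set (I := fun r' mem' => exists i S', (i <= n)%nat /\ reg S' k = INR i /\ J i r' S' /\
              holds inp L m nb mem' S').
  apply runs_while with (I := I); [exact Hc| |].
  - intros r2 mem2 (i & S2 & Hi & Ek & HJ2 & H2).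
    destruct (Hn i r2 S2 mem2 HJ2 H2) as [En Er].
    exists (INR i), (INR n). split; [rewrite <- Ek; eapply eval_reg; eauto; apply H2|].
    split; [exact En|]. split; [lia|]. split; intros Hlt.
    + apply INR_lt in Hlt. apply runs_seq.
      eapply runs_conseq; [apply (Hb i r2 S2 mem2 Hlt HJ2 Ek H2) | lia |].
      intros r3 mem3 (S3 & H3 & Ek3 & Hr3 & HJ3). step. intros mem4 H4.
      exists (Datatypes.S i), (set_reg S3 k (INR (Datatypes.S i))). split; [lia|].
      rewrite Ek3, <- S_INR in H4. split; [cbn; rewrite Nat.eqb_refl; reflexivity|].
      split; [exact HJ3 | exact H4].
    + apply INR_le in Hlt. assert (i = n) by lia. subst. eapply HQ; eauto.
  - exists 0%nat, (set_reg S k 0). split; [lia|]. split; [cbn; rewrite Nat.eqb_refl; reflexivity|].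
    split; assumption.
Qed.

End Rules.

Ltac fields :=
  cbn [job reg fld buf set_job set_reg set_fld set_buf Nat.eqb]; unfold set2;
  cbn [Nat.eqb]; rewrite ?Nat.eqb_refl.

Ltac frame :=
  cbn [job reg fld buf set_job set_reg set_fld set_buf]; unfold set2;
  repeat match goal with
  | |- context [(?a =? ?b)%nat] => destruct (Nat.eqb_spec a b); try lia
  end; auto; try lia; try congruence.

(** * Pointers into the intervals of a machine *)

Section Machines.

Variables (inp : nat -> R) (L m nb : nat).
Hypothesis HL : (6 <= L)%nat.

Fixpoint seg (a : nat) (l : list (R * R)) : Prop :=
  match l with
  | [] => True
  | (u, e) :: l' => (6 <= a /\ S a < L)%nat /\ inp a = u /\ inp (S a) = e /\ seg (S (S a)) l'
  end.

Definition machine_at (a : nat) (M : machine) : Prop :=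
  (6 <= a /\ S a < L)%nat /\ inp a = INR (length (intervals M)) /\ inp (S a) = last_ratio M /\
  seg (S (S a)) (intervals M).

Fixpoint machines_at (a : nat) (Ms : list machine) : Prop :=
  match Ms with
  | [] => a = L
  | M :: Ms' => machine_at a M /\ machines_at (a + (2 + 2 * length (intervals M))) Ms'
  end.

(* The fields [f] of M describe its work up to time [f f_time] <= T, and the
   intervals [l] that are still ahead. *)
Definition tracks (M : machine) (T : R) (f : nat -> R) (l : list (R * R)) : Prop :=
  (exists a, f f_pos = INR a /\ seg a l) /\ f f_rest = INR (length l) /\
  f f_last = last_ratio M /\ rising (f f_time) l /\ 0 <= f f_time <= T /\
  (forall t, f f_time <= t -> work M t = f f_done + work_from (f f_time) l (last_ratio M) t).

(** Together with [tracks] this says that [T] lies in the interval at the head of [l], or in the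
    unbounded one if [l] is empty, so the work up to [T] is one multiplication away. *)
Definition settled (T : R) (l : list (R * R)) : Prop :=
  match l with [] => True | (u, _) :: _ => T < u end.

Lemma tracks_le M T T' f l : tracks M T f l -> T <= T' -> tracks M T' f l.
Proof. intros (H1 & H2 & H3 & H4 & H5 & H6) HT. repeat split; auto; lra. Qed.

(** [700 * length l] is a potential: each interval passed releases 700 credits, which pay for the
    loop iteration, so a call costs at most 600 beyond the drop of the potential. Over all guesses
    the moves then cost no more than the intervals present at the start. *)
Lemma advance_correct i M l T0 S mem r (Q : nat -> memory -> Prop) :
  (i < m)%nat -> holds inp L m nb mem S -> reg S r_i = INR i ->
  tracks M T0 (fld S i) l -> T0 <= reg S r_T -> (600 + 700 * length l <= r)%nat ->
  (forall S' mem' r' l', holds inp L m nb mem' S' -> keeps [r_go] S S' -> buf S' = buf S ->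
     (forall i' f, i' <> i \/ (5 <= f)%nat -> fld S' i' f = fld S i' f) ->
     tracks M (reg S r_T) (fld S' i) l' -> settled (reg S r_T) l' ->
     (r + 700 * length l' <= r' + 700 * length l + 600)%nat -> Q r' mem') ->
  runs (space L m nb) advance mem r Q.
Proof.
  intros Hi HS Ei Ht HT Hr HQ. unfold advance. step. intros mem1 H1.
  set (I := fun (r1 : nat) mem' => exists S' l', holds inp L m nb mem' S' /\
     keeps [r_go] S S' /\ buf S' = buf S /\
     (forall i' f, i' <> i \/ (5 <= f)%nat -> fld S' i' f = fld S i' f) /\
     tracks M (reg S r_T) (fld S' i) l' /\
     ((reg S' r_go = 1 /\ (r + 700 * length l' <= r1 + 700 * length l + 100)%nat) \/
      (reg S' r_go = 0 /\ settled (reg S r_T) l' /\ (100 <= r1)%nat /\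
       (r + 700 * length l' <= r1 + 700 * length l + 500)%nat))).
  apply runs_while with (I := I); [cheap| |].
  - clear mem1 H1. intros r1 mem1 (S1 & l1 & H1 & K1 & B1 & F1 & T1 & D1).
    assert (E1 : reg S1 r_i = INR i) by (rewrite <- Ei; apply K1; simpl; lia).
    assert (ET : reg S1 r_T = reg S r_T) by (apply K1; simpl; lia).
    exists 0, (reg S1 r_go). split; [ev|]. split; [ev|].
    destruct D1 as [[G C]|[G [St [C0 C]]]]; rewrite G.
    2:{ split; [auto|]. split; [intros; lra|]. intros _. eapply HQ; eauto. lia. }
    split; [lia|]. split; [|intros; lra]. intros _.
    destruct T1 as [[a [Pa Sa]] [Pl [Pe [Pr [Pt Pw]]]]].
    step; intros Hlt.
    + rewrite Pl in Hlt. destruct l1 as [|[u e] l1]; [simpl in Hlt; lra|].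
      destruct Sa as [Ba [Iu [Ie Sa]]]. destruct Pr as [Pu Pr].
      assert (Cl : length ((u, e) :: l1) = Datatypes.S (length l1)) by reflexivity.
      rewrite Cl in *. clear Cl.
      step; intros Hu; rewrite Iu, ET in Hu.
      * step. intros mem2 H2. exists (set_reg S1 r_go 0), ((u, e) :: l1).
        split; [exact H2|]. split; [apply keeps_set; simpl; auto|]. split; [exact B1|].
        split; [exact F1|]. split.
        { repeat split; cbn [fld set_reg]; eauto; try lra.
          exists a; repeat split; auto; lia. }
        right. split; [reflexivity|]. split; [exact Hu|].
        simpl length. split; lia.
      * assert (Pa1 : fld S1 i f_pos + 1 = INR (Datatypes.S a)) by (rewrite Pa, S_INR; reflexivity).
        step. rewrite Iu, Ie. intros mem2 H2. step. rewrite Iu. intros mem3 H3.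
        step. intros mem4 H4. step. intros mem5 H5.
        eexists _, l1. split; [exact H5|]. split; [exact K1|]. split; [exact B1|].
        split; [|split; [|left; split; [exact G | lia]]].
        { intros i' f Hf. rewrite <- F1 by auto. frame. }
        repeat split; fields; auto; try lra.
        { exists (Datatypes.S (Datatypes.S a)). split; [|exact Sa].
          rewrite Pa, !S_INR. ring. }
        { rewrite Pl, S_INR. ring. }
        intros t Hte. rewrite Pw by lra. rewrite work_from_past by lra. ring.
    + rewrite Pl in Hlt. destruct l1 as [|ue l1];
        [|simpl length in Hlt; rewrite S_INR in Hlt; pose proof (pos_INR (length l1)); lra].
      step. intros mem2 H2. exists (set_reg S1 r_go 0), [].
      split; [exact H2|]. split; [apply keeps_set; simpl; auto|]. split; [exact B1|].
      split; [exact F1|]. split.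
      { repeat split; cbn [fld set_reg]; eauto; try lra. }
      right. split; [reflexivity|]. split; [exact Logic.I|]. lia.
  - exists (set_reg S r_go 1), l. split; [exact H1|].
    split; [apply keeps_set; [intros ? ?; reflexivity | simpl; auto]|].
    split; [reflexivity|]. split; [reflexivity|].
    split; [apply tracks_le with T0; auto|]. left. split; [reflexivity | lia].
Qed.

Variable m1 : nat.

Definition extra (X : R) (i : nat) : R := if (i <? m1)%nat then X else 0.

Lemma capacity_correct i M l T0 S mem r (Q : nat -> memory -> Prop) :
  (i < m)%nat -> holds inp L m nb mem S -> reg S r_i = INR i -> reg S r_m1 = INR m1 ->
  tracks M T0 (fld S i) l -> T0 <= reg S r_T -> (1100 + 700 * length l <= r)%nat ->
  (forall S' mem' r' l', holds inp L m nb mem' S' -> keeps [r_go; r_W] S S' -> buf S' = buf S ->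
     (forall i' f, i' <> i \/ (6 <= f)%nat -> fld S' i' f = fld S i' f) ->
     tracks M (reg S r_T) (fld S' i) l' ->
     reg S' r_W = reg S r_W + work M (reg S r_T) ->
     fld S' i f_cap = work M (reg S r_T) + extra (reg S r_X) i ->
     (r + 700 * length l' <= r' + 700 * length l + 1100)%nat -> Q r' mem') ->
  runs (space L m nb) capacity mem r Q.
Proof.
  intros Hi HS Ei Em1 Ht HT Hr HQ. unfold capacity. apply runs_seq.
  eapply advance_correct; eauto; [lia|].
  intros S1 mem1 r1 l1 H1 K1 B1 F1 T1 St1 C1.
  assert (E1 : reg S1 r_i = INR i) by (rewrite <- Ei; apply K1; simpl; lia).
  assert (ET : reg S1 r_T = reg S r_T) by (apply K1; simpl; lia).
  assert (EX : reg S1 r_X = reg S r_X) by (apply K1; simpl; lia).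
  assert (EW : reg S1 r_W = reg S r_W) by (apply K1; simpl; lia).
  assert (Em1' : reg S1 r_m1 = INR m1) by (rewrite <- Em1; apply K1; simpl; lia).
  apply runs_seq.
  (* Both branches store the same value, whether [T] lies in a listed interval or in the unbounded
     last one; stating this separately lets the continuation be treated once. *)
  assert (W : forall Q', (forall mem2, holds inp L m nb mem2 (set_fld S1 i f_cap (work M (reg S r_T)))
      -> Q' (r1 - 100 - 100)%nat mem2) ->
    runs (space L m nb) (IfLt (Cst 0) (Fld (Reg r_i) f_rest)
    (Store (fld_at (Reg r_i) f_cap) (Op Add (Fld (Reg r_i) f_done)
       (Op Mul (Fetch (Op Add (Fld (Reg r_i) f_pos) (Cst 1))) (Op Sub (Reg r_T) (Fld (Reg r_i) f_time)))))
    (Store (fld_at (Reg r_i) f_cap) (Op Add (Fld (Reg r_i) f_done)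
       (Op Mul (Fld (Reg r_i) f_last) (Op Sub (Reg r_T) (Fld (Reg r_i) f_time)))))) mem1 r1 Q').
  { intros Q' HQ'. destruct T1 as [[a [Pa Sa]] [Pl [Pe [Pr [Pt Pw]]]]].
    step; intros Hlt; rewrite Pl in Hlt.
    - destruct l1 as [|[u e] l1]; [simpl in Hlt; lra|].
      destruct Sa as [Ba [Iu [Ie Sa]]].
      assert (Pa1 : fld S1 i f_pos + 1 = INR (Datatypes.S a)) by (rewrite Pa, S_INR; reflexivity).
      step. intros mem2 H2. apply HQ'.
      rewrite (Pw (reg S r_T)) by lra. rewrite work_from_within by (simpl in St1; auto; lra).
      rewrite <- ET, <- Ie. exact H2.
    - destruct l1 as [|ue l1];
        [|simpl length in Hlt; rewrite S_INR in Hlt; pose proof (pos_INR (length l1)); lra].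
      step. intros mem2 H2. apply HQ'.
      rewrite (Pw (reg S r_T)) by lra. simpl work_from. rewrite Rmax_right by lra.
      rewrite <- ET, <- Pe. exact H2. }
  apply W. clear W. intros mem2 H2. step. intros mem3 H3.
  assert (V : fld (set_fld S1 i f_cap (work M (reg S r_T))) i f_cap = work M (reg S r_T)) by (fields; auto).
  rewrite V in H3. cbn [reg set_fld] in H3. rewrite EW in H3.
  step; intros Hlt; cbn in Hlt; rewrite E1, Em1' in Hlt.
  - step. intros mem4 H4. eapply HQ; [exact H4|..].
    + intros k Hk. fields. frame. exfalso; apply Hk; simpl; auto. apply K1; simpl in *; tauto.
    + exact B1.
    + intros i' f Hf. rewrite <- F1 by lia. frame.
    + exact T1.
    + reflexivity.
    + fields. rewrite EX. unfold extra. apply INR_lt in Hlt. apply Nat.ltb_lt in Hlt.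
      rewrite Hlt. reflexivity.
    + lia.
  - step. eapply HQ; [exact H3|..].
    + intros k Hk. fields. frame. exfalso; apply Hk; simpl; auto. apply K1; simpl in *; tauto.
    + exact B1.
    + intros i' f Hf. rewrite <- F1 by lia. frame.
    + exact T1.
    + reflexivity.
    + fields. unfold extra. apply INR_le in Hlt. apply Nat.ltb_ge in Hlt. rewrite Hlt. ring.
    + lia.
Qed.
End Machines.

(** Potential of all pointers together: the number of intervals that they have not yet passed. *)
Fixpoint ahead (ls : nat -> list (R * R)) (n : nat) : nat :=
  match n with O => O | S n' => (ahead ls n' + length (ls n'))%nat end.

Lemma ahead_update ls i l n : (i < n)%nat ->
  (ahead (fun i' => if i' =? i then l else ls i') n + length (ls i) = ahead ls n + length l)%nat.
Proof.
  assert (E : forall k, (k <= i)%nat -> ahead (fun i' => if (i' =? i)%nat then l else ls i') k = ahead ls k).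
  { induction k as [|k IH]; intros H; simpl; [auto|]. rewrite IH by lia.
    destruct (Nat.eqb_spec k i); [lia | auto]. }
  induction n as [|n IH]; intros H; [lia|]. simpl.
  destruct (Nat.eqb_spec n i) as [->|h].
  - rewrite E by lia. lia.
  - specialize (IH ltac:(lia)). lia.
Qed.

Section Guess.

Variables (inp : nat -> R) (L m nb m1 : nat) (Ms : list machine).
Hypothesis HL : (6 <= L)%nat.

Definition cap (X T : R) (i : nat) : R := work (nth_machine Ms i) T + extra m1 X i.

Definition all_track (T : R) (S : state) (ls : nat -> list (R * R)) : Prop :=
  forall i, (i < m)%nat -> tracks inp L (nth_machine Ms i) T (fld S i) (ls i).

Lemma capacities_correct ls T0 S mem r (Q : nat -> memory -> Prop) :
  holds inp L m nb mem S -> reg S r_m = INR m -> reg S r_m1 = INR m1 ->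
  all_track T0 S ls -> T0 <= reg S r_T ->
  (400 + 1300 * m + 700 * ahead ls m <= r)%nat ->
  (forall S' mem' r' ls', holds inp L m nb mem' S' ->
     keeps [r_go; r_W; r_i] S S' -> buf S' = buf S ->
     (forall i f, (6 <= f)%nat -> fld S' i f = fld S i f) ->
     all_track (reg S r_T) S' ls' ->
     reg S' r_W = sum_below (fun i => work (nth_machine Ms i) (reg S r_T)) m ->
     (forall i, (i < m)%nat -> fld S' i f_cap = cap (reg S r_X) (reg S r_T) i) ->
     (r + 700 * ahead ls' m <= r' + 700 * ahead ls m + 300 + 1300 * m)%nat -> Q r' mem') ->
  runs (space L m nb) capacities mem r Q.
Proof.
  intros HS Em Em1 Ht HT Hr HQ. unfold capacities. step. intros mem1 H1.
  (* During the loop the pointers of the machines below [k] stand at the new guess and the others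
     still at [T0]. *)
  set (J := fun (k r1 : nat) (S1 : state) => exists ls1,
     keeps [r_go; r_W; r_i] S S1 /\ buf S1 = buf S /\
     (forall i f, (6 <= f)%nat -> fld S1 i f = fld S i f) /\
     reg S1 r_W = sum_below (fun i => work (nth_machine Ms i) (reg S r_T)) k /\
     (forall i, (i < m)%nat -> (k <= i)%nat ->
        tracks inp L (nth_machine Ms i) T0 (fld S1 i) (ls1 i)) /\
     (forall i, (i < k)%nat ->
        tracks inp L (nth_machine Ms i) (reg S r_T) (fld S1 i) (ls1 i) /\
        fld S1 i f_cap = cap (reg S r_X) (reg S r_T) i) /\
     (r + 700 * ahead ls1 m <= r1 + 700 * ahead ls m + 200 + 1300 * k)%nat /\ (k <= m)%nat).
  apply runs_for with (inp := inp) (J := J) (n := m) (S := set_reg S r_W 0); auto; try lia.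
  - cheap.
  - intros i r1 S1 mem2 (ls1 & K1 & B1 & F1 & W1 & U1 & V1 & C1 & Hk) H2. split; [|lia].
    rewrite <- Em, <- (K1 r_m) by (simpl; lia). ev.
  - intros i r1 S1 mem2 Hi (ls1 & K1 & B1 & F1 & W1 & U1 & V1 & C1 & _) Ei H2.
    assert (ET : reg S1 r_T = reg S r_T) by (apply K1; simpl; lia).
    assert (EX : reg S1 r_X = reg S r_X) by (apply K1; simpl; lia).
    assert (Em1' : reg S1 r_m1 = INR m1) by (rewrite <- Em1; apply K1; simpl; lia).
    assert (Hle : (length (ls1 i) <= ahead ls1 m)%nat).
    { pose proof (ahead_update ls1 i [] m Hi). simpl in H. lia. }
    eapply capacity_correct with (l := ls1 i); eauto.
    + rewrite ET. auto.
    + lia.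
    + intros S2 mem3 r2 l2 H3 K2 B2 F2 T2 W2 P2 C2. exists S2. split; [exact H3|].
      split; [rewrite <- Ei; apply K2; simpl; lia|]. split; [lia|].
      exists (fun i' => if (i' =? i)%nat then l2 else ls1 i').
      pose proof (ahead_update ls1 i l2 m Hi) as Hup.
      split.
      { apply keeps_set; [|simpl; auto]. eapply keeps_trans; eauto.
        intros x; simpl; tauto. }
      split; [rewrite <- B1; exact B2|].
      split; [intros i' f Hf; rewrite <- F1 by auto; cbn; apply F2; auto|].
      split; [cbn; rewrite W2, W1, ET; reflexivity|].
      split.
      { intros i' Hi' Hlt. destruct (Nat.eqb_spec i' i); [lia|]. cbn.
        destruct (U1 i' Hi' ltac:(lia)) as (A1 & A2 & A3 & A4 & A5 & A6).
        unfold tracks. rewrite !F2 by auto. repeat split; auto; try apply A5. }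
      split; [|split; [lia | lia]].
      intros i' Hi'. destruct (Nat.eqb_spec i' i) as [->|].
      * split; [rewrite <- ET; exact T2 | ]. cbn. rewrite P2. unfold cap. rewrite ET, EX. reflexivity.
      * destruct (V1 i' ltac:(lia)) as [(A1 & A2 & A3 & A4 & A5 & A6) A7].
        cbn. unfold tracks. rewrite !F2 by auto. repeat split; auto; try apply A5.
  - intros r1 S1 mem2 (ls1 & K1 & B1 & F1 & W1 & U1 & V1 & C1 & Hk) Ei H2.
    eapply HQ with (ls' := ls1); eauto.
    + intros i Hi. apply V1; auto.
    + intros i Hi. apply V1; auto.
    + lia.
  - exists ls. split.
    { apply keeps_set; [apply keeps_set|]; simpl; auto. intros ? ?; reflexivity. }
    split; [reflexivity|]. split; [reflexivity|]. split; [reflexivity|].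
    split; [intros; apply Ht; auto|]. split; [intros; lia|]. lia.
Qed.

End Guess.

(** * Search through the assignments of the big jobs *)

Section Search.

Variables (inp : nat -> R) (L m nb : nat) (bigs : list R).
Hypothesis HL : (6 <= L)%nat.
Hypothesis Hnb : (length bigs <= nb)%nat.
Hypothesis Hm : (0 < m)%nat.

Definition valid_digits (a : list nat) : Prop :=
  length a = length bigs /\ Forall (fun d => (d < m)%nat) a.

Definition digits (S : state) (a : list nat) : Prop :=
  forall j, (j < length bigs)%nat -> buf S j j_digit = INR (nth j a 0%nat).

Definition sizes (S : state) : Prop :=
  forall j, (j < length bigs)%nat -> buf S j j_big = nth j bigs 0.

Definition good (P W : R) (c : nat -> R) (a : list nat) : Prop :=
  P <= W /\ forall i, (i < m)%nat -> load i bigs a <= c i.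

Definition check_cost := (1000 * (m + length bigs + 1))%nat.

Lemma check_correct c a S mem r (Q : nat -> memory -> Prop) :
  holds inp L m nb mem S -> reg S r_m = INR m -> reg S r_B = INR (length bigs) ->
  valid_digits a -> digits S a -> sizes S ->
  (forall i, (i < m)%nat -> fld S i f_cap = c i) -> (check_cost <= r)%nat ->
  (forall S' mem' r', holds inp L m nb mem' S' ->
     keeps [r_ok; r_i; r_b] S S' -> buf S' = buf S ->
     (forall i f, f <> f_room -> fld S' i f = fld S i f) ->
     (forall i, (i < m)%nat -> fld S' i f_room = c i - load i bigs a) ->
     (reg S' r_ok = 1 /\ good (reg S r_P) (reg S r_W) c a \/
      reg S' r_ok = 0 /\ ~ good (reg S r_P) (reg S r_W) c a) ->
     (r <= r' + check_cost)%nat -> Q r' mem') ->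
  runs (space L m nb) check mem r Q.
Proof.
  intros HS Em EB [La Va] Da Sz Hc Hr HQ. unfold check_cost in *. unfold check.
  apply runs_seq.
  assert (Start : forall Q' : nat -> memory -> Prop,
    (forall mem1 v, holds inp L m nb mem1 (set_reg S r_ok v) ->
       (v = 1 /\ reg S r_P <= reg S r_W \/ v = 0 /\ ~ reg S r_P <= reg S r_W) ->
       Q' (r - 100 - 100)%nat mem1) ->
    runs (space L m nb) (IfLt (Reg r_W) (Reg r_P) (Store (reg_at r_ok) (Cst 0))
      (Store (reg_at r_ok) (Cst 1))) mem r Q').
  { intros Q' HQ'. step; intros h; step; intros mem1 H1; eapply HQ'; try exact H1.
    - right; split; auto; lra.
    - left; split; auto; lra. }
  apply Start. clear Start. intros mem1 v H1 Hv. apply runs_seq.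
  set (J1 := fun (k r1 : nat) (S1 : state) =>
     keeps [r_ok; r_i; r_b] S S1 /\ buf S1 = buf S /\ reg S1 r_ok = v /\
     (forall i f, f <> f_room -> fld S1 i f = fld S i f) /\
     (forall i, (i < k)%nat -> fld S1 i f_room = c i) /\
     (r <= r1 + 300 + 300 * k)%nat /\ (k <= m)%nat).
  apply runs_for with (inp := inp) (J := J1) (n := m) (S := set_reg S r_ok v); auto; try lia.
  { cheap. }
  { intros i r1 S1 mem2 (K1 & B1 & V1 & F1 & R1 & C1 & Hk) H2. split; [|lia].
    rewrite <- Em, <- (K1 r_m) by (simpl; lia). ev. }
  { intros i r1 S1 mem2 Hi (K1 & B1 & V1 & F1 & R1 & C1 & _) Ei H2.
    step. rewrite F1, Hc by (auto; lia). intros mem3 H3. eexists. split; [exact H3|].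
    split; [exact Ei|]. split; [lia|]. split; [apply keeps_set; simpl; auto|].
    split; [exact B1|]. split; [exact V1|]. split.
    { intros i' f Hf. rewrite <- F1 by auto. frame. }
    split; [|lia]. intros i' Hi'. fields. destruct (Nat.eqb_spec i' i); [congruence|].
    apply R1; lia. }
  2:{ split; [|split; [|split; [|split; [|split]]]]; try reflexivity; try lia.
      apply keeps_set; [apply keeps_set|]; simpl; auto. intros ? ?; reflexivity. }
  clear mem1 H1. intros r1 S1 mem1 (K1 & B1 & V1 & F1 & R1 & C1 & _) _ H1.
  apply runs_seq.
  set (J2 := fun (k r2 : nat) (S2 : state) =>
     keeps [r_ok; r_i; r_b] S S2 /\ buf S2 = buf S /\ reg S2 r_ok = v /\
     (forall i f, f <> f_room -> fld S2 i f = fld S i f) /\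
     (forall i, (i < m)%nat -> fld S2 i f_room = c i - load i (firstn k bigs) (firstn k a)) /\
     (r <= r2 + 500 + 300 * m + 300 * k)%nat /\ (k <= length bigs)%nat).
  apply runs_for with (inp := inp) (J := J2) (n := length bigs) (S := S1); auto; try lia.
  { cheap. }
  { intros i r2 S2 mem2 (K2 & B2 & V2 & F2 & R2 & C2 & Hk) H2. split; [|lia].
    rewrite <- EB, <- (K2 r_B) by (simpl; lia). ev. }
  { intros j r2 S2 mem2 Hj (K2 & B2 & V2 & F2 & R2 & C2 & _) Ej H2.
    assert (Dj : buf S2 j j_digit = INR (nth j a 0%nat)) by (rewrite B2; auto).
    assert (Sj : buf S2 j j_big = nth j bigs 0) by (rewrite B2; auto).
    assert (Hd : (nth j a 0 < m)%nat) by (eapply Forall_nth in Va; eauto; lia).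
    step. rewrite Sj, R2 by auto. intros mem3 H3. eexists. split; [exact H3|].
    split; [exact Ej|]. split; [lia|]. split; [apply keeps_set; simpl; auto|].
    split; [exact B2|]. split; [exact V2|]. split.
    { intros i' f Hf. rewrite <- F2 by auto. frame. }
    split; [|lia]. intros i' Hi'. rewrite load_firstn_S by lia. fields.
    destruct (Nat.eqb_spec i' (nth j a 0%nat)) as [->|].
    - rewrite Nat.eqb_refl. ring.
    - rewrite R2 by auto. destruct (Nat.eqb_spec (nth j a 0%nat) i'); [congruence|]. ring. }
  2:{ split; [|split; [|split; [|split; [|split]]]]; auto; try lia.
      - apply keeps_set; simpl; auto.
      - intros i Hi. fields. rewrite R1 by auto. simpl. ring. }
  clear r1 S1 mem1 K1 B1 V1 F1 R1 C1 H1.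
  intros r2 S2 mem2 (K2 & B2 & V2 & F2 & R2 & C2 & _) _ H2.
  rewrite firstn_all in R2. rewrite <- La, firstn_all in R2.
  set (J3 := fun (k r3 : nat) (S3 : state) =>
     keeps [r_ok; r_i; r_b] S S3 /\ buf S3 = buf S /\
     (forall i f, f <> f_room -> fld S3 i f = fld S i f) /\
     (forall i, (i < m)%nat -> fld S3 i f_room = c i - load i bigs a) /\
     (reg S3 r_ok = 1 /\ reg S r_P <= reg S r_W /\
        (forall i, (i < k)%nat -> load i bigs a <= c i) \/
      reg S3 r_ok = 0 /\ ~ good (reg S r_P) (reg S r_W) c a) /\
     (r <= r3 + 700 + 300 * m + 300 * length bigs + 400 * k)%nat /\ (k <= m)%nat).
  apply runs_for with (inp := inp) (J := J3) (n := m) (S := S2); auto; try lia.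
  { cheap. }
  { intros i r3 S3 mem3 (K3 & B3 & F3 & R3 & O3 & C3 & Hk) H3. split; [|lia].
    rewrite <- Em, <- (K3 r_m) by (simpl; lia). ev. }
  { intros i r3 S3 mem3 Hi (K3 & B3 & F3 & R3 & O3 & C3 & _) Ei H3.
    step; rewrite R3 by auto; intros h.
    - step. intros mem4 H4. eexists. split; [exact H4|]. split; [exact Ei|]. split; [lia|].
      split; [apply keeps_set; [apply keeps_set|]; simpl; auto|].
      split; [exact B3|]. split; [exact F3|]. split; [exact R3|]. split; [|lia].
      right. split; [reflexivity|]. intros [_ G]. specialize (G i Hi). lra.
    - step. eexists. split; [exact H3|]. split; [exact Ei|]. split; [lia|].
      split; [apply keeps_set; simpl; auto|].
      split; [exact B3|]. split; [exact F3|]. split; [exact R3|]. split; [|lia].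
      destruct O3 as [[O3 [O4 O5]]|O3]; [left | right; exact O3].
      split; [exact O3|]. split; [exact O4|]. intros i' Hi'.
      destruct (Nat.eq_dec i' i) as [->|]; [lra | apply O5; lia]. }
  { intros r3 S3 mem3 (K3 & B3 & F3 & R3 & O3 & C3 & _) _ H3.
    eapply HQ; eauto.
    lia. }
  split; [apply keeps_set; simpl; auto|].
  split; [exact B2|]. split; [exact F2|]. split; [exact R2|]. split; [|lia].
  destruct Hv as [[-> Hv]|[-> Hv]]; [left | right].
  - split; [exact V2|]. split; [exact Hv|]. intros; lia.
  - split; [exact V2|]. intros [G _]. auto.
Qed.

Definition next_cost := (500 * length bigs + 800)%nat.

Lemma next_correct a S mem r (Q : nat -> memory -> Prop) :
  holds inp L m nb mem S -> reg S r_m = INR m -> reg S r_B = INR (length bigs) ->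
  valid_digits a -> digits S a -> (next_cost <= r)%nat ->
  (forall S' mem' r', holds inp L m nb mem' S' ->
     keeps [r_done; r_b] S S' -> fld S' = fld S ->
     (forall j f, f <> j_digit -> buf S' j f = buf S j f) ->
     ((exists a', reg S' r_done = 0 /\ valid_digits a' /\ digits S' a' /\
         code m a' = Datatypes.S (code m a)) \/
      (reg S' r_done = 1 /\ digits S' (repeat 0%nat (length bigs)) /\
         Datatypes.S (code m a) = (m ^ length bigs)%nat)) ->
     (r <= r' + next_cost)%nat -> Q r' mem') ->
  runs (space L m nb) next_assignment mem r Q.
Proof.
  intros HS Em EB [La Va] Da Hr HQ. unfold next_cost in *. unfold next_assignment.
  step. intros mem1 H1. step. intros mem2 H2.
  (* While [r_done] is 1, the first [b] digits of [a] were maximal and have become zeros, and [a2]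
     is untouched. Incrementing a digit sets [r_b] to [r_B], which leaves the loop. If the loop runs
     off the end instead, [a] was the last assignment. *)
  set (I := fun (r1 : nat) mem' => exists S1 b, holds inp L m nb mem' S1 /\
     keeps [r_done; r_b] S S1 /\ fld S1 = fld S /\
     (forall j f, f <> j_digit -> buf S1 j f = buf S j f) /\
     reg S1 r_b = INR b /\
     ((reg S1 r_done = 1 /\ (r <= r1 + 200 + 400 * b)%nat /\ (b <= length bigs)%nat /\
       exists a2, a = repeat (m - 1)%nat b ++ a2 /\ digits S1 (repeat 0%nat b ++ a2)) \/
      (b = length bigs /\ reg S1 r_done = 0 /\ (r <= r1 + 700 + 400 * length bigs)%nat /\
       exists a', valid_digits a' /\ digits S1 a' /\ code m a' = Datatypes.S (code m a)))).
  apply runs_while with (I := I); [cheap| |].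
  - clear mem1 mem2 H1 H2. intros r1 mem1 (S1 & b & H1 & K1 & F1 & B1 & Eb & D1).
    assert (Em1 : reg S1 r_m = INR m) by (rewrite <- Em; apply K1; simpl; lia).
    assert (EB1 : reg S1 r_B = INR (length bigs)) by (rewrite <- EB; apply K1; simpl; lia).
    exists (INR b), (INR (length bigs)). split; [rewrite <- Eb; ev|]. split; [rewrite <- EB1; ev|].
    split; [destruct D1; lia|]. split.
    + intros Hlt. apply INR_lt in Hlt. destruct D1 as [[G [C [_ [a2 [Ea Da2]]]]]|[G _]]; [|lia].
      assert (Db := Da2 b Hlt). rewrite app_nth2 in Db by (rewrite repeat_length; lia).
      rewrite repeat_length, Nat.sub_diag in Db.
      destruct a2 as [|d a2].
      { subst a. rewrite app_nil_r, repeat_length in La. lia. }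
      simpl in Db.
      assert (Lc : (b + Datatypes.S (length a2) = length bigs)%nat).
      { rewrite <- La, Ea, length_app, repeat_length. reflexivity. }
      assert (Hd : (d < m)%nat /\ Forall (fun d => (d < m)%nat) a2).
      { rewrite Ea in Va. apply Forall_app in Va as [_ Va]. inversion Va; auto. }
      assert (Dupd : forall d', digits (set_buf S1 b j_digit (INR d')) (repeat 0%nat b ++ d' :: a2)).
      { intros d' j Hj. fields. destruct (Nat.eqb_spec j b) as [->|].
        - rewrite app_nth2, repeat_length, Nat.sub_diag by (rewrite repeat_length; lia). reflexivity.
        - rewrite Da2 by auto. f_equal. destruct (Nat.lt_ge_cases j b).
          + rewrite !app_nth1 by (rewrite repeat_length; lia). reflexivity.
          + rewrite !app_nth2 by (rewrite repeat_length; lia). rewrite repeat_length.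
            destruct (j - b)%nat eqn:E; [lia | reflexivity]. }
      assert (Z : Forall (fun d => (d < m)%nat) (repeat 0%nat b)).
      { apply Forall_forall. intros x Hx. apply repeat_spec in Hx. lia. }
      step; rewrite Db, Em1; intros h.
      * rewrite <- S_INR in h. apply INR_lt in h. step. rewrite Db, <- S_INR.
        intros mem2 H2. step. intros mem3 H3. step. intros mem4 H4.
        eexists _, (length bigs). split; [exact H4|].
        split; [apply keeps_set; [apply keeps_set|]; simpl; auto|].
        split; [exact F1|].
        split; [intros j f Hf; rewrite <- B1 by auto; frame|].
        split; [exact EB1|]. right. split; [auto|]. split; [reflexivity|]. split; [lia|].
        exists (repeat 0%nat b ++ Datatypes.S d :: a2). split; [split|split].
        -- rewrite length_app, repeat_length. simpl. lia.
        -- apply Forall_app. split; [auto|]. constructor; [auto | apply Hd].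
        -- apply Dupd.
        -- rewrite code_carry by auto. rewrite Ea. reflexivity.
      * rewrite <- S_INR in h. apply INR_le in h. assert (d = m - 1)%nat by lia. subst d.
        step. intros mem2 H2. step. intros mem3 H3.
        eexists _, (Datatypes.S b). split; [exact H3|].
        split; [apply keeps_set; simpl; auto|].
        split; [exact F1|].
        split; [intros j f Hf; rewrite <- B1 by auto; frame|].
        split; [cbn; rewrite Eb; symmetry; apply S_INR|]. left. split; [exact G|].
        split; [lia|]. split; [lia|]. exists a2. split.
        -- rewrite Ea. clear. induction b as [|b IH]; simpl; [auto | f_equal; auto].
        -- assert (E : repeat 0%nat (Datatypes.S b) ++ a2 = repeat 0%nat b ++ 0%nat :: a2).
           { clear. induction b as [|b IH]; simpl; [auto | f_equal; auto]. }
           rewrite E. exact (Dupd 0%nat).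
    + intros Hge. apply INR_le in Hge. eapply HQ; eauto.
      * destruct D1 as [[G [C [Hb [a2 [Ea Da2]]]]]|[G [Gd [C D1]]]].
        -- right. assert (b = length bigs) by lia. subst b.
           destruct a2 as [|d a2].
           2:{ rewrite Ea, length_app, repeat_length in La. simpl in La. lia. }
           rewrite app_nil_r in *. split; [exact G|]. split; [exact Da2|].
           rewrite Ea. apply code_max; auto.
        -- left. destruct D1 as [a' [A1 [A2 A3]]]. exists a'. auto.
      * destruct D1; lia.
  - eexists _, 0%nat. split; [exact H2|].
    split; [apply keeps_set; [apply keeps_set|]; simpl; auto; intros ? ?; reflexivity|].
    split; [reflexivity|]. split; [reflexivity|]. split; [reflexivity|]. left.
    split; [reflexivity|]. split; [lia|]. split; [lia|]. exists a. split; [reflexivity | exact Da].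
Qed.

Definition search_cost := (2000 * (m + length bigs + 1))%nat.

(** The code of the current assignment measures progress: all smaller codes have been refused and
    paid for. A failed search ends with an overflow, hence with zero digits, which is the state in
    which the search for the next guess has to start. *)
Lemma search_correct c S mem r (Q : nat -> memory -> Prop) :
  holds inp L m nb mem S -> reg S r_m = INR m -> reg S r_B = INR (length bigs) ->
  reg S r_found = 0 -> digits S (repeat 0%nat (length bigs)) -> sizes S ->
  (forall i, (i < m)%nat -> fld S i f_cap = c i) ->
  (300 + m ^ length bigs * search_cost <= r)%nat ->
  (forall S' mem' r', holds inp L m nb mem' S' ->
     keeps [r_done; r_ok; r_i; r_b; r_found] S S' ->
     (forall j f, f <> j_digit -> buf S' j f = buf S j f) ->
     (forall i f, f <> f_room -> fld S' i f = fld S i f) ->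
     ((reg S' r_found = 1 /\ exists a, valid_digits a /\ digits S' a /\
         good (reg S r_P) (reg S r_W) c a /\
         forall i, (i < m)%nat -> fld S' i f_room = c i - load i bigs a) \/
      (reg S' r_found = 0 /\ digits S' (repeat 0%nat (length bigs)) /\
         forall a, valid_digits a -> ~ good (reg S r_P) (reg S r_W) c a)) ->
     (r <= r' + 300 + m ^ length bigs * search_cost)%nat -> Q r' mem') ->
  runs (space L m nb) search mem r Q.
Proof.
  intros HS Em EB E0 D0 Sz Hc Hr HQ. unfold search. step. intros mem1 H1.
  set (I := fun (r1 : nat) mem' => exists S1, holds inp L m nb mem' S1 /\
     keeps [r_done; r_ok; r_i; r_b; r_found] S S1 /\
     (forall j f, f <> j_digit -> buf S1 j f = buf S j f) /\
     (forall i f, f <> f_room -> fld S1 i f = fld S i f) /\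
     ((reg S1 r_done = 0 /\ reg S1 r_found = 0 /\ exists a, valid_digits a /\ digits S1 a /\
       (forall a', valid_digits a' -> (code m a' < code m a)%nat ->
          ~ good (reg S r_P) (reg S r_W) c a') /\
       (r <= r1 + 100 + code m a * search_cost)%nat) \/
      (reg S1 r_done = 1 /\ (100 <= r1)%nat /\
       (r <= r1 + 100 + m ^ length bigs * search_cost)%nat /\
      ((reg S1 r_found = 1 /\ exists a, valid_digits a /\ digits S1 a /\
         good (reg S r_P) (reg S r_W) c a /\
         forall i, (i < m)%nat -> fld S1 i f_room = c i - load i bigs a) \/
      (reg S1 r_found = 0 /\ digits S1 (repeat 0%nat (length bigs)) /\
         forall a, valid_digits a -> ~ good (reg S r_P) (reg S r_W) c a))))).
  apply runs_while with (I := I); [cheap| |].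
  - clear mem1 H1. intros r1 mem1 (S1 & H1 & K1 & B1 & F1 & D1).
    assert (Em1 : reg S1 r_m = INR m) by (rewrite <- Em; apply K1; simpl; lia).
    assert (EB1 : reg S1 r_B = INR (length bigs)) by (rewrite <- EB; apply K1; simpl; lia).
    assert (EP1 : reg S1 r_P = reg S r_P) by (apply K1; simpl; lia).
    assert (EW1 : reg S1 r_W = reg S r_W) by (apply K1; simpl; lia).
    exists (reg S1 r_done), 1. split; [ev|]. split; [ev|].
    destruct D1 as [[G [Gf [a [Va [Da [Na C]]]]]]|[G [C0 [C D1]]]]; rewrite G.
    2:{ split; [auto|]. split; [intros; lra|]. intros _. eapply HQ; eauto. lia. }
    assert (Hcode : (code m a + 1 <= m ^ length bigs)%nat).
    { destruct Va as [V1 V2]. rewrite <- V1. apply code_lt in V2. lia. }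
    assert (Hcost : ((code m a + 1) * search_cost <= m ^ length bigs * search_cost)%nat)
      by (apply Nat.mul_le_mono_r; auto).
    rewrite Nat.mul_add_distr_r, Nat.mul_1_l in Hcost.
    assert (Hsc : (check_cost + next_cost + 400 <= search_cost)%nat)
      by (unfold check_cost, next_cost, search_cost; lia).
    split; [lia|]. split; [|intros; lra]. intros _.
    apply runs_seq. eapply check_correct with (c := c) (a := a); eauto.
    + intros j Hj. rewrite B1 by lia. auto.
    + intros i Hi. rewrite F1 by lia. auto.
    + lia.
    + intros S2 mem2 r2 H2 K2 B2 F2 R2 O2 C2. rewrite EP1, EW1 in O2.
      assert (K12 : keeps [r_done; r_ok; r_i; r_b; r_found] S S2).
      { eapply keeps_trans; [exact K1 | exact K2 | intros x; simpl; tauto]. }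
      assert (F12 : forall i f, f <> f_room -> fld S2 i f = fld S i f).
      { intros i f Hf. rewrite F2, F1 by auto. reflexivity. }
      assert (Ef : reg S2 r_found = 0) by (rewrite <- Gf; apply K2; simpl; lia).
      destruct O2 as [[O2 Gd]|[O2 Ng]].
      * step; rewrite O2; intros h; [|lra]. step. intros mem3 H3. step. intros mem4 H4.
        eexists. split; [exact H4|].
        split; [apply keeps_set; [apply keeps_set; auto|]; simpl; tauto|].
        split; [intros j f Hf; cbn; rewrite B2; auto|]. split; [exact F12|].
        right. split; [reflexivity|]. split; [lia|]. split; [lia|]. left.
        split; [reflexivity|]. exists a. split; [auto|]. split.
        { intros j Hj. cbn. rewrite B2. auto. }
        split; [auto|]. exact R2.
      * step; rewrite O2; intros h; [lra|].
        eapply next_correct with (a := a); [exact H2|..]; auto.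
        -- rewrite <- Em1. apply K2; simpl; lia.
        -- rewrite <- EB1. apply K2; simpl; lia.
        -- intros j Hj. rewrite B2. auto.
        -- lia.
        -- intros S3 mem3 r3 H3 K3 F3 B3 O3 C3. exists S3. split; [exact H3|].
           split; [eapply keeps_trans; [exact K12 | exact K3 | intros x; simpl; tauto]|].
           split; [intros j f Hf; rewrite B3, B2 by auto; auto|].
           split; [intros i f Hf; rewrite F3; auto|].
           assert (Ef3 : reg S3 r_found = 0) by (rewrite <- Ef; apply K3; simpl; lia).
           (* Equal codes of valid assignments mean equal assignments, so refusing [a] settles its
              code and not just this list. *)
           assert (Nle : forall a', valid_digits a' -> (code m a' <= code m a)%nat ->
                     ~ good (reg S r_P) (reg S r_W) c a').
           { intros a' Va' Hle. destruct (Nat.eq_dec (code m a') (code m a)) as [e|].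
             - destruct Va' as [V1' V2'], Va as [V1 V2].
               assert (a' = a) by (apply code_inj with (m := m); auto; lia). subst; auto.
             - apply Na; auto; lia. }
           destruct O3 as [[a' [O4 [O5 [O6 O7]]]]|[O4 [O5 O6]]].
           ++ left. split; [auto|]. split; [auto|]. exists a'. split; [auto|]. split; [auto|].
              split; [intros a'' Va'' Hlt; apply Nle; auto; lia|]. rewrite O7. lia.
           ++ right. split; [auto|]. split; [lia|]. split; [lia|]. right.
              split; [auto|]. split; [auto|]. intros a'' Va''. apply Nle; auto.
              destruct Va'' as [V1 V2]. apply code_lt in V2. rewrite V1 in V2. lia.
  - eexists. split; [exact H1|].
    split; [apply keeps_set; simpl; auto; intros ? ?; reflexivity|].
    split; [reflexivity|]. split; [reflexivity|]. left. split; [reflexivity|].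
    split; [exact E0|]. exists (repeat 0%nat (length bigs)).
    assert (Z : code m (repeat 0%nat (length bigs)) = 0%nat).
    { clear. induction (length bigs); simpl; lia. }
    split.
    { split; [apply repeat_length|]. apply Forall_forall. intros x Hx.
      apply repeat_spec in Hx. lia. }
    split; [exact D0|]. rewrite Z. split; [intros; lia|]. lia.
Qed.

End Search.

(** * Between the passes: big jobs, guesses, open machines *)

Lemma firstn_snoc {A : Type} (d : A) k l : (k < length l)%nat ->
  firstn (S k) l = firstn k l ++ [nth k l d].
Proof.
  revert k; induction l as [|x l IH]; intros [|k] H; simpl in *; try lia; auto.
  f_equal. apply IH. lia.
Qed.

Lemma above_length s p : (length (above s p) <= length p)%nat.
Proof. apply filter_length_le. Qed.

(* Only machines with room for an arbitrary small job: then a single step of next fit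
   suffices per job. *)
Fixpoint opens (s : R) (room : nat -> R) (n : nat) : list (nat * R) :=
  match n with
  | O => []
  | S n' => opens s room n' ++ (if Rlt_dec (room n') s then [] else [(n', room n')])
  end.

Lemma opens_length s room n : (length (opens s room n) <= n)%nat.
Proof.
  induction n as [|n IH]; simpl; [auto|]. rewrite length_app.
  destruct (Rlt_dec (room n) s); simpl; lia.
Qed.

Section Between.

Variables (inp : nat -> R) (L m nb m1 : nat) (Ms : list machine).
Hypothesis HL : (6 <= L)%nat.
Hypothesis Hm : (0 < m)%nat.

Lemma all_track_ext T S S' ls : all_track inp L m Ms T S ls ->
  (forall i f, (f < 5)%nat -> fld S' i f = fld S i f) -> all_track inp L m Ms T S' ls.
Proof.
  intros H E i Hi. destruct (H i Hi) as (A1 & A2 & A3 & A4 & A5 & A6).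
  unfold tracks. rewrite !E by lia. repeat split; auto; apply A5.
Qed.

Lemma select_big_correct ks S mem r (Q : nat -> memory -> Prop) :
  holds inp L m nb mem S -> reg S r_kept = INR (length ks) -> (length ks <= nb)%nat ->
  (forall j, (j < length ks)%nat -> buf S j j_kept = nth j ks 0) -> reg S r_B = 0 ->
  (500 * length ks + 600 <= r)%nat ->
  (forall S' mem' r', holds inp L m nb mem' S' ->
     keeps [r_delta; r_s; r_X; r_B; r_i] S S' -> fld S' = fld S ->
     (forall j f, f <> j_big -> buf S' j f = buf S j f) ->
     reg S' r_delta = reg S r_delta * reg S r_P ->
     reg S' r_s = reg S r_q * reg S r_P ->
     reg S' r_X = reg S r_e0 * (reg S r_delta * reg S r_P) ->
     reg S' r_B = INR (length (above (reg S r_q * reg S r_P) ks)) ->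
     sizes (above (reg S r_q * reg S r_P) ks) S' ->
     (r <= r' + (500 * length ks + 600))%nat -> Q r' mem') ->
  runs (space L m nb) select_big mem r Q.
Proof.
  intros HS Ek Hnb Hks HB Hr HQ. unfold select_big. step. intros mem1 H1. step. intros mem2 H2.
  step. intros mem3 H3. set (s := reg S r_q * reg S r_P) in *.
  set (J := fun (k r1 : nat) (S1 : state) =>
     keeps [r_delta; r_s; r_X; r_B; r_i] S S1 /\ fld S1 = fld S /\
     (forall j f, f <> j_big -> buf S1 j f = buf S j f) /\
     reg S1 r_delta = reg S r_delta * reg S r_P /\ reg S1 r_s = s /\
     reg S1 r_X = reg S r_e0 * (reg S r_delta * reg S r_P) /\
     reg S1 r_B = INR (length (above s (firstn k ks))) /\
     sizes (above s (firstn k ks)) S1 /\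
     (r <= r1 + 400 + 500 * k)%nat /\ (k <= length ks)%nat).
  eapply runs_for with (inp := inp) (J := J) (n := length ks); [lia|lia|cheap|..]; [| | |exact H3|..].
  - intros i r1 S1 mem4 (K1 & F1 & B1 & D1 & E1 & X1 & L1 & Z1 & C1 & Hk) H4. split; [|lia].
    rewrite <- Ek, <- (K1 r_kept) by (simpl; lia). ev.
  - intros i r1 S1 mem4 Hi (K1 & F1 & B1 & D1 & E1 & X1 & L1 & Z1 & C1 & _) Ei H4.
    assert (Bi : buf S1 i j_kept = nth i ks 0) by (rewrite B1 by lia; auto).
    assert (Ab : above s (firstn (Datatypes.S i) ks) =
                 above s (firstn i ks) ++ (if Rlt_dec s (nth i ks 0) then [nth i ks 0] else [])).
    { rewrite (firstn_snoc 0) by auto. unfold above. rewrite filter_app. simpl.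
      destruct (Rlt_dec s (nth i ks 0)); reflexivity. }
    set (n1 := length (above s (firstn i ks))) in *.
    (* At most [i] of the first [i] kept jobs are big, so the next write lies within the job
       table. *)
    assert (Hn1 : (n1 <= i)%nat).
    { unfold n1. eapply Nat.le_trans; [apply above_length|]. rewrite length_firstn. lia. }
    step; rewrite Bi, E1; intros h.
    + step. rewrite Bi. intros mem5 H5. step. intros mem6 H6.
      eexists. split; [exact H6|]. split; [exact Ei|]. split; [lia|].
      split; [apply keeps_set; [apply keeps_set|]; simpl; tauto|].
      split; [exact F1|]. split; [intros j f Hf; rewrite <- B1 by auto; frame|].
      split; [exact D1|]. split; [exact E1|]. split; [exact X1|].
      rewrite Ab. destruct (Rlt_dec s (nth i ks 0)) as [_|]; [|tauto].
      unfold sizes. rewrite length_app, plus_INR. fold n1. cbn [length].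
      split; [cbn [reg set_reg set_buf Nat.eqb]; rewrite L1; reflexivity|]. split; [|lia].
      intros j Hj. fields. destruct (Nat.eqb_spec j n1) as [->|].
      * unfold n1. rewrite nth_middle. reflexivity.
      * rewrite Z1 by (fold n1; lia). rewrite app_nth1 by (fold n1; lia). reflexivity.
    + step. eexists. split; [exact H4|]. split; [exact Ei|]. split; [lia|].
      split; [apply keeps_set; simpl; tauto|].
      split; [exact F1|]. split; [exact B1|].
      split; [exact D1|]. split; [exact E1|]. split; [exact X1|].
      rewrite Ab. destruct (Rlt_dec s (nth i ks 0)); [lra|]. rewrite app_nil_r.
      split; [exact L1|]. split; [exact Z1 | lia].
  - intros r1 S1 mem4 (K1 & F1 & B1 & D1 & E1 & X1 & L1 & Z1 & C1 & _) Ei H4.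
    rewrite firstn_all in L1, Z1. eapply HQ; eauto. lia.
  - lia.
  - split.
    { repeat (apply keeps_set; [|simpl; tauto]). intros ? ?; reflexivity. }
    split; [reflexivity|]. split; [reflexivity|]. split; [reflexivity|].
    split; [reflexivity|]. split; [reflexivity|]. split; [exact HB|].
    split; [intros j Hj; simpl in Hj; lia|]. lia.
Qed.

Lemma list_open_correct room S mem r (Q : nat -> memory -> Prop) :
  holds inp L m nb mem S -> reg S r_m = INR m ->
  (forall i, (i < m)%nat -> fld S i f_room = room i) ->
  (600 * m + 700 <= r)%nat ->
  (forall S' mem' r', holds inp L m nb mem' S' ->
     keeps [r_cur; r_i; r_b] S S' -> buf S' = buf S -> reg S' r_cur = 0 -> reg S' r_b = 0 ->
     (forall j, (j < length (opens (reg S r_s) room m))%nat ->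
        fld S' j f_open = INR (fst (nth j (opens (reg S r_s) room m) (0%nat, 0))) /\
        fld S' j f_space = snd (nth j (opens (reg S r_s) room m) (0%nat, 0))) ->
     (r <= r' + (600 * m + 700))%nat -> Q r' mem') ->
  runs (space L m nb) list_open mem r Q.
Proof.
  intros HS Em Hroom Hr HQ. unfold list_open. step. intros mem1 H1. apply runs_seq.
  set (s := reg S r_s) in *.
  set (J := fun (k r1 : nat) (S1 : state) =>
     keeps [r_cur; r_i; r_b] S S1 /\ buf S1 = buf S /\
     (forall i, (i < m)%nat -> fld S1 i f_room = room i) /\
     reg S1 r_cur = INR (length (opens s room k)) /\
     (forall j, (j < length (opens s room k))%nat ->
        fld S1 j f_open = INR (fst (nth j (opens s room k) (0%nat, 0))) /\
        fld S1 j f_space = snd (nth j (opens s room k) (0%nat, 0))) /\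
     (r <= r1 + 200 + 600 * k)%nat /\ (k <= m)%nat).
  eapply runs_for with (inp := inp) (J := J) (n := m); [lia|lia|cheap|..]; [| | |exact H1|..].
  - intros i r1 S1 mem4 (K1 & B1 & R1 & L1 & O1 & C1 & Hk) H4. split; [|lia].
    rewrite <- Em, <- (K1 r_m) by (simpl; lia). ev.
  - intros i r1 S1 mem4 Hi (K1 & B1 & R1 & L1 & O1 & C1 & _) Ei H4.
    assert (Es : reg S1 r_s = s) by (apply K1; simpl; lia).
    pose proof (opens_length s room i) as Hlen.
    set (n1 := length (opens s room i)) in *.
    assert (On : opens s room (Datatypes.S i) =
      opens s room i ++ (if Rlt_dec (room i) s then [] else [(i, room i)])) by reflexivity.
    step; rewrite Es, R1 by auto; intros h.
    + step. eexists. split; [exact H4|]. split; [exact Ei|]. split; [lia|].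
      split; [apply keeps_set; simpl; tauto|]. split; [exact B1|]. split; [exact R1|].
      rewrite On. destruct (Rlt_dec (room i) s); [|tauto]. rewrite app_nil_r.
      split; [exact L1|]. split; [exact O1 | lia].
    + step. intros mem5 H5. step. intros mem6 H6. step. intros mem7 H7.
      eexists. split; [exact H7|]. split; [exact Ei|]. split; [lia|].
      split; [apply keeps_set; [apply keeps_set|]; simpl; tauto|]. split; [exact B1|].
      split; [intros i' Hi'; rewrite <- R1 by auto; frame|].
      rewrite On. destruct (Rlt_dec (room i) s); [lra|].
      rewrite length_app, plus_INR. fold n1. cbn [length].
      split; [cbn [reg set_reg set_fld Nat.eqb]; rewrite L1; reflexivity|]. split; [|lia].
      intros j Hj. fields. destruct (Nat.eqb_spec j n1) as [->|].
      * unfold n1. rewrite nth_middle. split; [exact Ei | apply R1; auto].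
      * rewrite app_nth1 by (fold n1; lia). apply O1. fold n1; lia.
  - intros r1 S1 mem4 (K1 & B1 & R1 & L1 & O1 & C1 & _) Ei H4.
    step. intros mem5 H5. step. intros mem6 H6. eapply HQ; [exact H6|..]; auto.
    + apply keeps_set; [apply keeps_set|]; simpl; tauto.
    + lia.
  - lia.
  - split.
    { apply keeps_set; [apply keeps_set|]; simpl; try tauto. intros ? ?; reflexivity. }
    split; [reflexivity|]. split; [exact Hroom|]. split; [reflexivity|].
    split; [intros j Hj; simpl in Hj; lia|]. lia.
Qed.

Variable bigs : list R.
Hypothesis Hnb : (length bigs <= nb)%nat.

Definition accept (P X T : R) (a : list nat) : Prop :=
  valid_digits m bigs a /\
  good m bigs P (sum_below (fun i => work (nth_machine Ms i) T) m) (cap m1 Ms X T) a.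

Definition round_cost := (1000 + 1300 * m + m ^ length bigs * search_cost m bigs)%nat.

(** The postcondition records that the guess before the accepted one was refused, which is what
    bounds the accepted guess by the optimum plus [delta]. For [k = 0] there is no earlier guess, as
    the first one tried is [delta], not 0. [Tmax] limits the number of rounds. *)
Lemma guess_correct ls q Tmax S mem r (Q : nat -> memory -> Prop) :
  holds inp L m nb mem S -> reg S r_m = INR m -> reg S r_m1 = INR m1 ->
  reg S r_B = INR (length bigs) -> reg S r_found = 0 -> reg S r_T = 0 ->
  0 < reg S r_delta -> 0 < Tmax <= INR q * reg S r_delta ->
  (forall T, Tmax <= T -> exists a, accept (reg S r_P) (reg S r_X) T a) ->
  digits bigs S (repeat 0%nat (length bigs)) -> sizes bigs S ->
  all_track inp L m Ms 0 S ls ->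
  (q * round_cost + 700 * ahead ls m + 200 <= r)%nat ->
  (forall S' mem' r' k a, holds inp L m nb mem' S' ->
     keeps [r_T; r_go; r_W; r_i; r_done; r_ok; r_b; r_found] S S' ->
     (forall j f, f <> j_digit -> buf S' j f = buf S j f) ->
     digits bigs S' a ->
     accept (reg S r_P) (reg S r_X) (INR (Datatypes.S k) * reg S r_delta) a ->
     (k = 0%nat \/ forall a, ~ accept (reg S r_P) (reg S r_X) (INR k * reg S r_delta) a) ->
     (forall i, (i < m)%nat -> fld S' i f_room =
        cap m1 Ms (reg S r_X) (INR (Datatypes.S k) * reg S r_delta) i - load i bigs a) ->
     (r <= r' + (q * round_cost + 700 * ahead ls m + 200))%nat -> Q r' mem') ->
  runs (space L m nb) guess mem r Q.
Proof.
  intros HS Em Em1 EB E0 ET Hd HT Hacc D0 Sz Ht Hr HQ. unfold guess.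
  set (P := reg S r_P) in *. set (X := reg S r_X) in *. set (d := reg S r_delta) in *.
  set (mods := [r_T; r_go; r_W; r_i; r_done; r_ok; r_b; r_found]) in *.
  set (I := fun (r1 : nat) mem' => exists S1 k, holds inp L m nb mem' S1 /\
     keeps mods S S1 /\
     (forall j f, f <> j_digit -> buf S1 j f = buf S j f) /\
     (k = 0%nat \/ forall a, ~ accept P X (INR k * d) a) /\ (k < q)%nat /\
     ((reg S1 r_found = 0 /\ reg S1 r_T = INR k * d /\
       digits bigs S1 (repeat 0%nat (length bigs)) /\
       exists ls1, all_track inp L m Ms (INR k * d) S1 ls1 /\
         (r + 700 * ahead ls1 m <= r1 + 700 * ahead ls m + k * round_cost)%nat) \/
      (reg S1 r_found = 1 /\ (100 <= r1)%nat /\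
       (r <= r1 + 700 * ahead ls m + Datatypes.S k * round_cost)%nat /\
       exists a, digits bigs S1 a /\ accept P X (INR (Datatypes.S k) * d) a /\
         forall i, (i < m)%nat ->
           fld S1 i f_room = cap m1 Ms X (INR (Datatypes.S k) * d) i - load i bigs a))).
  (* Guesses from [Tmax] on are accepted and [Tmax <= q * delta], so fewer than [q] guesses are ever
     refused; this secures the credits for one more round. *)
  assert (Hlt : forall k, (k = 0%nat \/ forall a, ~ accept P X (INR k * d) a) -> (k < q)%nat).
  { intros k Hk. apply INR_lt. apply Rmult_lt_reg_r with d; [lra|].
    destruct Hk as [->|Hk]; [simpl; lra|].
    destruct (Rlt_le_dec (INR k * d) Tmax); [lra|].
    destruct (Hacc (INR k * d)) as [a Ha]; [lra|]. elim (Hk a Ha). }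
  apply runs_while with (I := I); [cheap| |].
  - intros r1 mem1 (S1 & k & H1 & K1 & B1 & N1 & Hkq & D1).
    assert (Hround : (k * round_cost + round_cost <= q * round_cost)%nat) by nia.
    assert (Em' : reg S1 r_m = INR m) by (rewrite <- Em; apply K1; simpl; lia).
    assert (Em1' : reg S1 r_m1 = INR m1) by (rewrite <- Em1; apply K1; simpl; lia).
    assert (EB1 : reg S1 r_B = INR (length bigs)) by (rewrite <- EB; apply K1; simpl; lia).
    assert (EP1 : reg S1 r_P = P) by (apply K1; simpl; lia).
    assert (EX1 : reg S1 r_X = X) by (apply K1; simpl; lia).
    assert (Ed1 : reg S1 r_delta = d) by (apply K1; simpl; lia).
    exists (reg S1 r_found), 1. split; [ev|]. split; [ev|].
    destruct D1 as [[G [GT [Dz [ls1 [Tr C]]]]]|[G [C0 [C [a [Da [Ac Rm]]]]]]]; rewrite G.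
    2:{ split; [auto|]. split; [intros; lra|]. intros _. eapply HQ; eauto. rewrite Nat.mul_succ_l in C. lia. }
    assert (Hrc : (1000 + 1300 * m + m ^ length bigs * search_cost m bigs <= round_cost)%nat)
      by (unfold round_cost; lia).
    split; [lia|]. split; [|intros; lra]. intros _.
    step. intros mem2 H2. apply runs_seq.
    set (T := INR (Datatypes.S k) * d) in *.
    assert (ET2 : reg (set_reg S1 r_T (reg S1 r_T + reg S1 r_delta)) r_T = T).
    { cbn [reg set_reg Nat.eqb]. rewrite GT, Ed1. unfold T. rewrite S_INR. ring. }
    set (S2 := set_reg S1 r_T (reg S1 r_T + reg S1 r_delta)) in *.
    assert (K2 : keeps mods S S2) by (apply keeps_set; [auto | simpl; tauto]).
    eapply capacities_correct with (S := S2) (ls := ls1) (T0 := INR k * d); eauto.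
    { rewrite ET2. unfold T. rewrite S_INR. lra. }
    { lia. }
    intros S3 mem3 r3 ls3 H3 K3 B3 F3 Tr3 W3 P3 C3.
    rewrite ET2 in Tr3, W3, P3. change (reg S2 r_X) with (reg S1 r_X) in P3. rewrite EX1 in P3.
    assert (K23 : keeps mods S S3).
    { eapply keeps_trans; [exact K2 | exact K3 | intros x; simpl; tauto]. }
    assert (EP3 : reg S3 r_P = P) by (apply K23; simpl; lia).
    eapply search_correct with (S := S3) (bigs := bigs) (c := cap m1 Ms X T); eauto.
    { rewrite <- Em. apply K23; simpl; lia. }
    { rewrite <- EB. apply K23; simpl; lia. }
    { rewrite <- G. apply K3; simpl; lia. }
    { intros j Hj. rewrite B3. apply Dz; auto. }
    { intros j Hj. rewrite B3. cbn [buf S2 set_reg]. rewrite B1 by lia. auto. }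
    { lia. }
    intros S4 mem4 r4 H4 K4 B4 F4 O4 C4.
    assert (K34 : keeps mods S S4).
    { eapply keeps_trans; [exact K23 | exact K4 | intros x; simpl; tauto]. }
    assert (B34 : forall j f, f <> j_digit -> buf S4 j f = buf S j f).
    { intros j f Hf. rewrite B4, B3 by auto. apply B1; auto. }
    rewrite EP3, W3 in O4.
    destruct O4 as [[O4 [a [Va [Da [Ga Ra]]]]]|[O4 [Dz4 Na]]].
    + exists S4, k. repeat (split; [assumption|]). right. split; [auto|].
      split; [lia|]. split; [rewrite Nat.mul_succ_l; lia|]. exists a. split; [auto|]. split; [|auto].
      split; auto.
    + assert (N4 : Datatypes.S k = 0%nat \/ forall a, ~ accept P X (INR (Datatypes.S k) * d) a).
      { right. intros a [Va Ga]. apply (Na a); auto. }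
      exists S4, (Datatypes.S k). repeat (split; [auto|]). left. split; [auto|].
      split; [rewrite (K4 r_T), (K3 r_T) by (simpl; lia); exact ET2|].
      split; [auto|]. exists ls3. split.
      * eapply all_track_ext; [exact Tr3|]. intros i f Hf. apply F4. lia.
      * rewrite Nat.mul_succ_l. lia.
  - exists S, 0%nat. split; [exact HS|]. split; [intros ? ?; reflexivity|].
    split; [reflexivity|]. split; [auto|]. split; [apply Hlt; auto|]. left.
    split; [exact E0|]. split; [rewrite ET; simpl; ring|]. split; [exact D0|].
    exists ls. simpl INR. rewrite Rmult_0_l. split; [exact Ht | lia].
Qed.

End Between.

(** * Input encoding and initialization *)

Lemma skipn_cons {A : Type} (d : A) k l : (k < length l)%nat ->
  skipn k l = nth k l d :: skipn (S k) l.
Proof.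
  revert k; induction l as [|x l IH]; intros [|k] H; simpl in *; try lia; auto.
  apply IH. lia.
Qed.

Lemma seg_app pre l post inp L :
  (forall a, inp a = nth a (pre ++ flat_map (fun te => [fst te; snd te]) l ++ post) 0) ->
  (6 <= length pre)%nat -> (length pre + 2 * length l + length post = L)%nat ->
  seg inp L (length pre) l.
Proof.
  revert pre; induction l as [|[u e] l IH]; intros pre Hi H6 HL; simpl; [trivial|].
  simpl in Hi, HL.
  assert (E : forall v, pre ++ u :: e :: v = (pre ++ [u; e]) ++ v)
    by (intros; rewrite <- app_assoc; reflexivity).
  split; [lia|]. split; [|split].
  - rewrite Hi, nth_middle. reflexivity.
  - rewrite Hi, app_nth2, Nat.sub_succ_l, Nat.sub_diag by lia. reflexivity.
  - replace (S (S (length pre))) with (length (pre ++ [u; e])) by (rewrite length_app; simpl; lia).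
    apply IH.
    + intros a. rewrite Hi, E. reflexivity.
    + rewrite length_app; lia.
    + rewrite length_app; simpl; lia.
Qed.

Lemma length_flat_pairs (l : list (R * R)) :
  length (flat_map (fun te => [fst te; snd te]) l) = (2 * length l)%nat.
Proof. induction l as [|x l IH]; simpl in *; lia. Qed.

Lemma machines_at_app pre Ms inp L :
  (forall a, inp a = nth a (pre ++ flat_map encode_machine Ms) 0) ->
  (6 <= length pre)%nat -> (length pre + length (flat_map encode_machine Ms) = L)%nat ->
  machines_at inp L (length pre) Ms.
Proof.
  revert pre; induction Ms as [|M Ms IH]; intros pre Hi H6 HL; simpl in *; [lia|].
  set (b := flat_map (fun te => [fst te; snd te]) (intervals M)) in *.
  assert (Lb : length b = (2 * length (intervals M))%nat) by apply length_flat_pairs.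
  rewrite length_app, Lb in HL.
  assert (E : forall v, pre ++ INR (length (intervals M)) :: last_ratio M :: v =
     (pre ++ [INR (length (intervals M)); last_ratio M]) ++ v)
    by (intros; rewrite <- app_assoc; reflexivity).
  split; [split; [lia|split; [|split]]|].
  - rewrite Hi, nth_middle. reflexivity.
  - rewrite Hi, app_nth2, Nat.sub_succ_l, Nat.sub_diag by lia. reflexivity.
  - replace (S (S (length pre))) with
      (length (pre ++ [INR (length (intervals M)); last_ratio M])) by (rewrite length_app; simpl; lia).
    apply seg_app with (post := flat_map encode_machine Ms).
    + intros a. rewrite Hi, E. reflexivity.
    + rewrite length_app; lia.
    + rewrite length_app; simpl; lia.
  - replace (length pre + _)%nat with
      (length (pre ++ INR (length (intervals M)) :: last_ratio M :: b))
      by (rewrite length_app; simpl; lia).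
    apply IH.
    + intros a. rewrite Hi, <- app_assoc. reflexivity.
    + rewrite length_app; lia.
    + rewrite length_app; simpl; lia.
Qed.

Section Before.

Variables (inp : nat -> R) (L m nb m1 : nat) (Ms : list machine) (eps e0 pmax : R).
Hypothesis HL : (6 <= L)%nat.
Hypothesis Hm : (0 < m)%nat.
Hypothesis HMs : length Ms = m.
Hypothesis Heps : 0 < eps < 1.
Hypothesis I1 : inp 1%nat = eps.
Hypothesis I2 : inp 2%nat = e0.
Hypothesis I3 : inp 3%nat = INR m.
Hypothesis I4 : inp 4%nat = INR m1.
Hypothesis I5 : inp 5%nat = pmax.
Hypothesis Iend : forall a, (L <= a)%nat -> inp a = 0.
Hypothesis Iat : machines_at inp L 6 Ms.

Lemma eval_cell sp mem n : (n < sp)%nat -> eval sp mem (cell (Z.of_nat n)) = Some (mem n).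
Proof. intros H. eapply eval_fetch; [apply eval_nat | reflexivity | auto]. Qed.

(** Written as the program computes it: [INR m + eps] is the content of cell 1 at that time. *)
Definition q0 : R := (INR m + eps - INR m) * e0 * INR m1 / (2 * INR m * INR m).
Definition delta0 : R := (INR m + eps - INR m) / (2 * INR m).

Definition state0 : state :=
  State (INR L)
    (fun k => match k with
              | 0 => INR m | 1 => INR m1 | 2 => pmax | 3 => q0 | 6 => delta0 | 7 => e0 | _ => 0%R
              end%nat) (fun _ _ => 0) (fun _ _ => 0).

Definition scanned (mem : memory) : Prop :=
  mem 0%nat = INR L /\ mem 1%nat = INR m + eps /\
  (forall b, (2 <= b < 6)%nat -> mem b = inp b).

Lemma find_end_correct r (Q : nat -> memory -> Prop) : (500 * m + 200 <= r)%nat ->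
  (forall mem r', scanned mem -> (forall b, (6 <= b)%nat -> mem b = inp b) ->
     (r <= r' + (500 * m + 200))%nat -> Q r' mem) ->
  runs (space L m nb) find_end inp r Q.
Proof.
  intros Hr HQ. unfold find_end. apply runs_seq.
  assert (Hsp : (6 < space L m nb)%nat) by (unfold space; lia).
  eapply runs_store with (x := INR 0) (l := 0%nat); [reflexivity | apply address_INR; lia
    | reflexivity | cheap | lia |].
  set (I := fun (r1 : nat) (mem : memory) => exists k rest a, (length rest + k = m)%nat /\
     mem 0%nat = INR a /\ mem 1%nat = INR k + eps /\
     (forall b, (2 <= b)%nat -> mem b = inp b) /\ machines_at inp L a rest /\
     (r <= r1 + 100 + 300 * k)%nat).
  apply runs_while with (I := I); [cheap| |].
  - intros r1 mem (k & rest & a & Hk & M0 & M1 & Mb & Ha & C).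
    exists (mem 1%nat), (mem 3%nat).
    split; [apply (eval_cell _ _ 1); lia|]. split; [apply (eval_cell _ _ 3); lia|].
    rewrite M1, (Mb 3%nat), I3 by lia. split; [lia|]. split; intros h.
    + destruct rest as [|M rest].
      { simpl in Hk. subst k. lra. }
      destruct Ha as [[Ba [Ea _]] Ha]. simpl in Hk.
      assert (V : eval (space L m nb) mem (cell 0) = Some (INR a))
        by (rewrite <- M0; apply (eval_cell _ _ 0); lia).
      apply runs_seq. eapply runs_store with (x := INR 0) (l := 0%nat);
        [reflexivity | apply address_INR; lia | | cheap | lia |].
      { eapply eval_add; [exact V|]. eapply eval_add; [apply eval_cst|].
        eapply eval_mul; [apply eval_cst|].
        eapply eval_fetch; [exact V | reflexivity | unfold space; lia]. }
      eapply runs_store with (x := INR 1) (l := 1%nat);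
        [reflexivity | apply address_INR; lia | | cheap | lia |].
      { eapply eval_add; [apply (eval_cell _ _ 1); lia | apply eval_cst]. }
      exists (S k), rest, (a + (2 + 2 * length (intervals M)))%nat.
      split; [lia|]. split.
      { unfold update. cbn [Nat.eqb]. rewrite (Mb a), Ea by lia.
        rewrite !plus_INR, mult_INR. simpl INR. ring. }
      split; [unfold update; simpl Nat.eqb; cbv iota; rewrite M1, S_INR; ring|].
      split; [intros b Hb; unfold update; destruct (Nat.eqb_spec b 1), (Nat.eqb_spec b 0); try lia; auto|].
      split; [exact Ha | lia].
    + assert (k = m).
      { destruct (Nat.lt_ge_cases k m) as [hk|]; [|lia].
        apply le_INR in hk. rewrite S_INR in hk. lra. }
      subst k. destruct rest; [|simpl in Hk; lia]. simpl in Ha. subst a.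
      apply HQ.
      * split; [exact M0|]. split; [exact M1|]. intros b Hb. apply Mb; lia.
      * intros b Hb. apply Mb; lia.
      * lia.
  - exists 0%nat, Ms, 6%nat. split; [lia|].
    split; [unfold update; simpl; lra|]. split; [unfold update; simpl; rewrite I1; lra|].
    split; [intros b Hb; unfold update; destruct (Nat.eqb_spec b 0); [lia | auto]|].
    split; [exact Iat | lia].
Qed.

Lemma scanned_update mem k v : scanned mem -> scanned (update mem (L + k) v).
Proof.
  intros (H0 & H1 & H2). unfold scanned, update.
  destruct (Nat.eqb_spec 0 (L + k)), (Nat.eqb_spec 1 (L + k)); try lia.
  repeat split; auto. intros b Hb. destruct (Nat.eqb_spec b (L + k)); [lia | auto].
Qed.

Lemma scanned_cell mem n v : scanned mem -> (n < 6)%nat ->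
  v = match n with O => INR L | S O => INR m + eps | _ => inp n end ->
  eval (space L m nb) mem (cell (Z.of_nat n)) = Some v.
Proof.
  intros (H0 & H1 & H2) Hn ->. rewrite eval_cell by (unfold space; lia). f_equal.
  destruct n as [|[|n]]; auto. apply H2; lia.
Qed.

Lemma runs_store_scanned mem k e v r (Q : nat -> memory -> Prop) :
  scanned mem -> (k < 20)%nat -> eval (space L m nb) mem e = Some v ->
  (1 + cost (Op Add (cell 0) (Cst (Z.of_nat k))) + cost e <= 100)%nat -> (100 <= r)%nat ->
  (scanned (update mem (L + k) v) -> Q (r - 100)%nat (update mem (L + k) v)) ->
  runs (space L m nb) (Store (Op Add (cell 0) (Cst (Z.of_nat k))) e) mem r Q.
Proof.
  intros H Hk He Hc Hr HQ. eapply runs_store with (x := INR (L + k)) (l := (L + k)%nat); eauto.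
  - rewrite plus_INR. eapply eval_add; [apply (scanned_cell mem 0); auto; lia | apply eval_nat].
  - apply address_INR. unfold space; lia.
  - apply HQ, scanned_update, H.
Qed.

Lemma runs_store_scanned0 mem e v r (Q : nat -> memory -> Prop) :
  scanned mem -> eval (space L m nb) mem e = Some v ->
  (1 + cost (cell 0) + cost e <= 100)%nat -> (100 <= r)%nat ->
  (scanned (update mem (L + 0) v) -> Q (r - 100)%nat (update mem (L + 0) v)) ->
  runs (space L m nb) (Store (cell 0) e) mem r Q.
Proof.
  intros H He Hc Hr HQ. eapply runs_store with (x := INR L) (l := (L + 0)%nat); eauto.
  - apply (scanned_cell mem 0); auto; lia.
  - rewrite Nat.add_0_r. apply address_INR. unfold space; lia.
  - apply HQ, scanned_update, H.
Qed.

Ltac cells :=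
  repeat first
    [ apply eval_cst
    | eapply eval_add | eapply eval_sub | eapply eval_mul
    | lazymatch goal with
      | |- eval _ _ (cell 0) = _ => eapply (scanned_cell _ 0); [eassumption | lia | reflexivity]
      | |- eval _ _ (cell 1) = _ => eapply (scanned_cell _ 1); [eassumption | lia | reflexivity]
      | |- eval _ _ (cell 2) = _ => eapply (scanned_cell _ 2); [eassumption | lia | symmetry; exact I2]
      | |- eval _ _ (cell 3) = _ => eapply (scanned_cell _ 3); [eassumption | lia | symmetry; exact I3]
      | |- eval _ _ (cell 4) = _ => eapply (scanned_cell _ 4); [eassumption | lia | symmetry; exact I4]
      | |- eval _ _ (cell 5) = _ => eapply (scanned_cell _ 5); [eassumption | lia | symmetry; exact I5]
      end ].

Lemma set_up_correct mem r (Q : nat -> memory -> Prop) :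
  scanned mem -> (forall b, (6 <= b)%nat -> mem b = inp b) -> (800 <= r)%nat ->
  (forall mem', holds inp L m nb mem' state0 -> Q (r - 800)%nat mem') ->
  runs (space L m nb) set_up mem r Q.
Proof.
  intros H Hb Hr HQ. unfold set_up. assert (Hm' : 0 < INR m) by (apply lt_0_INR; auto).
  apply runs_seq. eapply runs_store_scanned0; [exact H | cells | cheap | lia |].
  intros H1. apply runs_seq.
  eapply (runs_store_scanned _ 1); [exact H1 | lia | cells | cheap | lia |].
  intros H2. apply runs_seq.
  eapply (runs_store_scanned _ 2); [exact H2 | lia | cells | cheap | lia |].
  intros H3. apply runs_seq.
  eapply (runs_store_scanned _ 3); [exact H3 | lia | eapply eval_div; [cells | cells |] | cheap | lia |].
  { assert (0 < 2 * INR m * INR m) by nra. lra. }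
  intros H4. apply runs_seq.
  eapply (runs_store_scanned _ 6); [exact H4 | lia | eapply eval_div; [cells | cells |] | cheap | lia |].
  { lra. }
  intros H5. apply runs_seq.
  eapply (runs_store_scanned _ 7); [exact H5 | lia | cells | cheap | lia |].
  intros H6. apply runs_seq.
  eapply runs_store with (x := INR 1) (l := 1%nat); [reflexivity | | cells | cheap | lia |].
  { apply address_INR. unfold space; lia. }
  set (mem1 := update _ (L + 7) _) in *.
  assert (V0 : eval (space L m nb) (update mem1 1 (INR L)) (cell 0) = Some (INR L)).
  { rewrite (eval_cell _ _ 0) by (unfold space; lia). f_equal. apply H6. }
  assert (V3 : eval (space L m nb) (update mem1 1 (INR L)) (cell 3) = Some (INR m)).
  { rewrite (eval_cell _ _ 3) by (unfold space; lia). f_equal. rewrite <- I3. apply H6. lia. }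
  eapply runs_store with (x := INR 2) (l := 2%nat); [reflexivity | | | cheap | lia |].
  { apply address_INR. unfold space; lia. }
  { eapply eval_add; [eapply eval_add; [exact V0 | apply eval_cst]
                     |eapply eval_mul; [apply eval_cst | exact V3]]. }
  replace (r - 100 - 100 - 100 - 100 - 100 - 100 - 100 - 100)%nat with (r - 800)%nat by lia.
  apply HQ. destruct H as (M0 & M1 & M2).
  assert (U : forall b, (6 <= b)%nat -> (b < L \/ L + 20 <= b)%nat ->
     update (update mem1 1 (INR L)) 2 (INR L + 20 + 9 * INR m) b = inp b).
  { intros b Hb1 Hb2. unfold mem1, update.
    repeat match goal with
    | |- context [(b =? ?c)%nat] => destruct (Nat.eqb_spec b c); try lia
    end. apply Hb; auto. }
  unfold holds. cbn [job reg fld buf state0].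
  split; [apply H6|]. split; [unfold update; simpl; reflexivity|].
  split.
  { change (INR L + 20 + 9 * INR m = INR (L + 20 + 9 * m)).
    rewrite !plus_INR, mult_INR. simpl. ring. }
  split; [intros a Ha; apply U; lia|].
  split; [|split].
  (* Registers that are not stored to keep the zero that fills the memory beyond the input; the
     counters of the algorithm start from it. *)
  - intros k Hk. unfold mem1, update.
    do 20 (destruct k as [|k];
      [repeat match goal with
       | |- context [(?a =? ?b)%nat] => destruct (Nat.eqb_spec a b); try lia
       end; first [reflexivity | rewrite Hb, Iend by lia; reflexivity] |]).
    lia.
  - intros i f Hi Hf. rewrite U, Iend by lia. reflexivity.
  - intros i f Hi Hf. rewrite U, Iend by lia. reflexivity.
Qed.

Hypothesis valid : Forall valid_machine Ms.

(** The time and the work of every pointer start at 0, which the cleared memory already provides.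
    The other pointer fields are read from the machine description, whose length gives the address
    of the next one. *)
Lemma locate_machines_correct S mem r (Q : nat -> memory -> Prop) :
  holds inp L m nb mem S -> reg S r_m = INR m ->
  (forall i f, fld S i f = 0) -> (600 * m + 400 <= r)%nat ->
  (forall S' mem' r', holds inp L m nb mem' S' -> keeps [r_b; r_i] S S' -> buf S' = buf S ->
     all_track inp L m Ms 0 S' (fun i => intervals (nth_machine Ms i)) ->
     (r <= r' + (600 * m + 400))%nat -> Q r' mem') ->
  runs (space L m nb) locate_machines mem r Q.
Proof.
  intros HS Em Hz Hr HQ. unfold locate_machines. step. intros mem1 H1.
  set (J := fun (k r1 : nat) (S1 : state) => keeps [r_b; r_i] S S1 /\ buf S1 = buf S /\
     (exists a, reg S1 r_b = INR a /\ machines_at inp L a (skipn k Ms)) /\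
     (forall i f, (f = 3 \/ f = 4)%nat -> fld S1 i f = 0) /\
     (forall i, (i < k)%nat -> tracks inp L (nth_machine Ms i) 0 (fld S1 i)
                                 (intervals (nth_machine Ms i))) /\
     (r <= r1 + 200 + 600 * k)%nat /\ (k <= m)%nat).
  eapply runs_for with (inp := inp) (J := J) (n := m); [lia|lia|cheap|..]; [| | |exact H1|..].
  - intros i r1 S1 mem4 (K1 & B1 & A1 & F1 & T1 & C1 & Hk) H4. split; [|lia].
    rewrite <- Em, <- (K1 r_m) by (simpl; lia). ev.
  - intros i r1 S1 mem4 Hi (K1 & B1 & [a [Ea A1]] & F1 & T1 & C1 & _) Ei H4.
    rewrite (skipn_cons (Machine [] 1)) in A1 by lia.
    change (nth i Ms (Machine [] 1)) with (nth_machine Ms i) in A1.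
    assert (VM : valid_machine (nth_machine Ms i)).
    { eapply Forall_nth in valid; [exact valid | lia]. }
    set (M := nth_machine Ms i) in *.
    destruct A1 as [(Ba & Na & Ra & Sa) A1].
    assert (Ea1 : reg S1 r_b + 1 = INR (Datatypes.S a)) by (rewrite Ea, S_INR; ring).
    step. intros mem5 H5. step. rewrite Na. intros mem6 H6. step. rewrite Ra. intros mem7 H7.
    step. rewrite Na. intros mem8 H8.
    eexists. split; [exact H8|]. split; [exact Ei|]. split; [lia|].
    split; [apply keeps_set; [apply keeps_set|]; simpl; tauto|]. split; [exact B1|].
    split.
    { exists (a + (2 + 2 * length (intervals M)))%nat. split; [|exact A1].
      cbn [reg set_reg set_fld Nat.eqb]. rewrite Ea, !plus_INR, mult_INR. simpl. ring. }
    split; [intros i' f Hf; rewrite <- (F1 i' f) by auto; frame|].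
    split; [|lia]. intros i' Hi'. destruct (Nat.eq_dec i' i) as [->|].
    + destruct VM as [V1 V2]. fold M. repeat split; fields; auto.
      * exists (Datatypes.S (Datatypes.S a)). split; [|exact Sa].
        rewrite Ea, !S_INR. ring.
      * rewrite F1 by auto. apply rising_sorted. exact V1.
      * rewrite F1 by auto. lra.
      * rewrite F1 by auto. lra.
      * intros t Hte. rewrite !F1 by auto. unfold work. ring.
    + destruct (T1 i' ltac:(lia)) as (A2 & A3 & A4 & A5 & A6 & A7).
      unfold tracks. fields. rewrite (proj2 (Nat.eqb_neq i' i)) by auto.
      repeat split; auto; apply A6.
  - intros r1 S1 mem4 (K1 & B1 & A1 & F1 & T1 & C1 & _) Ei H4.
    eapply HQ; eauto. lia.
  - lia.
  - split; [apply keeps_set; [apply keeps_set|]; simpl; try tauto; intros ? ?; reflexivity|].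
    split; [reflexivity|]. split; [exists 6%nat; split; [simpl; lra | exact Iat]|].
    split; [intros; apply Hz|]. split; [intros; lia | lia].
Qed.

End Before.

(** * The two passes over the stream *)

Fixpoint total_room (lst : list (nat * R)) : R :=
  match lst with [] => 0 | (_, x) :: lst' => x + total_room lst' end.

Fixpoint room_of (i : nat) (lst : list (nat * R)) : R :=
  match lst with
  | [] => 0
  | (k, x) :: lst' => (if (k =? i)%nat then x else 0) + room_of i lst'
  end.

Lemma room_of_nonneg i lst : Forall (fun kx => 0 <= snd kx) lst -> 0 <= room_of i lst.
Proof.
  induction 1 as [|[k x] lst H Hl IH]; simpl in *; [lra|]. destruct (k =? i)%nat; lra.
Qed.

Lemma total_room_app l l' : total_room (l ++ l') = total_room l + total_room l'.
Proof. induction l as [|[k x] l IH]; simpl; lra. Qed.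

Lemma room_of_app i l l' : room_of i (l ++ l') = room_of i l + room_of i l'.
Proof. induction l as [|[k x] l IH]; simpl; lra. Qed.

(** Every closed machine costs less than [s] of room, and there are [n] minus the number of open
    ones. The terms are arranged so that the open machines keep a reserve of [s] each, as the second
    pass demands. *)
Lemma total_room_opens s room n :
  sum_below room n + INR (length (opens s room n)) * s <= total_room (opens s room n) + INR n * s.
Proof.
  induction n as [|n IH]; [simpl; lra|]. rewrite S_INR.
  cbn [opens sum_below]. rewrite length_app, plus_INR, total_room_app.
  destruct (Rlt_dec (room n) s); simpl; lra.
Qed.

Lemma room_of_opens_above s room n i : (n <= i)%nat -> room_of i (opens s room n) = 0.
Proof.
  induction n as [|n IH]; intros H; [reflexivity|]. cbn [opens].
  rewrite room_of_app, IH by lia. destruct (Rlt_dec (room n) s); simpl; [lra|].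
  destruct (Nat.eqb_spec n i); [lia | lra].
Qed.

Lemma room_of_opens s room n i : (i < n)%nat -> 0 <= room i ->
  room_of i (opens s room n) <= room i.
Proof.
  intros H H0; induction H as [|n H IH]; cbn [opens]; rewrite room_of_app.
  - rewrite room_of_opens_above by lia. destruct (Rlt_dec (room i) s); simpl; [lra|].
    rewrite Nat.eqb_refl. lra.
  - destruct (Rlt_dec (room n) s); simpl; [lra|]. destruct (Nat.eqb_spec n i); [lia | lra].
Qed.

Lemma opens_spec s room n : Forall (fun kx => (fst kx < n)%nat /\ s <= snd kx) (opens s room n).
Proof.
  induction n as [|n IH]; cbn [opens]; [constructor|]. apply Forall_app. split.
  - eapply Forall_impl; [|exact IH]. intros kx; simpl; intros [H1 H2]; split; [lia | lra].
  - destruct (Rlt_dec (room n) s); [constructor|].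
    constructor; [simpl; split; [lia | lra] | constructor].
Qed.

Section Passes.

Variables (inp : nat -> R) (L m nb : nat).
Hypothesis HL : (6 <= L)%nat.

Definition pass_cost := 1000%nat.

Lemma first_pass_correct q pmax p pre acc S mem :
  holds inp L m nb mem S -> reg S r_q = q -> reg S r_pmax = pmax -> reg S r_P = acc ->
  reg S r_kept = INR (length pre) ->
  (forall j, (j < length pre)%nat -> buf S j j_kept = nth j pre 0) ->
  (length (pre ++ kept q pmax acc p) <= nb)%nat ->
  exists out mem' S', pass (space L m nb) pass_cost first_pass mem p out mem' /\
    holds inp L m nb mem' S' /\ keeps [r_P; r_kept] S S' /\ fld S' = fld S /\
    (forall j f, f <> j_kept -> buf S' j f = buf S j f) /\
    reg S' r_P = acc + sum_list p /\
    reg S' r_kept = INR (length (pre ++ kept q pmax acc p)) /\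
    (forall j, (j < length (pre ++ kept q pmax acc p))%nat ->
       buf S' j j_kept = nth j (pre ++ kept q pmax acc p) 0).
Proof.
  revert pre acc S mem; induction p as [|x p IH]; intros pre acc S mem HS Eq Ep EP Ek Hb Hn.
  - exists [], mem, S. cbn [kept] in *. rewrite app_nil_r in *.
    repeat split; auto; try apply HS; [constructor | simpl; lra].
  - assert (R : runs (space L m nb) first_pass (update mem 0 x) pass_cost (fun _ mem' =>
      exists S' pre', holds inp L m nb mem' S' /\ keeps [r_P; r_kept] S S' /\ fld S' = fld S /\
        (forall j f, f <> j_kept -> buf S' j f = buf S j f) /\ reg S' r_P = acc + x /\
        reg S' r_kept = INR (length pre') /\
        (forall j, (j < length pre')%nat -> buf S' j j_kept = nth j pre' 0) /\
        pre ++ kept q pmax acc (x :: p) = pre' ++ kept q pmax (acc + x) p)).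
    { pose proof (holds_job inp L m nb HL mem S x HS) as H0.
      unfold first_pass, pass_cost. step. intros mem1 H1. cbn [reg job set_job] in H1.
      rewrite EP in H1. cbn [kept] in Hn |- *.
      step; cbn [reg job set_job set_reg Nat.eqb]; rewrite Eq; intros h1.
      - destruct (Rlt_dec (q * (acc + x)) x) as [_|]; [|tauto].
        step; cbn [reg job set_job set_reg Nat.eqb]; rewrite Eq, Ep; intros h2.
        + destruct (Rlt_dec (q * pmax) x) as [_|]; [|tauto].
          rewrite !length_app in Hn. simpl in Hn.
          step. intros mem2 H2. step. intros mem3 H3.
          eexists _, (pre ++ [x]). split; [exact H3|].
          split.
          { apply keeps_set; [|simpl; tauto]. intros k Hk. fields.
            destruct (Nat.eqb_spec k 4); [subst; simpl in Hk; tauto | auto]. }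
          split; [reflexivity|]. split; [intros j f Hf; frame|].
          split; [reflexivity|]. rewrite length_app, plus_INR. cbn [length].
          split; [fields; rewrite Ek; reflexivity|]. split.
          { intros j Hj. fields. destruct (Nat.eqb_spec j (length pre)) as [->|].
            - rewrite nth_middle. reflexivity.
            - rewrite app_nth1 by lia. apply Hb. lia. }
          rewrite <- app_assoc. reflexivity.
        + destruct (Rlt_dec (q * pmax) x); [lra|]. step.
          eexists _, pre. split; [exact H1|].
          split; [apply keeps_set; [intros ? ?; reflexivity | simpl; tauto]|].
          repeat (split; [reflexivity || assumption|]). reflexivity.
      - destruct (Rlt_dec (q * (acc + x)) x); [lra|]. step.
        eexists _, pre. split; [exact H1|].
        split; [apply keeps_set; [intros ? ?; reflexivity | simpl; tauto]|].
        repeat (split; [reflexivity || assumption|]). reflexivity. }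
    destruct R as (t & mem1 & r' & Ex & Ht & S1 & pre' & H1 & K1 & F1 & B1 & P1 & L1 & N1 & E1).
    rewrite E1 in *.
    destruct (IH pre' (acc + x) S1 mem1 H1) as (out & mem' & S' & Ps & H' & K' & F' & B' & P' & L' & N');
      auto.
    + rewrite <- Eq. apply K1; simpl; lia.
    + rewrite <- Ep. apply K1; simpl; lia.
    + exists (mem1 0%nat :: out), mem', S'. split; [econstructor; eauto; lia|].
      split; [exact H'|].
      split; [eapply keeps_trans; [exact K1 | exact K' | intros y; simpl; tauto]|].
      split; [rewrite F'; exact F1|]. split; [intros j f Hf; rewrite B', B1; auto|].
      split; [rewrite P'; simpl; unfold sum_list; simpl; ring|]. split; assumption.
Qed.

(* Small jobs are placed by next fit.  Leaving a machine wastes less than [s], so the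
   total room stays above the small work to come plus [s] per machine left; hence
   some machine is left as long as small work is to come. *)
Lemma second_pass_correct s p a b lst cur S mem :
  holds inp L m nb mem S -> reg S r_s = s -> Forall (fun x => 0 < x) p ->
  reg S r_b = INR b -> length a = length (above s p) -> (b + length a <= nb)%nat ->
  Forall (fun k => (k < m)%nat) a ->
  (forall j, (j < length a)%nat -> buf S (b + j) j_digit = INR (nth j a 0%nat)) ->
  reg S r_cur = INR cur -> (cur + length lst <= m)%nat ->
  (forall j, (j < length lst)%nat ->
     fld S (cur + j) f_open = INR (fst (nth j lst (0%nat, 0))) /\
     fld S (cur + j) f_space = snd (nth j lst (0%nat, 0))) ->
  Forall (fun kx => (fst kx < m)%nat /\ 0 <= snd kx) lst ->
  Forall (fun kx => s <= snd kx) (tl lst) ->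
  sum_list p - sum_list (above s p) + INR (length lst) * s <= total_room lst ->
  exists sigma mem', length sigma = length p /\ Forall (fun k => (k < m)%nat) sigma /\
    pass (space L m nb) pass_cost second_pass mem p (map INR sigma) mem' /\
    forall i, load i p sigma <= load i (above s p) a + room_of i lst.
Proof.
  intros HS Es Hp. revert a b lst cur S mem HS Es.
  induction Hp as [|x p Hx Hp IH];
    intros a b lst cur S mem HS Es Eb La Hab Va Da Ec Hcl Dl Vl Tl Room.
  - exists [], mem. split; [reflexivity|]. split; [constructor|]. split; [constructor|].
    intros i. simpl. assert (0 <= room_of i lst).
    { apply room_of_nonneg. eapply Forall_impl; [|exact Vl]. intros kx [_ H]; exact H. }
    lra.
  - pose proof (holds_job inp L m nb HL mem S x HS) as H0.
    (* Reduces each of the three cases below to the execution of one command and the invariant for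
       the rest of the stream: the remaining digits [a'], the remaining open machines [lst'], and
       the balance of the loads. *)
    assert (Fin : forall k a' b' lst' cur',
      runs (space L m nb) second_pass (update mem 0 x) pass_cost (fun _ mem' =>
        exists S', holds inp L m nb mem' S' /\ job S' = INR k /\ reg S' r_s = s /\
          reg S' r_b = INR b' /\ reg S' r_cur = INR cur' /\
          (forall j, (j < length a')%nat -> buf S' (b' + j) j_digit = INR (nth j a' 0%nat)) /\
          (forall j, (j < length lst')%nat ->
             fld S' (cur' + j) f_open = INR (fst (nth j lst' (0%nat, 0))) /\
             fld S' (cur' + j) f_space = snd (nth j lst' (0%nat, 0)))) ->
      (k < m)%nat -> length a' = length (above s p) -> (b' + length a' <= nb)%nat ->
      Forall (fun k => (k < m)%nat) a' -> (cur' + length lst' <= m)%nat ->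
      Forall (fun kx => (fst kx < m)%nat /\ 0 <= snd kx) lst' ->
      Forall (fun kx => s <= snd kx) (tl lst') ->
      sum_list p - sum_list (above s p) + INR (length lst') * s <= total_room lst' ->
      (forall i, (if (k =? i)%nat then x else 0) + load i (above s p) a' + room_of i lst' <=
         load i (above s (x :: p)) a + room_of i lst) ->
      exists sigma mem', length sigma = length (x :: p) /\ Forall (fun k => (k < m)%nat) sigma /\
        pass (space L m nb) pass_cost second_pass mem (x :: p) (map INR sigma) mem' /\
        forall i, load i (x :: p) sigma <= load i (above s (x :: p)) a + room_of i lst).
    { intros k a' b' lst' cur' (t & mem1 & r' & Ex & Ht & S1 & H1 & J1 & Es1 & Eb1 & Ec1 & Da1 & Dl1)
        Hk La' Hab' Va' Hcl' Vl' Tl' Room' Hload.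
      destruct (IH a' b' lst' cur' S1 mem1) as (sigma & mem' & Ls & Vs & Ps & Lo); auto.
      exists (k :: sigma), mem'. split; [simpl; lia|]. split; [constructor; auto|]. split.
      - simpl map. rewrite <- J1. assert (E : mem1 0%nat = job S1) by apply H1. rewrite <- E.
        econstructor; eauto. lia.
      - intros i. specialize (Lo i). specialize (Hload i). simpl load at 1. lra. }
    assert (Sum : sum_list (x :: p) = x + sum_list p) by reflexivity.
    rewrite above_cons in La, Room, Fin |- *.
    pose proof (sum_above_le s p Hp) as Hsm.
    destruct (Rlt_dec s x) as [Hbig|Hsmall].
    + destruct a as [|k a]; [simpl in La; lia|]. apply Forall_cons_iff in Va as [Va1 Va].
      simpl length in *. simpl app in *.
      assert (Dk : buf S b j_digit = INR k).
      { rewrite <- (Nat.add_0_r b). apply (Da 0%nat). lia. }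
      apply (Fin k a (Datatypes.S b) lst cur); auto; try lia.
      * unfold second_pass, pass_cost.
        step; cbn [reg job set_job]; rewrite Es; intros h; [|lra].
        step. intros mem1 H1. step. intros mem2 H2.
        eexists. split; [exact H2|]. split; [exact Dk|]. split; [exact Es|].
        split; [rewrite S_INR, <- Eb; reflexivity|]. split; [exact Ec|].
        split; [|exact Dl]. intros j Hj. cbn [buf set_reg set_job].
        rewrite Nat.add_succ_comm. apply (Da (Datatypes.S j)).
        lia.
      * rewrite Sum in Room. unfold sum_list in *. simpl in Room. lra.
      * intros i. simpl. lra.
    + simpl app in *. rewrite Sum in Room.
      assert (Lpos : (0 < length lst)%nat).
      { destruct lst as [|kx lst]; simpl in *; [lra | lia]. }
      destruct lst as [|[k0 x0] lst]; [simpl in Lpos; lia|].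
      apply Forall_cons_iff in Vl as [[V1 V2] Vl']. cbn [fst snd tl] in *.
      cbn [length] in Room, Hcl. rewrite S_INR in Room. cbn [total_room] in Room.
      destruct (Dl 0%nat Lpos) as [D1 D2]. rewrite Nat.add_0_r in D1, D2. cbn in D1, D2.
      destruct (Rlt_dec x0 x) as [Hfull|Hfits].
      (* The machine being left cannot be the last open one: its room [x0 < x] would have to cover
         the small work to come, [x] included. The next one has room at least [s], hence enough for
         [x], so a single move suffices. *)
      * destruct lst as [|[k1 x1] lst]; [simpl in Room; lra|].
        apply Forall_cons_iff in Tl as [T1 Tl']. cbn [snd] in T1.
        apply Forall_cons_iff in Vl' as [[V3 V4] Vl'']. cbn [fst snd] in *.
        cbn [length] in Room, Hcl. rewrite S_INR in Room. cbn [total_room] in Room.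
        destruct (Dl 1%nat ltac:(simpl; lia)) as [D3 D4]. rewrite Nat.add_1_r in D3, D4.
        cbn in D3, D4.
        assert (Ec1 : reg S r_cur + 1 = INR (Datatypes.S cur)) by (rewrite Ec, S_INR; ring).
        apply (Fin k1 a b ((k1, x1 - x) :: lst) (Datatypes.S cur)); auto.
        -- unfold second_pass, pass_cost.
           step; cbn [reg job set_job]; intros h; [lra|].
           apply runs_seq. step; cbn [fld job set_job]; rewrite D2; intros h2; [|lra].
           step. intros mem1 H1. step. intros mem2 H2. step.
           intros mem3 H3. eexists. split; [exact H3|].
           split; [fields; exact D3|]. split; [exact Es|]. split; [exact Eb|].
           split; [exact Ec1|]. split; [exact Da|].
           intros j Hj. destruct j as [|j].
           { rewrite Nat.add_0_r. cbn [nth fst snd]. fields. rewrite D4. split; [exact D3 | reflexivity]. }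
           cbn [nth]. destruct (Dl (Datatypes.S (Datatypes.S j)) ltac:(simpl in *; lia)) as [D5 D6].
           cbn [nth] in D5, D6. replace (Datatypes.S cur + Datatypes.S j)%nat with
             (cur + Datatypes.S (Datatypes.S j))%nat by lia.
           fields. rewrite (proj2 (Nat.eqb_neq _ _)) by lia. split; assumption.
        -- simpl in *; lia.
        -- constructor; [simpl; split; [auto | lra] | auto].
        -- cbn [length total_room]. rewrite S_INR. lra.
        -- intros i. cbn [room_of].
           destruct (Nat.eqb_spec k1 i), (Nat.eqb_spec k0 i); lra.
      * apply (Fin k0 a b ((k0, x0 - x) :: lst) cur); auto.
        -- unfold second_pass, pass_cost.
           step; cbn [reg job set_job]; intros h; [lra|].
           apply runs_seq. step; cbn [fld job set_job]; rewrite D2; intros h2; [lra|].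
           step. step. intros mem2 H2. step.
           intros mem3 H3. eexists. split; [exact H3|].
           split; [fields; exact D1|]. split; [exact Es|]. split; [exact Eb|].
           split; [exact Ec|]. split; [exact Da|].
           intros j Hj. destruct j as [|j].
           { rewrite Nat.add_0_r. cbn [nth fst snd]. fields. rewrite D2. split; [exact D1 | reflexivity]. }
           cbn [nth]. destruct (Dl (Datatypes.S j) ltac:(simpl in *; lia)) as [D5 D6].
           cbn [nth] in D5, D6.
           fields. rewrite (proj2 (Nat.eqb_neq _ _)) by lia. split; assumption.
        -- constructor; [simpl; split; [auto | lra] | auto].
        -- cbn [length total_room]. rewrite S_INR. lra.
        -- intros i. cbn [room_of]. destruct (Nat.eqb_spec k0 i); lra.
Qed.

End Passes.

(** * The complete run and its approximation ratio *)

Lemma sum_below_extra m1 X m : (m1 <= m)%nat -> sum_below (extra m1 X) m = INR m1 * X.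
Proof.
  intros H. induction H as [|m H IH].
  - rewrite (sum_below_ext _ (fun _ => X)), sum_below_const; [auto|].
    intros i Hi. unfold extra. apply Nat.ltb_lt in Hi. rewrite Hi. reflexivity.
  - simpl. rewrite IH. unfold extra. apply Nat.ltb_ge in H. rewrite H. ring.
Qed.

Lemma ahead_ext f g n : (forall i, (i < n)%nat -> f i = g i) -> ahead f n = ahead g n.
Proof.
  intros H; induction n as [|n IH]; simpl; [auto|]. rewrite IH, H by auto. reflexivity.
Qed.

Lemma ahead_le_input Ms :
  (2 * ahead (fun i => intervals (nth_machine Ms i)) (length Ms) <=
   length (flat_map encode_machine Ms))%nat.
Proof.
  induction Ms as [|M Ms IH] using rev_ind; [simpl; lia|].
  rewrite length_app, Nat.add_1_r. cbn [ahead].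
  rewrite flat_map_app, length_app.
  rewrite (ahead_ext _ (fun i => intervals (nth_machine Ms i))).
  - unfold nth_machine at 2. rewrite nth_middle.
    cbn [flat_map]. rewrite app_nil_r. unfold encode_machine at 2. cbn [length].
    rewrite length_flat_pairs. lia.
  - intros i Hi. unfold nth_machine. rewrite app_nth1 by auto. reflexivity.
Qed.

Lemma max_list_le_sum p : Forall (fun x => 0 < x) p -> max_list p <= sum_list p.
Proof.
  induction 1 as [|x p Hx Hp IH]; [simpl; lra|]. pose proof (sum_list_nonneg p Hp).
  simpl. apply Rmax_lub; unfold sum_list, max_list in *; simpl; lra.
Qed.

Lemma sum_list_pos p : p <> [] -> Forall (fun x => 0 < x) p -> 0 < sum_list p.
Proof.
  intros Hne Hp. destruct Hp as [|x p' Hx Hp']; [tauto|].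
  pose proof (sum_list_nonneg p' Hp'). unfold sum_list in *; simpl; lra.
Qed.

Lemma INR_machines m m1 : (1 <= m1)%nat -> (m1 <= m - 1)%nat ->
  2 <= INR m /\ 1 <= INR m1 <= INR m.
Proof.
  intros H H'. change 2 with (INR 2). change 1 with (INR 1).
  repeat split; apply le_INR; lia.
Qed.

Lemma q0_bounds m m1 e0 eps : (1 <= m1)%nat -> (m1 <= m - 1)%nat -> 0 < e0 <= 1 ->
  0 < eps < 1 -> 0 < q0 m m1 eps e0 < 1.
Proof.
  intros H H' He0 Heps. destruct (INR_machines m m1 H H') as [M1 M2].
  replace (q0 m m1 eps e0) with (eps * e0 * INR m1 / (2 * INR m ^ 2)) by (unfold q0; field; lra).
  assert (0 < 2 * INR m ^ 2) by nra. assert (0 < eps * e0 <= 1) by nra.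
  split; [apply Rdiv_lt_0_compat; nra|].
  apply Rmult_lt_reg_r with (2 * INR m ^ 2); [auto|].
  replace (eps * e0 * INR m1 / (2 * INR m ^ 2) * (2 * INR m ^ 2)) with (eps * e0 * INR m1)
    by (field; lra). nra.
Qed.

Section Run.

Variables (m m1 : nat) (e0 eps : R) (Ms : list machine) (p : list R).
Hypothesis Hm1 : (1 <= m1)%nat.
Hypothesis Hm1m : (m1 <= m - 1)%nat.
Hypothesis He0 : 0 < e0 <= 1.
Hypothesis Heps : 0 < eps < 1.
Hypothesis HMs : length Ms = m.
Hypothesis valid : Forall valid_machine Ms.
Hypothesis fast : Forall (fun M => Forall (fun e => e0 <= e) (ratios M)) (firstn m1 Ms).
Hypothesis Hne : p <> [].
Hypothesis Hp : Forall (fun x => 0 < x) p.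

Let P := sum_list p.
Let q := q0 m m1 eps e0.
Let delta := delta0 m eps * P.
Let X := e0 * delta.
Let s := q * P.
Let input := encode_input m1 e0 eps (max_list p) Ms.
Let inp a := nth a input 0.
Let L := length input.
Let ks := kept q (max_list p) 0 p.
Let nb := length ks.
Let bigs := above s p.
Let mach := nth_machine Ms.

Lemma INR_m_pos : 2 <= INR m.
Proof. apply (INR_machines m m1); auto. Qed.

Lemma q_eq : q = eps * e0 * INR m1 / (2 * INR m ^ 2).
Proof. pose proof INR_m_pos. unfold q, q0. field. lra. Qed.

Lemma delta_eq : delta = eps * P / (2 * INR m).
Proof. pose proof INR_m_pos. unfold delta, delta0. field. lra. Qed.

Lemma P_pos : 0 < P.
Proof. apply sum_list_pos; auto. Qed.

Lemma delta_pos : 0 < delta.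
Proof.
  rewrite delta_eq. pose proof INR_m_pos. pose proof P_pos.
  apply Rdiv_lt_0_compat; nra.
Qed.

Lemma X_pos : 0 < X.
Proof. unfold X. pose proof delta_pos. nra. Qed.

Lemma q_bounds : 0 < q < 1.
Proof. apply q0_bounds; auto. Qed.

(* The slack of the fast machines makes up for the work [s] wasted per machine. *)
Lemma slack : INR m1 * X = INR m * s.
Proof.
  unfold X, s. rewrite q_eq, delta_eq. pose proof INR_m_pos. field. lra.
Qed.

Lemma bigs_kept : above s ks = bigs.
Proof.
  unfold bigs, ks. pose proof q_bounds. pose proof (max_list_le_sum p Hp).
  apply above_kept; auto; try lra; unfold s, P; nra.
Qed.

Lemma valid_mach i : (i < m)%nat -> valid_machine (mach i).
Proof. intros H. eapply Forall_nth in valid; [exact valid | lia]. Qed.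

Lemma fast_mach i : (i < m1)%nat -> Forall (fun e => e0 <= e) (ratios (mach i)).
Proof.
  intros H. pose proof fast as F. rewrite Forall_forall in F. apply F.
  unfold mach, nth_machine. rewrite <- (firstn_skipn m1 Ms) at 1.
  assert (length (firstn m1 Ms) = m1) by (rewrite length_firstn; lia).
  rewrite app_nth1 by lia. apply nth_In. lia.
Qed.

Lemma extra_nonneg i : 0 <= extra m1 X i.
Proof. unfold extra. pose proof X_pos. destruct (i <? m1)%nat; lra. Qed.

(** The loads of a schedule that ends by [T] are at most the work of the machines. Summing them
    gives the test on [P]; dropping the small jobs gives an assignment of the big ones, which fits
    even without [X]. *)
Lemma feasible_accept sch T : feasible Ms p sch -> makespan p sch <= T ->
  exists a, accept m m1 Ms bigs P X T a.
Proof.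
  intros Hf HT. set (sigma := map (machine_of sch) (seq 0 (length p))).
  assert (Ls : length p = length sigma) by (unfold sigma; rewrite length_map, length_seq; auto).
  assert (Vs : Forall (fun k => (k < m)%nat) sigma).
  { apply Forall_forall. intros k Hk. apply in_map_iff in Hk as [j [<- Hj]].
    apply in_seq in Hj. destruct Hf as [Hf _]. rewrite <- HMs. apply Hf. lia. }
  assert (Lo : forall i, (i < m)%nat -> load i p sigma <= work (mach i) T).
  { intros i Hi. apply feasible_load; auto. lia. }
  destruct (restrict_assignment m s p sigma Ls Hp Vs) as [a [A1 [A2 A3]]].
  exists a. split; [split; auto|]. split.
  - unfold P. rewrite <- (sum_load m p sigma) by auto. apply sum_below_le. auto.
  - intros i Hi. unfold cap. specialize (A3 i). specialize (Lo i Hi).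
    pose proof (extra_nonneg i). unfold bigs, mach in *. lra.
Qed.

(** Limits the number of guesses without reference to the optimum or to the speed of the slow
    machines. *)
Lemma late_accept T : P / e0 <= T -> exists a, accept m m1 Ms bigs P X T a.
Proof.
  intros HT. pose proof P_pos.
  assert (T0 : 0 < P / e0) by (apply Rdiv_lt_0_compat; lra).
  assert (W0 : P <= work (mach 0%nat) T).
  { pose proof (work_lower e0 (mach 0%nat) 0 (valid_mach 0 ltac:(lia)) (fast_mach 0 ltac:(lia))
      ltac:(lra) T ltac:(lra)) as W. rewrite work_0, Rplus_0_l, Rplus_0_l in W by (apply valid_mach; lia).
    assert (P = e0 * (P / e0)) by (field; lra). nra. }
  assert (Wn : forall i, (i < m)%nat -> 0 <= work (mach i) T).
  { intros i Hi. apply work_nonneg; [apply valid_mach; auto | lra]. }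
  exists (repeat 0%nat (length bigs)). split; [split|split].
  - apply repeat_length.
  - apply Forall_forall. intros k Hk. apply repeat_spec in Hk. lia.
  - eapply Rle_trans; [exact W0|].
    rewrite <- (sum_below_single 0 (work (mach 0%nat) T) m) by lia.
    apply sum_below_le. intros i Hi. destruct (Nat.eqb_spec 0 i) as [<-|];
      [unfold mach; lra | apply Wn; auto].
  - intros i Hi. unfold cap. pose proof (extra_nonneg i).
    destruct (Nat.eq_dec i 0) as [->|h].
    + pose proof (load_sum_le 0 bigs (repeat 0%nat (length bigs))) as B1.
      pose proof (sum_above_le s p Hp) as B2. fold bigs P in B2.
      assert (Forall (fun x => 0 < x) bigs).
      { unfold bigs, above. apply Forall_forall. intros x Hx. apply filter_In in Hx.
        rewrite Forall_forall in Hp. apply Hp, Hx. }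
      specialize (B1 H1). unfold mach in W0. lra.
    + rewrite load_repeat by auto. specialize (Wn i Hi). unfold mach in Wn. lra.
Qed.

Variable rounds : nat.
Hypothesis Hrounds : 2 * INR m / (eps * e0) <= INR rounds.

(** In units of [delta] the bound [P / e0] is [2 m / (eps e0)]: the total work cancels, so the
    number of rounds depends on the parameters alone. *)
Lemma rounds_enough : 0 < P / e0 <= INR rounds * delta.
Proof.
  pose proof P_pos. pose proof delta_pos. pose proof INR_m_pos.
  split; [apply Rdiv_lt_0_compat; lra|].
  replace (P / e0) with (2 * INR m / (eps * e0) * delta).
  - apply Rmult_le_compat_r; lra.
  - rewrite delta_eq. field. repeat split; lra.
Qed.

Definition total_time : nat :=
  (3000 * (1 + m + nb + ahead (fun i => intervals (nth_machine Ms i)) m +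
           rounds * (1 + m + m ^ length bigs * (m + length bigs + 1))))%nat.

Lemma algorithm_run : exists t sigma k,
  run algorithm input p (space L m nb) pass_cost t sigma /\ (t <= total_time)%nat /\
  length sigma = length p /\ Forall (fun i => (i < m)%nat) sigma /\
  (forall i, (i < m)%nat -> load i p sigma <= cap m1 Ms X (INR (S k) * delta) i) /\
  (k = 0%nat \/ forall a, ~ accept m m1 Ms bigs P X (INR k * delta) a).
Proof.
  assert (HL : (6 <= L)%nat) by (unfold L, input, encode_input; rewrite length_app; simpl; lia).
  assert (Hbn : (length bigs <= nb)%nat) by (rewrite <- bigs_kept; apply above_length).
  assert (Iat : machines_at inp L 6 Ms).
  { apply (machines_at_app [0; eps; e0; INR (length Ms); INR m1; max_list p]).
    - reflexivity.
    - simpl; lia.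
    - unfold L, input, encode_input. rewrite length_app. reflexivity. }
  assert (I3 : inp 3%nat = INR m) by (rewrite <- HMs; reflexivity).
  assert (Iend : forall a, (L <= a)%nat -> inp a = 0)
    by (intros; apply nth_overflow; assumption).
  set (ls := fun i => intervals (nth_machine Ms i)).
  assert (Before : runs (space L m nb) (before algorithm) inp (1400 + 1100 * m) (fun _ mem' =>
    exists S1, holds inp L m nb mem' S1 /\
      keeps [r_b; r_i] (state0 L m m1 eps e0 (max_list p)) S1 /\
      buf S1 = (fun _ _ => 0) /\ all_track inp L m Ms 0 S1 ls)).
  { cbn [before algorithm]. apply runs_seq.
    eapply find_end_correct with (eps := eps) (Ms := Ms); auto; try lia.
    intros mem r' Hsc Hmem Hr'. apply runs_seq.
    eapply set_up_correct with (inp := inp) (m1 := m1) (Ms := Ms) (eps := eps)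
      (e0 := e0) (pmax := max_list p);
      auto; try lia.
    intros mem' H'.
    eapply locate_machines_correct with (inp := inp) (Ms := Ms) (eps := eps); auto; try lia;
      [exact H' | reflexivity | reflexivity |].
    intros S' mem2 r2 H2 K2 B2 T2 C2. exists S'. auto. }
  destruct Before as (ta & mem1 & r1 & Ex1 & Ht1 & S1 & H1 & K1 & B1 & T1).
  destruct (first_pass_correct inp L m nb HL q (max_list p) p [] 0 S1 mem1 H1)
    as (out & mem2 & S2 & Ps2 & H2 & K2 & F2 & B2 & P2 & N2 & Z2).
  { apply (K1 3%nat); simpl; lia. }
  { apply (K1 2%nat); simpl; lia. }
  { apply (K1 4%nat); simpl; lia. }
  { apply (K1 5%nat); simpl; lia. }
  { simpl; lia. }
  { simpl. fold ks. auto. }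
  simpl app in N2, Z2. fold ks in N2, Z2. rewrite Rplus_0_l in P2. fold P in P2.
  assert (K12 : keeps [r_b; r_i; r_P; r_kept] (state0 L m m1 eps e0 (max_list p)) S2).
  { intros k Hk. rewrite (K2 k), (K1 k); simpl in *; tauto. }
  assert (Eq2 : reg S2 r_q = q) by (apply K12; simpl; lia).
  assert (Ed2 : reg S2 r_delta = delta0 m eps) by (apply K12; simpl; lia).
  assert (Ee2 : reg S2 r_e0 = e0) by (apply K12; simpl; lia).
  assert (Between : runs (space L m nb) (between algorithm) mem2
    (600 + 500 * nb + (rounds * round_cost m bigs + 700 * ahead ls m + 200) + (600 * m + 700))
    (fun _ mem' => exists S5 k a, holds inp L m nb mem' S5 /\ reg S5 r_s = s /\
       reg S5 r_cur = 0 /\ reg S5 r_b = 0 /\ digits bigs S5 a /\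
       accept m m1 Ms bigs P X (INR (S k) * delta) a /\
       (k = 0%nat \/ forall a, ~ accept m m1 Ms bigs P X (INR k * delta) a) /\
       let room i := cap m1 Ms X (INR (S k) * delta) i - load i bigs a in
       forall j, (j < length (opens s room m))%nat ->
        fld S5 j f_open = INR (fst (nth j (opens s room m) (0%nat, 0))) /\
        fld S5 j f_space = snd (nth j (opens s room m) (0%nat, 0)))).
  { cbn [between algorithm]. apply runs_seq.
    eapply select_big_correct with (inp := inp) (ks := ks) (S := S2); auto;
      [lia | apply (K12 10%nat); simpl; lia | fold nb; lia |].
    intros S3 mem3 r3 H3 K3 F3 B3 D3 E3 X3 L3 Z3 C3. fold nb in C3.
    rewrite Ed2, P2 in D3. fold delta in D3. rewrite Eq2, P2 in E3. fold s in E3.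
    rewrite Ee2, Ed2, P2 in X3. fold delta X in X3.
    rewrite Eq2, P2 in L3, Z3. fold s in L3, Z3. rewrite bigs_kept in L3, Z3.
    assert (EP3 : reg S3 r_P = P) by (rewrite <- P2; apply K3; simpl; lia).
    assert (K13 : keeps [r_b; r_i; r_P; r_kept; r_delta; r_s; r_X; r_B]
                    (state0 L m m1 eps e0 (max_list p)) S3).
    { intros k Hk. rewrite (K3 k), (K12 k); simpl in *; tauto. }
    apply runs_seq.
    eapply guess_correct with (inp := inp) (m1 := m1) (Ms := Ms) (bigs := bigs) (ls := ls)
      (q := rounds) (Tmax := P / e0) (S := S3); auto; try lia.
    { apply (K13 0%nat); simpl; lia. }
    { apply (K13 1%nat); simpl; lia. }
    { apply (K13 12%nat); simpl; lia. }
    { apply (K13 11%nat); simpl; lia. }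
    { rewrite D3. apply delta_pos. }
    { rewrite D3. apply rounds_enough. }
    { rewrite EP3, X3. apply late_accept. }
    { intros j Hj. rewrite B3, B2, B1 by lia. rewrite nth_repeat. reflexivity. }
    { eapply all_track_ext; [exact HL | lia | exact T1 |]. intros i f Hf. rewrite F3, F2. reflexivity. }
    intros S4 mem4 r4 k a H4 K4 B4 D4 A4 N4 R4 C4. rewrite EP3, X3, D3 in A4, N4.
    rewrite X3, D3 in R4.
    eapply list_open_correct with (inp := inp) (S := S4)
      (room := fun i => cap m1 Ms X (INR (S k) * delta) i - load i bigs a); auto; try lia.
    { rewrite (K4 0%nat) by (simpl; lia). apply (K13 0%nat); simpl; lia. }
    intros S5 mem5 r5 H5 K5 B5 Cur5 Bb5 O5 C5.
    assert (E4 : reg S4 r_s = s) by (rewrite <- E3; apply K4; simpl; lia).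
    rewrite E4 in O5.
    exists S5, k, a. split; [exact H5|]. split; [rewrite <- E4; apply K5; simpl; lia|].
    split; [exact Cur5|]. split; [exact Bb5|].
    split; [intros j Hj; rewrite B5; auto|]. split; [exact A4|]. split; [exact N4|].
    exact O5. }
  destruct Between as (tb & mem5 & r5 & Ex5 & Ht5 & S5 & k & a & H5 & E5 & Cur5 & Bb5 & D5 & A5 & N5 & O5).
  cbv zeta in O5.
  set (T := INR (S k) * delta) in *.
  set (room := fun i => cap m1 Ms X T i - load i bigs a) in *.
  destruct A5 as [[La Va] [PW Good]].
  assert (Hs : 0 < s) by (unfold s; pose proof q_bounds; pose proof P_pos; nra).
  assert (Hroom : forall i, (i < m)%nat -> 0 <= room i).
  { intros i Hi. specialize (Good i Hi). unfold room. lra. }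
  destruct (second_pass_correct inp L m nb HL s p a 0 (opens s room m) 0 S5 mem5)
    as (sigma & mem6 & Ls & Vs & Ps6 & Lo); auto.
  { lia. }
  { intros j Hj. apply D5. lia. }
  { apply opens_length. }
  { eapply Forall_impl; [|apply opens_spec]. intros kx [G1 G2]. split; [auto | lra]. }
  { assert (F : Forall (fun kx => s <= snd kx) (opens s room m)).
    { eapply Forall_impl; [|apply opens_spec]. intros kx [G1 G2]; auto. }
    destruct F; simpl; auto. }
  (* By [slack] the capacities add up to the work of the machines plus [m s]. Closing machines in
     [opens] uses up [s] for each of them, and the [s] left for each open machine is the reserve
     that next fit requires. *)
  { pose proof (total_room_opens s room m) as TR.
    assert (SR : sum_below room m + sum_list bigs =
      sum_below (fun i => work (nth_machine Ms i) T) m + INR m1 * X).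
    { rewrite <- (sum_load m bigs a), <- sum_below_plus by auto.
      rewrite <- (sum_below_extra m1 X m), <- sum_below_plus by lia.
      apply sum_below_ext. intros i _. unfold room, cap. ring. }
    rewrite slack in SR. fold P bigs. lra. }
  exists (ta + tb)%nat, sigma, k. split.
  { apply run_intro with (ta := ta) (tb := tb) (mem1 := mem1) (mem2 := mem2) (mem3 := mem5)
      (mem4 := mem6) (out := out); auto. unfold L, space; lia. }
  split.
  { unfold round_cost, search_cost in Ht5. unfold total_time. fold ls.
    set (w := (m + length bigs + 1)%nat) in *. set (D := (m ^ length bigs)%nat) in *.
    assert (A : (rounds * (1000 + 1300 * m + D * (2000 * w)) <=
                 3000 * (rounds * (1 + m + D * w)))%nat).
    { assert (M : forall y z, (z <= 3000 * y -> rounds * z <= 3000 * (rounds * y))%nat)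
        by (intros; nia).
      apply M. clear M. nia. }
    lia. }
  split; [auto|]. split; [auto|]. split; [|exact N5].
  intros i Hi. specialize (Lo i). pose proof (room_of_opens s room m i Hi (Hroom i Hi)).
  fold bigs in Lo. fold T.
  assert (room i = cap m1 Ms X T i - load i bigs a) by reflexivity. lra.
Qed.

(** The refused guess [k * delta], or 0 if none was refused, is at most the optimum. The bound adds
    one [delta] to reach the accepted guess and one for [X], and each of them is at most [eps / 2]
    times the optimum. *)
Lemma approximation sigma k C :
  length sigma = length p -> Forall (fun i => (i < m)%nat) sigma ->
  (forall i, (i < m)%nat -> load i p sigma <= cap m1 Ms X (INR (S k) * delta) i) ->
  (k = 0%nat \/ forall a, ~ accept m m1 Ms bigs P X (INR k * delta) a) ->
  optimal_makespan Ms p C ->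
  makespan p (list_schedule Ms p sigma) <= (1 + eps) * C.
Proof.
  intros Ls Vs Lo Hk [[sch [Hf HC]] _].
  pose proof delta_pos. pose proof INR_m_pos. pose proof (pos_INR k).
  assert (C0 : 0 <= C) by (rewrite <- HC; apply max_list_nonneg).
  assert (HkC : INR k * delta <= C).
  { destruct Hk as [->|Hk]; [simpl; lra|].
    destruct (Rle_dec (INR k * delta) C) as [|h]; [auto|].
    destruct (feasible_accept sch (INR k * delta) Hf) as [a Ha]; [lra|]. elim (Hk a Ha). }
  assert (PC : P <= INR m * C).
  { destruct (feasible_accept sch C Hf) as [a [_ [HP _]]]; [lra|].
    eapply Rle_trans; [exact HP|]. rewrite <- sum_below_const.
    apply sum_below_le. intros i Hi. apply work_le; [apply valid_mach|]; auto. }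
  assert (dC : delta <= eps / 2 * C).
  { rewrite delta_eq. replace (eps * P / (2 * INR m)) with (eps / 2 * (P / INR m)) by (field; lra).
    apply Rmult_le_compat_l; [lra|].
    apply Rmult_le_reg_l with (INR m); [lra|].
    replace (INR m * (P / INR m)) with P by (field; lra). auto. }
  apply Rle_trans with (INR (S k) * delta + delta); [|rewrite S_INR; nra].
  rewrite S_INR in *.
  apply list_schedule_makespan; auto; [rewrite HMs; auto | nra |].
  rewrite HMs. intros i Hi. eapply Rle_trans; [apply Lo; auto|].
  unfold cap, extra. destruct (Nat.ltb_spec i m1).
  - unfold X. apply work_lower; [apply valid_mach; auto | apply fast_mach; auto | nra | lra].
  - rewrite Rplus_0_r. apply work_mono; [apply valid_mach; auto | nra].
Qed.

End Run.

(** * Resource bounds *)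

Lemma ln_2_bounds : / 2 < ln 2 < 1.
Proof.
  split; [apply ln_lt_2|]. rewrite <- (ln_exp 1). apply ln_increasing; [lra|].
  pose proof (exp_ineq1 1). lra.
Qed.

Lemma lg_ge_ln x : 1 < x -> ln x <= lg x.
Proof.
  intros Hx. eapply Rle_trans; [|apply Rmax_r]. pose proof ln_2_bounds.
  assert (0 < ln x) by (rewrite <- ln_1; apply ln_increasing; lra).
  apply Rmult_le_reg_r with (ln 2); [lra|].
  replace (ln x / ln 2 * ln 2) with (ln x) by (field; lra). nra.
Qed.

Lemma lg_ge_1 x : 1 <= lg x.
Proof. apply Rmax_l. Qed.

Lemma ln_le_self x : 0 < x -> ln x <= x.
Proof.
  intros Hx. pose proof (exp_ineq1_le (ln x)) as H. rewrite exp_ln in H by auto. lra.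
Qed.

Lemma Rpower_mono_exponent b x y : 1 < b -> x <= y -> Rpower b x <= Rpower b y.
Proof. intros Hb Hxy. apply Rle_Rpower; lra. Qed.

(** Serves to absorb the polynomial factors of the running time into the power of [m] in [t1_bound].
    It squares [x <= 2 * exp (x / 2)], where [x / 2 <= x * ln b] because [ln b >= ln 2 > 1 / 2] for
    [b >= 2]. *)
Lemma square_le_Rpower b x : 2 <= b -> 0 < x -> x * x <= 4 * Rpower b (2 * x).
Proof.
  intros Hb Hx. pose proof ln_2_bounds.
  assert (L : / 2 <= ln b).
  { destruct (Req_dec b 2) as [->|]; [lra|].
    assert (ln 2 < ln b) by (apply ln_increasing; lra). lra. }
  assert (H1 : x <= 2 * exp (x / 2)).
  { pose proof (exp_ineq1_le (x / 2)). lra. }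
  assert (E : Rpower b (2 * x) = exp (x * ln b) * exp (x * ln b)).
  { unfold Rpower. rewrite <- exp_plus. f_equal. ring. }
  assert (exp (x / 2) <= exp (x * ln b)).
  { assert (x / 2 <= x * ln b) by nra.
    destruct (Req_dec (x / 2) (x * ln b)) as [->|]; [lra|].
    left; apply exp_increasing; lra. }
  rewrite E. pose proof (exp_pos (x * ln b)). nra.
Qed.

(** A machine without shared intervals may still have up to [c] intervals, hence the summand
    [length Ms]; the main terms of the space and time bounds dominate it. *)
Lemma encode_machines_length c Ms :
  Forall (fun M => (num_intervals M <= c * (num_shared M + 1))%nat) Ms ->
  INR (length (flat_map encode_machine Ms)) <= 2 * INR c * (total_shared Ms + INR (length Ms)).
Proof.
  induction 1 as [|M Ms HM H IH].
  - unfold total_shared. simpl. lra.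
  - cbn [flat_map]. rewrite length_app, plus_INR. cbn [length]. rewrite S_INR.
    assert (E : length (encode_machine M) = (2 * num_intervals M)%nat).
    { unfold encode_machine, num_intervals, ratios. cbn [length].
      rewrite length_flat_pairs, length_app, length_map. simpl. lia. }
    rewrite E. apply le_INR in HM. rewrite mult_INR, plus_INR in HM.
    rewrite mult_INR. simpl (INR 1) in HM. simpl (INR 2).
    assert (T : total_shared (M :: Ms) = INR (num_shared M) + total_shared Ms) by reflexivity.
    rewrite T. nra.
Qed.

Lemma total_shared_nonneg Ms : 0 <= total_shared Ms.
Proof.
  unfold total_shared. induction Ms as [|M Ms IH]; simpl; [lra|].
  pose proof (pos_INR (num_shared M)). unfold sum_list in *. simpl in *. lra.
Qed.

Lemma sum_lg_ge Ms : INR (length Ms) <= sum_list (map (fun M => lg (INR (num_shared M))) Ms).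
Proof.
  induction Ms as [|M Ms IH]; [simpl; lra|].
  cbn [length map]. rewrite S_INR. pose proof (lg_ge_1 (INR (num_shared M))).
  unfold sum_list in *. simpl in *. lra.
Qed.

Lemma exists_nat_ceil x : 0 <= x -> exists n, x <= INR n <= x + 1.
Proof.
  intros Hx. exists (Z.to_nat (up x)). destruct (archimed x) as [H1 H2].
  assert (0 <= up x)%Z by (apply le_IZR; lra).
  rewrite INR_IZR_INZ, Z2Nat.id by auto. lra.
Qed.

Section Bounds.

Variables (m m1 c : nat) (e0 eps : R) (Ms : list machine) (p : list R).
Hypothesis Hm1 : (1 <= m1)%nat.
Hypothesis Hm1m : (m1 <= m - 1)%nat.
Hypothesis He0 : 0 < e0 <= 1.
Hypothesis Heps : 0 < eps < 1.
Hypothesis HMs : length Ms = m.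
Hypothesis Hc : Forall (fun M => (num_intervals M <= c * (num_shared M + 1))%nat) Ms.
Hypothesis Hne : p <> [].
Hypothesis Hp : Forall (fun x => 0 < x) p.

Let E := INR m ^ 2 / (eps * e0 * INR m1).
Let Y := INR m / (eps * e0).
Let q := q0 m m1 eps e0.
Let nb := length (kept q (max_list p) 0 p).
Let B := length (above (q * sum_list p) p).
Let N := total_shared Ms.
Let input := encode_input m1 e0 eps (max_list p) Ms.

(** [E] is [1 / (2 q)] and [Y] is the argument of the logarithm in the space bound. They differ by
    the factor [m / m1], which lies between 1 and [m <= Y]. So [ln E] is at most of the order of
    [lg Y], and [m] and the number of guesses are at most of the order of [E]. *)
Lemma sizes_order : 2 <= INR m /\ INR m <= Y /\ Y <= E /\ E <= Y * Y.
Proof.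
  destruct (INR_machines m m1 Hm1 Hm1m) as [M1 M2]. assert (0 < eps * e0 <= 1) by nra.
  assert (EY : E = Y * (INR m / INR m1)) by (unfold E, Y; field; lra).
  assert (R1 : 1 <= INR m / INR m1 <= INR m).
  { split; apply Rmult_le_reg_r with (INR m1); try lra;
      unfold Rdiv; rewrite Rmult_assoc, Rinv_l by lra; nra. }
  assert (YM : INR m <= Y).
  { unfold Y. apply Rmult_le_reg_r with (eps * e0); [lra|].
    unfold Rdiv; rewrite Rmult_assoc, Rinv_l by lra; nra. }
  rewrite EY. repeat split; auto; nra.
Qed.

Lemma q_inv : 1 / q = 2 * E.
Proof.
  destruct (INR_machines m m1 Hm1 Hm1m) as [M1 M2]. unfold q, E, q0.
  field. repeat split; lra.
Qed.

Lemma q_pos : 0 < q < 1.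
Proof. apply q0_bounds; auto. Qed.

Lemma q_E : q * (2 * E) = 1.
Proof. rewrite <- q_inv. pose proof q_pos. field. lra. Qed.

Lemma kept_bound : INR nb <= 1 + 8 * E * ln (2 * E).
Proof.
  pose proof q_pos. pose proof q_inv as QI.
  replace (8 * E) with (4 / q) by (rewrite <- (Rmult_1_r 4); unfold Rdiv in *; lra).
  rewrite <- QI. apply kept_length; auto; [lra| |].
  - apply Forall_forall. intros x Hx. split; [rewrite Forall_forall in Hp; auto|].
    apply max_list_ge; auto.
  - destruct p as [|x p']; [tauto|]. inversion Hp; subst.
    eapply Rlt_le_trans; [|apply max_list_ge; left; reflexivity]. auto.
Qed.

Lemma ln_E : ln (2 * E) <= 3 * lg Y.
Proof.
  destruct sizes_order as (S1 & S2 & S3 & S4). pose proof ln_2_bounds.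
  assert (ln (2 * E) <= ln 2 + (ln Y + ln Y)).
  { rewrite <- !ln_mult by nra.
    destruct (Req_dec (2 * E) (2 * (Y * Y))) as [->|]; [lra|].
    left; apply ln_increasing; nra. }
  assert (ln 2 <= ln Y).
  { destruct (Req_dec Y 2) as [->|]; [lra|]. left; apply ln_increasing; lra. }
  pose proof (lg_ge_ln Y ltac:(lra)). lra.
Qed.

Lemma big_bound : INR B <= 2 * E.
Proof.
  pose proof q_pos. pose proof (above_count (q * sum_list p) p Hp) as C. fold B in C.
  assert (0 < sum_list p) by (apply sum_list_pos; auto).
  pose proof q_E. pose proof (pos_INR B).
  assert (INR B * q <= 1).
  { apply Rmult_le_reg_r with (sum_list p); [auto|]. lra. }
  assert (INR B * (q * (2 * E)) <= 2 * E).
  { destruct sizes_order as (S1 & S2 & S3 & S4). nra. }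
  rewrite H1, Rmult_1_r in H4. exact H4.
Qed.

Lemma input_length : INR (length input) <= 6 + 2 * INR c * (N + INR m).
Proof.
  unfold input, encode_input. rewrite length_app, plus_INR, <- HMs.
  pose proof (encode_machines_length c Ms Hc). unfold N. simpl (length _).
  replace (INR 6) with 6 by (simpl; lra). lra.
Qed.

(** A crude constant that depends on [c] only and serves for space, time and exponent alike. It is a
    product because literals of type [nat] are unary. *)
Definition constant : nat := (1000 * 500 * (c + 1))%nat.

Lemma INR_constant : INR constant = 500000 * (INR c + 1).
Proof.
  unfold constant. rewrite !mult_INR, plus_INR.
  rewrite (INR_IZR_INZ 1000), (INR_IZR_INZ 500). simpl. lra.
Qed.

Lemma space_enough :
  INR (space (length input) m nb) <= INR constant * space_bound m m1 N eps e0.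
Proof.
  rewrite INR_constant. unfold space_bound. fold E Y.
  unfold space. rewrite !plus_INR, !mult_INR.
  replace (INR 20) with 20 by (simpl; lra). replace (INR 9) with 9 by (simpl; lra).
  replace (INR 3) with 3 by (simpl; lra).
  destruct sizes_order as (S1 & S2 & S3 & S4).
  pose proof input_length. pose proof kept_bound. pose proof ln_E. pose proof (lg_ge_1 Y).
  pose proof (total_shared_nonneg Ms). fold N in H3. pose proof (pos_INR c).
  set (l := lg Y) in *. clearbody l.
  assert (E * ln (2 * E) <= E * (3 * l)) by (apply Rmult_le_compat_l; lra).
  assert (1 <= E * l) by nra. assert (INR m <= E * l) by nra.
  assert (INR c * INR m <= INR c * (E * l)) by (apply Rmult_le_compat_l; lra).
  assert (0 <= INR c * N) by nra. assert (0 <= INR c * (E * l)) by nra.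
  nra.
Qed.

Variable rounds : nat.
Hypothesis Hrounds : 2 * INR m / (eps * e0) <= INR rounds <= 2 * INR m / (eps * e0) + 1.

(** Each guess goes through at most [m ^ (2 E)] assignments. The guesses and the checks contribute a
    factor of order [E * E], which [square_le_Rpower] hides in another [m ^ (2 E)]; the kept jobs
    add a term of order [E * E]. The power [m ^ (4 E)] stays below the one in [t1_bound] since [lg]
    is at least 1, and the same holds for the remaining factors. *)
Lemma time_enough :
  INR (total_time m m1 e0 eps Ms p rounds) <=
  INR constant * (N + t1_bound (INR constant) m m1 Ms eps e0).
Proof.
  destruct sizes_order as (S1 & S2 & S3 & S4).
  pose proof kept_bound as KB. pose proof big_bound as BB. pose proof input_length as IL.
  pose proof (total_shared_nonneg Ms) as N0. fold N in N0. pose proof (pos_INR c) as C0.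
  set (Z := Rpower (INR m) (2 * E)).
  assert (Z1 : 1 <= Z).
  { unfold Z. rewrite <- (Rpower_O (INR m)) by lra. apply Rpower_mono_exponent; lra. }
  assert (mB : INR (m ^ B) <= Z).
  { rewrite pow_INR, <- Rpower_pow by lra. apply Rpower_mono_exponent; lra. }
  assert (Ah : INR (ahead (fun i => intervals (nth_machine Ms i)) m) <= INR c * (N + INR m)).
  { pose proof (ahead_le_input Ms) as A. rewrite HMs in A. apply le_INR in A.
    rewrite mult_INR in A. pose proof (encode_machines_length c Ms Hc).
    rewrite HMs in H. simpl (INR 2) in A. unfold N. lra. }
  assert (Rn : INR rounds <= 3 * E).
  { unfold Y in S3. replace (2 * INR m / (eps * e0)) with (2 * (INR m / (eps * e0))) in Hrounds
      by (field; lra). fold Y in S3, Hrounds. lra. }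
  assert (Nb : INR nb <= 17 * (E * E)).
  { pose proof (ln_le_self (2 * E) ltac:(lra)).
    assert (E * ln (2 * E) <= E * (2 * E)) by (apply Rmult_le_compat_l; lra). nra. }
  pose proof (pos_INR (m ^ B)) as mB0. pose proof (pos_INR B) as B0.
  pose proof (pos_INR rounds) as R0.
  assert (EE : 1 <= E * E) by nra. assert (EEZ : E * E <= E * E * Z) by nra.
  assert (EZ : E <= E * Z) by nra. assert (EEE : E <= E * E) by nra.
  assert (In : 1 + INR m + INR (m ^ B) * (INR m + INR B + 1) <= 6 * (E * Z)).
  { assert (INR (m ^ B) * (INR m + INR B + 1) <= Z * (4 * E)).
    { apply Rmult_le_compat; lra. }
    lra. }
  assert (Rounds : INR rounds * (1 + INR m + INR (m ^ B) * (INR m + INR B + 1)) <= 18 * (E * E * Z)).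
  { replace (18 * (E * E * Z)) with (3 * E * (6 * (E * Z))) by ring.
    assert (0 <= INR (m ^ B) * (INR m + INR B + 1)) by nra.
    apply Rmult_le_compat; lra. }
  assert (Total : INR (total_time m m1 e0 eps Ms p rounds) <=
                  3000 * INR c * N + 3000 * (37 + INR c) * (E * E * Z)).
  { unfold total_time. fold q nb B. rewrite mult_INR, !plus_INR, mult_INR, !plus_INR, mult_INR, !plus_INR.
    rewrite (INR_IZR_INZ 3000). simpl (IZR (Z.of_nat 3000)). simpl (INR 1).
    assert (INR c * INR m <= INR c * (E * E * Z)) by (apply Rmult_le_compat_l; lra).
    lra. }
  set (K := INR constant). assert (EK : K = 500000 * (INR c + 1)) by apply INR_constant.
  unfold t1_bound. fold K.
  set (l := lg (INR m / (eps * e0 * INR m1))). set (l' := lg (1 / eps * lg (INR m / e0))).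
  set (sl := sum_list (map (fun M => lg (INR (num_shared M))) Ms)).
  assert (l1 : 1 <= l) by apply lg_ge_1. assert (l'1 : 1 <= l') by apply lg_ge_1.
  assert (sl1 : 1 <= sl) by (pose proof (sum_lg_ge Ms); rewrite HMs in H; unfold sl; lra).
  fold E.
  assert (Big : Rpower (INR m) (4 * E) <= Rpower (INR m) (K * (E * l))).
  { apply Rpower_mono_exponent; [lra|]. assert (E <= E * l) by nra.
    assert (4 <= K) by lra. nra. }
  assert (Sq : E * E * Z <= 4 * Rpower (INR m) (4 * E)).
  { replace (4 * E) with (2 * E + 2 * E) at 1 by ring. rewrite Rpower_plus. fold Z.
    pose proof (square_le_Rpower (INR m) E S1 ltac:(lra)) as SQ. fold Z in SQ. nra. }
  set (W := Rpower (INR m) (K * (E * l))) in *.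
  assert (W0 : 0 < W) by apply exp_pos.
  assert (Wl : W <= W * l' * sl).
  { assert (W <= W * l') by nra. nra. }
  assert (EEZ4 : E * E * Z <= 4 * (W * l' * sl)) by lra.
  eapply Rle_trans; [exact Total|]. rewrite EK.
  set (V := W * l' * sl) in *. clearbody V.
  assert (3000 * (37 + INR c) * (E * E * Z) <= 3000 * (37 + INR c) * (4 * V))
    by (apply Rmult_le_compat_l; lra).
  assert (0 <= INR c * N) by nra. assert (0 <= INR c * V) by nra. nra.
Qed.

End Bounds.

Theorem theorem3 :
  exists (A : two_pass_algorithm) (d : nat),
  forall c : nat, exists K : nat,
  forall (m m1 : nat) (e0 eps : R) (Ms : list machine) (p : list R),
    (1 <= m1)%nat -> (m1 <= m - 1)%nat ->
    0 < e0 <= 1 ->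
    0 < eps < 1 ->
    length Ms = m ->
    Forall valid_machine Ms ->
    Forall (fun M => (num_intervals M <= c * (num_shared M + 1))%nat) Ms ->
    Forall (fun M => Forall (fun e => e0 <= e) (ratios M)) (firstn m1 Ms) ->
    p <> nil ->
    Forall (fun pj => 0 < pj) p ->
    exists (sp t : nat) (sigma : list nat) (s : schedule),
      run A (encode_input m1 e0 eps (max_list p) Ms) p sp d t sigma /\
      INR sp <= INR K * space_bound m m1 (total_shared Ms) eps e0 /\
      INR t <= INR K * (total_shared Ms + t1_bound (INR K) m m1 Ms eps e0) /\
      realizes sigma s /\
      feasible Ms p s /\
      (forall Copt, optimal_makespan Ms p Copt ->
         makespan p s <= (1 + eps) * Copt).
Proof.
  exists algorithm, pass_cost. intros c. exists (constant c).
  intros m m1 e0 eps Ms p Hm1 Hm1m He0 Heps HMs valid Hc fast Hne Hp.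
  assert (Y0 : 0 <= 2 * INR m / (eps * e0)).
  { apply Rle_mult_inv_pos; [pose proof (pos_INR m); lra | nra]. }
  (* The number of rounds belongs to the analysis; the program has no rounding operation and simply
     loops until a guess is accepted. *)
  destruct (exists_nat_ceil _ Y0) as [rounds Hrounds].
  destruct (algorithm_run m m1 e0 eps Ms p Hm1 Hm1m He0 Heps HMs valid fast Hne Hp rounds
              (proj1 Hrounds)) as (t & sigma & k & Hrun & Ht & Ls & Vs & Lo & Hk).
  assert (Vs' : Forall (fun i => (i < length Ms)%nat) sigma) by (rewrite HMs; exact Vs).
  eexists _, t, sigma, (list_schedule Ms p sigma).
  split; [exact Hrun|]. split; [|split; [|split; [|split]]].
  - apply space_enough; auto.
  - eapply Rle_trans; [apply le_INR; exact Ht|]. apply time_enough; auto.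
  - apply list_schedule_realizes; auto.
  - apply list_schedule_feasible; auto.
  - intros C HC. eapply approximation with (m := m) (m1 := m1) (e0 := e0); eauto.
Qed.
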